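(* For every non-trivial knot type $[K]$, $$e_{sh}[K] \ge \frac{3\,e_L[K]+30}{8}.$$
   Context: The cubic lattice is the point lattice $\mathbb{Z}^3\subset\mathbb{R}^3$ with basis $x=\langle 1,0,0\rangle$, $y=\langle 0,1,0\rangle$, $z=\langle 0,0,1\rangle$. The simple hexagonal lattice (sh-lattice) is the set of integer combinations of $x=\langle 1,0,0\rangle$, $y=\langle \tfrac12,\tfrac{\sqrt3}{2},0\rangle$, $w=\langle 0,0,1\rangle$; in the sh-lattice one also sets $z=y-x=\langle -\tfrac12,\tfrac{\sqrt3}{2},0\rangle$. An edge is a unit-length segment joining two lattice points that differ by $\pm x,\pm y,\pm z$ in the cubic lattice, or by $\pm x,\pm y,\pm z,\pm w$ in the sh-lattice. A polygon (lattice knot) in one of these lattices is a non-self-intersecting closed polygonal path made of edges of that lattice; a stick of a polygon is a maximal line segment of it parallel to one of these directions, and is called an $x$-, $y$-, $z$- or $w$-stick accordingly. A $w$-level of a sh-lattice polygon is a plane perpendicular to $w$ that contains $x$-, $y$- or $z$-sticks of the polygon; the polygon is properly leveled with respect to $w$ if on each $w$-level these sticks form a single connected polygonal arc. Likewise, a $z$-level of a cubic lattice polygon is a plane perpendicular to $z$ that contains $x$- or $y$-sticks of the polygon, and the polygon is properly leveled with respect to $z$ if on each $z$-level these sticks form a single connected polygonal arc. All cubic lattice polygons are assumed properly leveled with respect to $z$, and all sh-lattice polygons are assumed properly leveled with respect to $w$. The edge length of a polygon is its total number of edges. $e_L[K]$ (respectively $e_{sh}[K]$) is the minimum edge length over all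 such polygons in the cubic lattice (respectively sh-lattice) representing the knot type $[K]$. *)

(* Defs.v *)
From mathcomp Require Import all_boot all_order all_algebra.
From mathcomp Require Import all_classical all_reals all_analysis.

Set Implicit Arguments.
Unset Strict Implicit.
Unset Printing Implicit Defensive.

Import Order.TTheory GRing.Theory Num.Theory.
Import numFieldNormedType.Exports.

Local Open Scope classical_set_scope.
Local Open Scope ring_scope.

Definition vec3 {R : realType} (a b c : R) : 'rV[R]_3 :=
  \row_(i < 3) [:: a; b; c]`_i.

Definition height {R : realType} (v : 'rV[R]_3) : R := v ord0 (inord 2).

(** * Closed polygonal paths

    A closed polygonal path is given by the cyclic sequence [p] of its
    vertices; its edge number [i] runs from the [i]-th vertex to the next one,
    the last edge returning to vertex 0. *)

Definition edge_src {R : realType} (p : seq 'rV[R]_3) (i : nat) : 'rV[R]_3 :=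
  p`_i.

Definition edge_tgt {R : realType} (p : seq 'rV[R]_3) (i : nat) : 'rV[R]_3 :=
  (rot 1 p)`_i.

Definition edge_point {R : realType} (p : seq 'rV[R]_3) (i : nat) (s : R) :
    'rV[R]_3 :=
  (1 - s) *: edge_src p i + s *: edge_tgt p i.

Definition trace {R : realType} (p : seq 'rV[R]_3) : set 'rV[R]_3 :=
  [set v | exists (i : nat) (s : R),
    [/\ (i < size p)%N, 0 <= s <= 1 & v = edge_point p i s]].

(** Non-self-intersecting: the parametrisation by
    {0, ..., size p - 1} x [0, 1[ is injective. This excludes in particular the
    degenerate paths with one or two vertices. *)
Definition simple_closed {R : realType} (p : seq 'rV[R]_3) : Prop :=
  (0 < size p)%N /\
  forall (i j : nat) (s t : R), (i < size p)%N -> (j < size p)%N ->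
    0 <= s < 1 -> 0 <= t < 1 ->
    edge_point p i s = edge_point p j t -> i = j /\ s = t.

(** * Knot types *)

Definition homeomorphism {T U : topologicalType} (f : T -> U) : Prop :=
  continuous f /\
  exists g : U -> T, [/\ continuous g, cancel f g & cancel g f].

Definition ambient_isotopic {R : realType} (K K' : set 'rV[R]_3) : Prop :=
  exists H : R -> 'rV[R]_3 -> 'rV[R]_3,
  [/\ {within `[0, 1] `*` [set: 'rV[R]_3],
        continuous (fun q : R * 'rV[R]_3 => H q.1 q.2)},
      forall t : R, 0 <= t <= 1 -> homeomorphism (H t),
      H 0 = id
    & H 1 @` K = K'].

Definition tame_knot {R : realType} (K : set 'rV[R]_3) : Prop :=
  exists2 p, simple_closed p & ambient_isotopic (trace p) K.

Definition round_circle {R : realType} : set 'rV[R]_3 :=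
  [set v | exists a b : R, a ^+ 2 + b ^+ 2 = 1 /\ v = vec3 a b 0].

Definition trivial_knot {R : realType} (K : set 'rV[R]_3) : Prop :=
  ambient_isotopic K round_circle.

(** * Lattice polygons

    Both lattices have the vertical direction [e_z] (called z in the cubic
    lattice, w in the sh-lattice), and [hor] lists the remaining directions,
    which are all horizontal. *)

Definition e_x (R : realType) : 'rV[R]_3 := vec3 1 0 0.
Definition e_y (R : realType) : 'rV[R]_3 := vec3 0 1 0.
Definition e_z (R : realType) : 'rV[R]_3 := vec3 0 0 1.
Definition sh_y (R : realType) : 'rV[R]_3 := vec3 (1 / 2) (Num.sqrt 3 / 2) 0.

Definition point_lattice {R : realType} (a b c : 'rV[R]_3) : set 'rV[R]_3 :=
  [set v | exists i j k : int, v = i%:~R *: a + j%:~R *: b + k%:~R *: c].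

Definition cubic_lattice {R : realType} : set 'rV[R]_3 :=
  point_lattice (e_x R) (e_y R) (e_z R).

Definition sh_lattice {R : realType} : set 'rV[R]_3 :=
  point_lattice (e_x R) (sh_y R) (e_z R).

Definition cubic_hor (R : realType) : seq 'rV[R]_3 := [:: e_x R; e_y R].

Definition sh_hor (R : realType) : seq 'rV[R]_3 :=
  [:: e_x R; sh_y R; sh_y R - e_x R].

Definition is_edge {R : realType} (D : seq 'rV[R]_3) : rel 'rV[R]_3 :=
  fun u v => (v - u \in D) || (u - v \in D).

Definition lattice_polygon {R : realType} (L : set 'rV[R]_3)
    (hor : seq 'rV[R]_3) (p : seq 'rV[R]_3) : Prop :=
  [/\ simple_closed p,
      forall v, v \in p -> L v
    & cycle (is_edge (e_z R :: hor)) p].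

(** Edge [i] of [p] is part of a horizontal stick lying in the plane of
    height [h]. Sticks being maximal straight runs of edges, the horizontal
    sticks in that plane and these edges have the same union. *)
Definition level_edge {R : realType} (hor : seq 'rV[R]_3) (p : seq 'rV[R]_3)
    (h : R) (i : nat) : Prop :=
  is_edge hor (edge_src p i) (edge_tgt p i) /\ height (edge_src p i) = h.

(** The edges in a level form a single arc: once the starting vertex of the
    cyclic sequence [p] is well chosen, they are exactly its first [k] edges.
    The bound on [k] makes this an arc rather than the whole closed polygon. *)
Definition properly_leveled {R : realType} (hor : seq 'rV[R]_3)
    (p : seq 'rV[R]_3) : Prop :=
  forall h : R,
    (exists i, (i < size p)%N /\ level_edge hor p h i) ->
    exists r k : nat, (k < size p)%N /\
      forall i, (i < size p)%N -> (level_edge hor (rot r p) h i <-> (i < k)%N).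

(** * Minimum edge lengths

    The edge length of a polygon is its number [size p] of edges. *)

Definition representatives {R : realType} (L : set 'rV[R]_3)
    (hor : seq 'rV[R]_3) (K : set 'rV[R]_3) : set (seq 'rV[R]_3) :=
  [set p | [/\ lattice_polygon L hor p, properly_leveled hor p
             & ambient_isotopic (trace p) K]].

(** The infimum of a non-empty set of natural numbers is its minimum (see
    [min_edge_lengthP]); extended reals make the definition total. *)
Definition min_edge_length {R : realType} (L : set 'rV[R]_3)
    (hor : seq 'rV[R]_3) (K : set 'rV[R]_3) : \bar R :=
  ereal_inf [set (size p)%:R%:E | p in representatives L hor K].

Definition e_L {R : realType} (K : set 'rV[R]_3) : \bar R :=
  min_edge_length cubic_lattice (cubic_hor R) K.

Definition e_sh {R : realType} (K : set 'rV[R]_3) : \bar R :=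
  min_edge_length sh_lattice (sh_hor R) K.

Lemma min_edge_lengthP {R : realType} (L : set 'rV[R]_3)
    (hor : seq 'rV[R]_3) (K : set 'rV[R]_3) :
  representatives L hor K !=set0 ->
  exists p, [/\ representatives L hor K p,
    forall q, representatives L hor K q -> (size p <= size q)%N
    & min_edge_length L hor K = (size p)%:R%:E].
Proof.
move=> [p0 p0K].
pose P n := `[< exists2 p, representatives L hor K p & size p = n >].
have exP : exists n, P n by exists (size p0); apply/asboolP; exists p0.
case: (ex_minnP exP) => n /asboolP[p pK <-] pmin.
have le_p q : representatives L hor K q -> (size p <= size q)%N.
  by move=> qK; apply: pmin; apply/asboolP; exists q.
exists p; split=> //; apply/eqP; rewrite eq_le; apply/andP; split.
  by apply: ereal_inf_lbound; exists p.
by apply: le_ereal_inf_tmp => _ [q qK <-]; rewrite lee_fin ler_nat le_p.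
Qed.

(* Main.v *)
Require Import Defs.
From mathcomp Require Import all_boot all_order all_algebra.
From mathcomp Require Import all_classical all_reals all_analysis.
From mathcomp Require Import ring lra zify.

Set Implicit Arguments.
Unset Strict Implicit.
Unset Printing Implicit Defensive.
Import Order.TTheory GRing.Theory Num.Theory.
Import numFieldNormedType.Exports.
Local Open Scope classical_set_scope.
Local Open Scope ring_scope.

(** The proof turns a shortest polygon [p] of the sh-lattice into a polygon of
    the cubic lattice that has the same knot type and at most
    [(8 * size p - 30) / 3] edges.

    A linear map takes the sh-lattice to the cubic one, but it takes one of
    the three horizontal directions to the diagonal of a unit square. So the
    image is stretched by the factor 2 in the two horizontal directions: a
    vertical edge keeps its length, an edge in a lattice direction becomes two
    edges, and a doubled diagonal edge can be followed by a staircase of four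
    edges around its midpoint ([stair]). A staircase could overlap a
    neighbouring edge, but only at a corner of 45 degrees, which is then cut
    off. The rotation of the sh-lattice by 60 degrees permutes the three
    horizontal directions, so that the diagonal edges can be assumed to be at
    most a third of the horizontal ones ([few_diagonals]). With [v] vertical
    edges among [n], the new polygon has therefore at most [v + 8 * (n - v) /
    3] edges, which is [(8 * n - 5 * v) / 3].

    It remains to see that [v] is at least 6 when the knot is not trivial
    ([few_vertical_trivial]). With at most five vertical edges, the heights
    along the polygon go up once and down once, through at most three
    levels. Because each level contains a single arc, one of the two ways
    between the lowest and the highest level is straight, and the polygon climbs
    from one end of a vertical segment to the other. It is then contracted, edge
    after edge, to a triangle with a vertical side ([fan_trivial]).

    All isotopies are generated by one construction: pushing the points of space
    along a fixed direction by an amount that does not decrease too fast in this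
    direction ([ambient_isotopic_push]). Shears are such pushes; so is the
    replacement of one side of a triangle by the two others ([delta_move]), by
    which diagonals are replaced with staircases and polygons are contracted;
    and two such pushes make a round circle out of a triangle
    ([tri_standard_trivial]). *)

(** * Pushing along a direction *)

Section Push.
Variables (R : realType) (V : normedModType R).
Implicit Types (q u : V).

(** Pushing along a fixed direction [u] by an amount [h] that does not
    decrease too fast along [u] maps every line parallel to [u] increasingly
    onto itself. Solving [s = h (q - s u)] for [s] inverts the map, and the
    gap [1 - kappa] makes the solution depend continuously on [q]. *)
Lemma homeomorphism_push (u : V) (h : V -> R) (kappa : R) :
  continuous h -> kappa < 1 ->
  (forall q s, 0 <= s -> h q - kappa * s <= h (q + s *: u)) ->
  homeomorphism (fun q => q + h q *: u).
Proof.
move=> ch k1 hh.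
pose psi q s := s - h (q - s *: u).
have psi_incr q s s' : s <= s' -> (1 - kappa) * (s' - s) <= psi q s' - psi q s.
  move=> ss'; have /hh : 0 <= s' - s by lra.
  move=> /(_ (q - s' *: u)).
  have -> : q - s' *: u + (s' - s) *: u = q - s *: u.
    by rewrite scalerBl addrA subrK.
  rewrite /psi; lra.
have cpsi q : continuous (psi q).
  move=> s; apply: cvgB; first exact: cvg_id.
  apply: (@cvg_comp _ _ _ (fun s => q - s *: u) h _ (nbhs (q - s *: u))); last exact: ch.
  apply: cvgB; first exact: cvg_cst.
  by apply: cvgZr_tmp; exact: cvg_id.
have /choice [sg sgP] : forall q, exists s, psi q s = 0.
  move=> q; pose b := `|psi q 0| / (1 - kappa).
  have b0 : 0 <= b by rewrite divr_ge0 //; lra.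
  have bE : (1 - kappa) * b = `|psi q 0| by rewrite /b; field; lra.
  have hb := psi_incr q 0 b b0.
  have hNb := psi_incr q (- b) 0 ltac:(lra).
  have [|c _ ec] := @IVT R (psi q) (- b) b 0 ltac:(lra)
    (continuous_subspaceT (cpsi q)).
    rewrite ge_min le_max; apply/andP; split; apply/orP.
      left; move: (ler_norm (psi q 0)) (ler_norm (- psi q 0)); rewrite normrN; lra.
    right; move: (ler_norm (psi q 0)) (ler_norm (- psi q 0)); rewrite normrN; lra.
  by exists c.
have psi_inj q s s' : psi q s = psi q s' -> s = s'.
  move=> e; case: (lerP s s') => ss'.
    by have := psi_incr q _ _ ss'; rewrite e subrr => ?; nra.
  by have := psi_incr q _ _ (ltW ss'); rewrite e subrr => ?; nra.
split.
  move=> q; apply: cvgD.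
    exact: cvg_id.
  by apply: cvgZr_tmp; exact: ch.
exists (fun q => q - sg q *: u); split.
- suff csg : continuous sg.
    move=> q; apply: cvgB.
      exact: cvg_id.
    by apply: cvgZr_tmp; exact: csg.
  move=> q0; apply/cvgrPdist_lt => e e0.
  have ch0 : continuous (fun q => h (q - sg q0 *: u)).
    move=> q; apply: (@cvg_comp _ _ _ (fun q => q - sg q0 *: u) h _ (nbhs (q - sg q0 *: u))); last exact: ch.
    by apply: cvgB; [exact: cvg_id|exact: cvg_cst].
  have /cvgrPdist_lt /(_ ((1 - kappa) * e)) := ch0 q0.
  have ke : 0 < (1 - kappa) * e by nra.
  move=> /(_ ke) nq; apply: (@filterS _ (nbhs q0) _ _ _ _ nq) => q.
  have := sgP q0; have := sgP q; rewrite {2}/psi => sq sq0.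
  have e1 : psi q (sg q0) = h (q0 - sg q0 *: u) - h (q - sg q0 *: u).
    by move: sq0; rewrite /psi; lra.
  rewrite -e1 /= => lt.
  case: (lerP (sg q0) (sg q)) => le.
    have := psi_incr q _ _ le; rewrite sgP.
    by move: (ler_norm (- psi q (sg q0))); rewrite normrN => *; nra.
  have := psi_incr q _ _ (ltW le); rewrite sgP.
  by move: (ler_norm (psi q (sg q0))) => *; nra.
- move=> q /=; have -> : sg (q + h q *: u) = h q.
    apply: (psi_inj (q + h q *: u)); rewrite sgP /psi addrK subrr //.
  by rewrite addrK.
- move=> q /=; have := sgP q; rewrite /psi => e.
  have -> : h (q - sg q *: u) = sg q by lra.
  by rewrite subrK.
Qed.

Lemma continuous_scaled (g : V -> R) (t : R) :
  continuous g -> continuous (fun q => t * g q).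
Proof. by move=> cg q; apply: cvgM; [exact: cvg_cst|exact: cg]. Qed.

Lemma continuous_push (u : V) (g : V -> R) :
  continuous g -> continuous (fun x : R * V => x.2 + (x.1 * g x.2) *: u).
Proof.
move=> cg -[t q] /=; apply: cvgD; first exact: cvg_snd.
apply: cvgZr_tmp; apply: cvgM; first exact: cvg_fst.
by apply: (@cvg_comp _ _ _ snd g _ (nbhs q)); [exact: cvg_snd|exact: cg].
Qed.

End Push.

Section Isotopy.
Variable R : realType.
Notation V := 'rV[R]_3.
Implicit Types (A B C : set V) (q u : V).

Lemma homeomorphism_comp (T U W : topologicalType) (f : T -> U) (g : U -> W) :
  homeomorphism f -> homeomorphism g -> homeomorphism (g \o f).
Proof.
move=> [cf [f' [cf' fK f'K]]] [cg [g' [cg' gK g'K]]]; split.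
  by move=> x; apply: continuous_comp; [exact: cf|exact: cg].
exists (f' \o g'); split.
- by move=> x; apply: continuous_comp; [exact: cg'|exact: cf'].
- by move=> x /=; rewrite gK fK.
- by move=> x /=; rewrite f'K g'K.
Qed.

Lemma within_continuousE (T U : topologicalType) (D : set T) (f : T -> U) :
  {within D, continuous f} <->
  forall x, D x -> forall W, nbhs (f x) W -> nbhs x [set y | D y -> W (f y)].
Proof.
split.
  by move/subspace_continuousP => h x Dx W /(h x Dx).
by move=> h; apply/subspace_continuousP => x Dx W /(h x Dx).
Qed.

Lemma ambient_isotopic_sym A B : ambient_isotopic A B -> ambient_isotopic B A.
Proof.
move=> [H [cH hH H0 H1]].
have [c1 [g [cg gK Kg]]] : homeomorphism (H 1) by apply: hH; rewrite ler01 lexx.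
exists (fun t q => H (1 - t) (g q)); split.
- apply/within_continuousE => -[t q] [/= t01 _] W nW.
  have t01' : `[0, 1]%classic (1 - t).
    by move: t01; rewrite /= !in_itv/= => /andP[? ?]; apply/andP; split; lra.
  have := (within_continuousE _ _).1 cH (1 - t, g q) (conj t01' I) _ nW.
  pose F (x : R * V) := (1 - x.1, g x.2).
  have cF : F x @[x --> (t, q)] --> F (t, q).
    apply: (@cvg_pair _ _ _ _ (nbhs (1 - t)) (nbhs (g q)) _ _ _
      (fun x : R * V => 1 - x.1) (fun x => g x.2)).
    + apply: cvgB; [exact: cvg_cst|exact: cvg_fst].
    + apply: (@cvg_comp _ _ _ snd g _ (nbhs q)); [exact: cvg_snd|exact: cg].
  move=> /cF nF; apply: (@filterS _ (nbhs (t, q)) _ _ _ _ nF) => -[s r] /= h [sI _]; apply: h; split=> //.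
  by move: sI; rewrite /= !in_itv/= => /andP[? ?]; apply/andP; split; lra.
- move=> t t01; apply: (@homeomorphism_comp _ _ _ g (H (1 - t))).
    by split=> //; exists (H 1).
  by apply: hH; move: t01 => /andP[? ?]; apply/andP; split; lra.
- by apply/funext => q; rewrite subr0 Kg.
- rewrite subrr H0 -H1; apply/seteqP; split=> [q [_ [r Ar <-] <-]|q Aq] /=.
    by rewrite gK.
  by exists (H 1 q); [exists q|rewrite gK].
Qed.

Lemma ambient_isotopic_trans A B C :
  ambient_isotopic A B -> ambient_isotopic B C -> ambient_isotopic A C.
Proof.
move=> [H [cH hH H0 H1]] [H' [cH' hH' H'0 H'1]].
exists (fun t q => H' t (H t q)); split.
- apply/within_continuousE => -[t q] tI W nW.
  have tI' : (`[0, 1]%classic `*` setT) (t, H t q) by case: tI.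
  have := (within_continuousE _ _).1 cH' (t, H t q) tI' _ nW.
  case=> -[/= P Q] [nP nQ] PQ.
  have h1 := (within_continuousE _ _).1 cH (t, q) tI _ nQ.
  have h2 : nbhs (t, q) [set y : R * V | P y.1] by apply: cvg_fst.
  near=> y => yI.
  apply: (PQ (y.1, H y.1 y.2)); last by case: yI.
  split=> /=; first by near: y.
  by move: yI; near: y.
- move=> t t01; apply: (@homeomorphism_comp _ _ _ (H t) (H' t)); auto.
- by rewrite H0 H'0.
- by rewrite -H'1 -H1 image_comp.
Unshelve. all: by end_near. Qed.

Lemma ambient_isotopic_push (u : V) (g : V -> R) (kappa : R) A :
  continuous g -> 0 <= kappa < 1 ->
  (forall q s, 0 <= s -> g q - kappa * s <= g (q + s *: u)) ->
  ambient_isotopic A ((fun q => q + g q *: u) @` A).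
Proof.
move=> cg /andP[k0 k1] hg.
exists (fun t q => q + (t * g q) *: u); split.
- by apply: continuous_subspaceT; exact: (@continuous_push R V).
- move=> t /andP[t0 t1]; apply: (@homeomorphism_push R V u (fun q => t * g q) kappa) => //.
    exact: (@continuous_scaled R V).
  move=> q s s0; have := hg q s s0 => h.
  have ks : 0 <= kappa * s by exact: mulr_ge0.
  nra.
- by apply/funext => q; rewrite mul0r scale0r addr0.
- by apply: eq_imagel => q _; rewrite mul1r.
Qed.

Lemma ambient_isotopic_refl A : ambient_isotopic A A.
Proof.
rewrite {2}(_ : A = (fun q => q + (fun=> 0) q *: (0 : V)) @` A); last first.
  by apply/seteqP; split=> [q Aq|q [r Ar <-]]; [exists q|]; rewrite ?scaler0 ?addr0.
apply: (@ambient_isotopic_push 0 (fun=> 0) 0).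
- exact: cst_continuous.
- by rewrite lexx ltr01.
- by move=> *; rewrite mul0r subr0.
Qed.

End Isotopy.

(** * Tents over a triangle *)

Section Tent.
Variable R : realType.
Implicit Types (al be ga K s : R).

(** In the coordinates of [delta_move], the triangle has the vertices
    (-1,0,0), (1,0,0) and (0,1,0). *)
Definition in_tri al be ga := [/\ ga = 0, 0 <= be & `|al| + be <= 1].

(** Pushing by [tent] in the second direction maps the base [be = 0] to the
    two other sides. Its support shrinks to the triangle when [K] grows, while
    its slopes in that direction stay above [- K / (K + 1) > -1]. *)
Definition tent K al be ga :=
  Num.max 0 (Num.min (1 - `|al| - K * `|ga| + K * be)
                     (1 - `|al| - K * `|ga| - K / (K + 1) * be)).

Lemma tent_ge0 K al be ga : 0 <= tent K al be ga.
Proof. by rewrite /tent le_max lexx. Qed.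

Lemma tent_gt0 K al be ga : 0 < K -> 0 < tent K al be ga ->
  [/\ `|al| < 1, K * `|ga| < 1 - `|al|, - (K * be) < 1 - `|al|
    & K * (`|al| + be - 1) < 1 - `|al|].
Proof.
move=> K0; rewrite /tent lt_max ltxx /= lt_min => /andP[h1 h2].
have K1 : 0 < K + 1 by lra.
have ek : (K + 1) * (K / (K + 1) * be) = K * be by field; lra.
have k1 : 0 <= K / (K + 1) by rewrite divr_ge0 //; lra.
have h3 : 0 < (K + 1) * (1 - `|al| - K * `|ga| - K / (K + 1) * be).
  by rewrite mulr_gt0.
have g0 : 0 <= K * `|ga| by rewrite mulr_ge0 // ltW.
have gK : 0 <= K * (K * `|ga|) by rewrite mulr_ge0 // ltW.
have t0 : 0 < 1 - `|al| - K * `|ga|.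
  case: (lerP 0 be) => b0.
    have : 0 <= K / (K + 1) * be by apply: mulr_ge0.
    lra.
  have : 0 <= K * (- be) by rewrite mulr_ge0 //; lra.
  lra.
split; nra.
Qed.

(** Near an endpoint of the base, the support is contained in a cone; a
    segment that starts there and leaves the triangle leaves the cone, too,
    once the cone is close enough to the triangle. *)
Lemma tent_off_corner (al1 be1 ga1 : R) :
  (forall s, 0 <= s <= 1 ->
    in_tri ((1 - s) * -1 + s * al1) (s * be1) (s * ga1) ->
    `|(1 - s) * -1 + s * al1| = 1) ->
  exists2 K0, 0 < K0 & forall K s, K0 <= K -> 0 <= s <= 1 ->
    tent K ((1 - s) * -1 + s * al1) (s * be1) (s * ga1) = 0.
Proof.
move=> out.
pose r := al1 + 1.
have eal s : (1 - s) * -1 + s * al1 = -1 + s * r by rewrite /r; ring.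
have main (dl : R) : 0 < dl -> (0 < r -> dl <= `|ga1| \/ dl <= - be1 \/ dl <= be1 - r) ->
    exists2 K0, 0 < K0 & forall K s, K0 <= K -> 0 <= s <= 1 ->
    tent K ((1 - s) * -1 + s * al1) (s * be1) (s * ga1) = 0.
  move=> dl0 far; exists ((`|r| + 1) / dl); first by rewrite divr_gt0.
  move=> K s; rewrite ler_pdivrMr // => KK /andP[s0 s1]; apply/eqP.
  rewrite eq_le tent_ge0 andbT leNgt; apply/negP.
  have K0 : 0 < K by rewrite -(pmulr_lgt0 _ dl0) (lt_le_trans _ KK).
  move=> /(tent_gt0 K0)[]; rewrite eal.
  rewrite (normrM s) (ger0_norm s0) => h1 h2 h3 h4.
  have nr : - (-1 + s * r) <= `|-1 + s * r| by rewrite -normrN ler_norm.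
  have sr : 0 < s * r by lra.
  have sp : 0 < s by case: (ltgtP 0 s) => // [|e]; [lra|move: sr; rewrite -e mul0r ltxx].
  have rp : 0 < r by move: sr; rewrite pmulr_rgt0.
  have Krd : r < K * dl by move: (ler_norm r); lra.
  have sKrd : s * r < s * (K * dl) by rewrite ltr_pM2l.
  have sK : 0 < s * K by apply: mulr_gt0.
  case: (far rp) => [f|[f|f]].
  - have : (s * K) * dl <= (s * K) * `|ga1| by rewrite ler_pM2l.
    nra.
  - have : (s * K) * dl <= (s * K) * (- be1) by rewrite ler_pM2l.
    nra.
  - have : (s * K) * dl <= (s * K) * (be1 - r) by rewrite ler_pM2l.
    nra.
have [r0|r0] := lerP r 0; first by apply: (main 1) => //; lra.
have [g0|g0] := eqVneq ga1 0; last first.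
  by apply: (main `|ga1|); [rewrite normr_gt0|move=> _; left].
have [b0|b0] := ltrP be1 0; first by apply: (main (- be1)); [lra|move=> _; right; left].
have [b1|b1] := ltrP r be1; first by apply: (main (be1 - r)); [lra|move=> _; right; right].
(* The segment runs inside the triangle near its start, which is excluded. *)
exfalso; pose s := (2 * (1 + r))^-1.
have sE : 2 * s + 2 * (s * r) = 1.
  by rewrite -[RHS](@mulVf _ (2 * (1 + r))) -/s; [ring|lra].
have s0 : 0 < s by rewrite /s invr_gt0; lra.
have sr : 0 < s * r by exact: mulr_gt0.
have sb : s * be1 <= s * r by rewrite ler_pM2l.
have sb0 : 0 <= s * be1 by rewrite mulr_ge0 // ltW.
have s01 : 0 <= s <= 1 by apply/andP; split; lra.
have tri : in_tri ((1 - s) * -1 + s * al1) (s * be1) (s * ga1).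
  rewrite eal; split=> //; first by rewrite g0 mulr0.
  by rewrite ltr0_norm; lra.
by have := out s s01 tri; rewrite eal ltr0_norm; lra.
Qed.

Lemma tent_off_end (al0 be0 ga0 al1 be1 ga1 : R) :
  (forall s, 0 <= s <= 1 ->
    in_tri ((1 - s) * al0 + s * al1) ((1 - s) * be0 + s * be1)
           ((1 - s) * ga0 + s * ga1) ->
    `|(1 - s) * al0 + s * al1| = 1) ->
  `|al0| = 1 -> be0 = 0 -> ga0 = 0 ->
  exists2 K0, 0 < K0 & forall K s, K0 <= K -> 0 <= s <= 1 ->
    tent K ((1 - s) * al0 + s * al1) ((1 - s) * be0 + s * be1)
           ((1 - s) * ga0 + s * ga1) = 0.
Proof.
move=> out a0 b0 g0; rewrite b0 g0 in out *.
have tentN K al be ga : tent K (- al) be ga = tent K al be ga.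
  by rewrite /tent normrN.
have triN al be ga : in_tri (- al) be ga = in_tri al be ga.
  by rewrite /in_tri normrN.
have [aE|aE] : al0 = -1 \/ al0 = 1.
- by move: a0; case: (ger0P al0); lra.
- have [s s01|K0 K0p h] := @tent_off_corner al1 be1 ga1.
    by have := out s s01; rewrite aE !mulr0 !add0r.
  by exists K0 => // K s KK s01; rewrite aE !mulr0 !add0r h.
- have eN s : (1 - s) * -1 + s * - al1 = - ((1 - s) * al0 + s * al1).
    by rewrite aE; ring.
  have [s s01|K0 K0p h] := @tent_off_corner (- al1) be1 ga1.
    by have := out s s01; rewrite eN triN normrN !mulr0 !add0r.
  exists K0 => // K s KK s01; rewrite !mulr0 !add0r.
  by have := h K s KK s01; rewrite eN tentN.
Qed.

(** A segment that starts or ends at a vertex of the base is handled by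
    [tent_off_end], and any other one stays away from the triangle. Hence tents
    that are steep enough leave the rest of a polygon fixed. *)
Lemma tent_off_segment (al0 be0 ga0 al1 be1 ga1 : R) :
  (forall s, 0 <= s <= 1 ->
    in_tri ((1 - s) * al0 + s * al1) ((1 - s) * be0 + s * be1)
           ((1 - s) * ga0 + s * ga1) ->
    (`|(1 - s) * al0 + s * al1| = 1 /\ (1 - s) * be0 + s * be1 = 0) /\
    (((1 - s) * al0 + s * al1, (1 - s) * be0 + s * be1, (1 - s) * ga0 + s * ga1)
      = (al0, be0, ga0) \/
     ((1 - s) * al0 + s * al1, (1 - s) * be0 + s * be1, (1 - s) * ga0 + s * ga1)
      = (al1, be1, ga1))) ->
  exists2 K0, 0 < K0 & forall K s, K0 <= K -> 0 <= s <= 1 ->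
    tent K ((1 - s) * al0 + s * al1) ((1 - s) * be0 + s * be1)
           ((1 - s) * ga0 + s * ga1) = 0.
Proof.
move=> out.
have [[t0 tb0 ta0]|nt0] := pselect (in_tri al0 be0 ga0).
  have [] := out 0 ltac:(by rewrite lexx ler01).
    by rewrite !subr0 !mul1r !mul0r !addr0.
  rewrite !subr0 !mul1r !mul0r !addr0 => -[a0 b0] _.
  by apply: tent_off_end => // s s01 /(out s s01)[[]].
have [[t1 tb1 ta1]|nt1] := pselect (in_tri al1 be1 ga1).
  have [] := out 1 ltac:(by rewrite lexx ler01).
    by rewrite subrr !mul1r !mul0r !add0r.
  rewrite subrr !mul1r !mul0r !add0r => -[a1 b1] _.
  have [|K0 K0p h] := @tent_off_end al1 be1 ga1 al0 be0 ga0 _ a1 b1 t1.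
    move=> s s01 tri.
    have [] := out (1 - s) ltac:(by move/andP: s01 => [? ?]; apply/andP; split; lra).
      by rewrite subKr ![s * _ + _]addrC.
    by rewrite subKr ![s * _ + _]addrC => -[].
  exists K0 => // K s KK s01.
  have := h K (1 - s) KK ltac:(by move/andP: s01 => [? ?]; apply/andP; split; lra).
  by rewrite subKr ![s * _ + _]addrC.
have nt s : 0 <= s <= 1 -> ~ in_tri ((1 - s) * al0 + s * al1)
    ((1 - s) * be0 + s * be1) ((1 - s) * ga0 + s * ga1).
  move=> s01 tri; have [_ [e|e]] := out s s01 tri; move: tri; case: e => -> -> ->; auto.
(* A segment that avoids the triangle stays at a positive distance from it. *)
pose F s := Num.max (Num.max (`|(1 - s) * al0 + s * al1| +
  ((1 - s) * be0 + s * be1) - 1) (- ((1 - s) * be0 + s * be1)))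
  `|(1 - s) * ga0 + s * ga1|.
have caff (x y : R) : continuous (fun s : R => (1 - s) * x + s * y).
  move=> s; apply: cvgD; apply: cvgM.
  - by apply: cvgB; [exact: cvg_cst|exact: cvg_id].
  - exact: cvg_cst.
  - exact: cvg_id.
  - exact: cvg_cst.
have cF : continuous F.
  move=> s; apply: (@continuous_max _ _ (fun s => Num.max _ _) (fun s => `| _ |)); last first.
    by apply: cvg_norm; exact: caff.
  apply: (@continuous_max _ _ (fun s => _ - 1) (fun s => - _)); last first.
    by apply: cvgN; exact: caff.
  apply: cvgB; last exact: cvg_cst.
  by apply: cvgD; [apply: cvg_norm|]; exact: caff.
have [c] := @EVT_min R F 0 1 ler01 (continuous_subspaceT cF).
rewrite in_itv /= => c01 Fmin.
have Fc : 0 < F c.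
  rewrite ltNge; apply/negP; rewrite /F !ge_max => /andP[/andP[h1 h2] h3].
  apply: (nt c c01); split; last by lra.
    by apply/eqP; rewrite -normr_le0.
  by lra.
exists (F c)^-1; first by rewrite invr_gt0.
move=> K s; rewrite -div1r ler_pdivrMr // => KK s01; apply/eqP.
rewrite eq_le tent_ge0 andbT leNgt; apply/negP.
have K0 : 0 < K by rewrite -(pmulr_lgt0 _ Fc) (lt_le_trans _ KK).
move=> /(tent_gt0 K0)[h1 h2 h3 h4].
have := Fmin s; rewrite in_itv /= => /(_ s01).
have n0 := normr_ge0 ((1 - s) * al0 + s * al1).
rewrite leNgt => /negP; apply; rewrite {1}/F !gt_max.
by rewrite -!andbA; apply/and3P; split; rewrite -(ltr_pM2l K0); lra.
Qed.

End Tent.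

(** * Coordinates and segments *)

Section Coordinates.
Variable R : realType.
Notation V := 'rV[R]_3.
Implicit Types (a b c q u v w : V) (k s x y z : R).

Definition xc v : R := v ord0 (inord 0).
Definition yc v : R := v ord0 (inord 1).
Definition zc v : R := height v.

Lemma xc_vec3 x y z : xc (vec3 x y z) = x.
Proof. by rewrite /xc /vec3 mxE inordK. Qed.
Lemma yc_vec3 x y z : yc (vec3 x y z) = y.
Proof. by rewrite /yc /vec3 mxE inordK. Qed.
Lemma zc_vec3 x y z : zc (vec3 x y z) = z.
Proof. by rewrite /zc /height /vec3 mxE inordK. Qed.
Lemma xcD v w : xc (v + w) = xc v + xc w. Proof. by rewrite /xc mxE. Qed.
Lemma ycD v w : yc (v + w) = yc v + yc w. Proof. by rewrite /yc mxE. Qed.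
Lemma zcD v w : zc (v + w) = zc v + zc w. Proof. by rewrite /zc /height mxE. Qed.
Lemma xcN v : xc (- v) = - xc v. Proof. by rewrite /xc mxE. Qed.
Lemma ycN v : yc (- v) = - yc v. Proof. by rewrite /yc mxE. Qed.
Lemma zcN v : zc (- v) = - zc v. Proof. by rewrite /zc /height mxE. Qed.
Lemma xcZ k v : xc (k *: v) = k * xc v. Proof. by rewrite /xc mxE. Qed.
Lemma ycZ k v : yc (k *: v) = k * yc v. Proof. by rewrite /yc mxE. Qed.
Lemma zcZ k v : zc (k *: v) = k * zc v. Proof. by rewrite /zc /height mxE. Qed.
Lemma xc0 : xc 0 = 0. Proof. by rewrite /xc mxE. Qed.
Lemma yc0 : yc 0 = 0. Proof. by rewrite /yc mxE. Qed.
Lemma zc0 : zc 0 = 0. Proof. by rewrite /zc /height mxE. Qed.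

Definition coordE := (xc_vec3, yc_vec3, zc_vec3, xcD, ycD, zcD,
  xcN, ycN, zcN, xcZ, ycZ, zcZ, (xc0, yc0, zc0)).

Lemma vecP v w : xc v = xc w -> yc v = yc w -> zc v = zc w -> v = w.
Proof.
move=> h0 h1 h2; apply/rowP => -[[|[|[|]]] i3] //.
- by move: h0; rewrite /xc (_ : inord 0 = Ordinal i3) //; apply/val_inj; rewrite /= inordK.
- by move: h1; rewrite /yc (_ : inord 1 = Ordinal i3) //; apply/val_inj; rewrite /= inordK.
- by move: h2; rewrite /zc /height (_ : inord 2 = Ordinal i3) //; apply/val_inj; rewrite /= inordK.
Qed.

Lemma continuous_xc : continuous xc. Proof. exact: coord_continuous. Qed.
Lemma continuous_yc : continuous yc. Proof. exact: coord_continuous. Qed.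
Lemma continuous_zc : continuous zc. Proof. exact: coord_continuous. Qed.

Definition dot w v := xc w * xc v + yc w * yc v + zc w * zc v.

Lemma dotD u v w : dot u (v + w) = dot u v + dot u w.
Proof. by rewrite /dot !coordE; ring. Qed.
Lemma dotZ k u v : dot u (k *: v) = k * dot u v.
Proof. by rewrite /dot !coordE; ring. Qed.
Lemma dotN u v : dot u (- v) = - dot u v.
Proof. by rewrite /dot !coordE; ring. Qed.

Lemma dot_eq0 v : dot v v = 0 -> [/\ xc v = 0, yc v = 0 & zc v = 0].
Proof.
rewrite /dot => /eqP; rewrite !paddr_eq0 ?addr_ge0 -?expr2 ?sqr_ge0 // !sqrf_eq0.
by case/andP=> /andP[/eqP ? /eqP ?] /eqP ?.
Qed.

Lemma continuous_affine w (d : R) : continuous (fun v => dot w v + d).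
Proof.
suff cont (T : topologicalType) (f g h : T -> R) : continuous f -> continuous g ->
    continuous h -> continuous (fun t => xc w * f t + yc w * g t + zc w * h t + d).
  by apply: cont; [exact: continuous_xc|exact: continuous_yc|exact: continuous_zc].
move=> cf cg ch t; apply: cvgD; last exact: cvg_cst.
apply: cvgD; [apply: cvgD|]; apply: cvgM; try exact: cvg_cst.
- exact: cf.
- exact: cg.
- exact: ch.
Qed.

Definition segment a b : set V :=
  [set q | exists s : R, 0 <= s <= 1 /\ q = (1 - s) *: a + s *: b].

Definition segs (l : seq (V * V)) : set V :=
  [set q | exists e, e \in l /\ segment e.1 e.2 q].

Lemma segmentC a b : segment a b = segment b a.
Proof.
suff sub v w : segment v w `<=` segment w v by apply/seteqP; split; exact: sub.
move=> q [s [s01 ->]]; move: (s01) => /andP[s0 s1]; exists (1 - s);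
  by rewrite subKr; split; [apply/andP; split; lra|exact: addrC].
Qed.

Lemma segs_nil : segs [::] = set0.
Proof. by apply/seteqP; split=> // q [e [+ _]]; rewrite in_nil. Qed.

Lemma segs_cat l l' : segs (l ++ l') = segs l `|` segs l'.
Proof.
apply/seteqP; split=> q.
  by move=> [e [+ h]]; rewrite mem_cat => /orP[el|el]; [left|right]; exists e.
by move=> [[e [el h]]|[e [el h]]]; exists e; rewrite mem_cat el ?orbT.
Qed.

Lemma segs_cons e l : segs (e :: l) = segment e.1 e.2 `|` segs l.
Proof.
rewrite -cat1s segs_cat; congr setU; apply/seteqP; split=> q.
  by move=> [e' []]; rewrite inE => /eqP ->.
by exists e; rewrite inE eqxx.
Qed.

Lemma eq_segs l l' : l =i l' -> segs l = segs l'.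
Proof. by move=> e; apply/seteqP; split=> q [x [h1 h2]]; exists x; split=> //; [rewrite -e|rewrite e]. Qed.

Lemma segment_split a b k : 0 <= k <= 1 ->
  segment a b = segment a ((1 - k) *: a + k *: b) `|` segment ((1 - k) *: a + k *: b) b.
Proof.
move=> /andP[k0 k1]; apply/seteqP; split=> [q [s [s01 ->]]|q]; first (have /andP[s0 s1] := s01).
- case: (lerP s k) => sk; [left|right].
  + have [k_0|kn] := eqVneq k 0.
      exists 0; split; first by rewrite lexx ler01.
      have -> : s = 0 by lra.
      by apply: vecP; rewrite k_0 !coordE; ring.
    exists (s / k); split.
      apply/andP; split; first by rewrite divr_ge0.
      by rewrite ler_pdivrMr; [lra|rewrite lt_neqAle eq_sym kn].
    by apply: vecP; rewrite !coordE; field.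
  + have kn : 1 - k != 0 by apply/eqP; lra.
    exists ((s - k) / (1 - k)); split.
      apply/andP; split; first by rewrite divr_ge0 //; lra.
      by rewrite ler_pdivrMr; lra.
    by apply: vecP; rewrite !coordE; field.
- case=> -[s [s01 ->]]; have /andP[s0 s1] := s01.
    exists (s * k); split; first by apply/andP; split; nra.
    by apply: vecP; rewrite !coordE; ring.
  exists (k + s * (1 - k)); split; first by apply/andP; split; nra.
  by apply: vecP; rewrite !coordE; ring.
Qed.

Definition triangle a b c : set V :=
  [set q | exists x y z : R, [/\ 0 <= x, 0 <= y, 0 <= z, x + y + z = 1
    & q = x *: a + y *: b + z *: c]].

Definition noncollinear a b c :=
  forall x y, x *: (b - a) + y *: (c - a) = 0 -> x = 0 /\ y = 0.

(** Affine coordinates in which [a], [b], [c] become (-1,0,0), (1,0,0) and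
    (0,1,0); moving along [u] changes the second one only. *)
Lemma triangle_frame a b c : noncollinear a b c ->
  exists wa wb wg u (da db dg : R),
  [/\ (dot wa u = 0 /\ dot wb u = 1) /\ dot wg u = 0,
      forall q r, dot wa q = dot wa r -> dot wb q = dot wb r ->
        dot wg q = dot wg r -> q = r,
      [/\ dot wa a + da = -1, dot wb a + db = 0 & dot wg a + dg = 0],
      [/\ dot wa b + da = 1, dot wb b + db = 0 & dot wg b + dg = 0]
    & [/\ dot wa c + da = 0, dot wb c + db = 1 & dot wg c + dg = 0] ].
Proof.
move=> nc.
have [d1 d1E] : exists d, d = b - a by exists (b - a).
have [d2 d2E] : exists d, d = c - a by exists (c - a).
rewrite /noncollinear -d1E -d2E in nc.
pose cross v w := vec3 (yc v * zc w - zc v * yc w) (zc v * xc w - xc v * zc w)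
  (xc v * yc w - yc v * xc w).
pose n := cross d1 d2.
pose N := dot n n.
have N0 : N != 0.
  apply/eqP => Ne.
  have [n1 n2 n3] := dot_eq0 Ne.
  have rel : dot d2 d2 *: d1 + (- dot d1 d2) *: d2 = 0.
    (* This is the double cross product of [d2] with [n]. *)
    have [e1 e2 e3] : [/\ dot d2 d2 * xc d1 - dot d1 d2 * xc d2 = yc d2 * zc n - zc d2 * yc n,
        dot d2 d2 * yc d1 - dot d1 d2 * yc d2 = zc d2 * xc n - xc d2 * zc n
      & dot d2 d2 * zc d1 - dot d1 d2 * zc d2 = xc d2 * yc n - yc d2 * xc n].
      by rewrite /n /cross !coordE /dot; split; ring.
    by apply: vecP; rewrite !coordE mulNr ?(e1, e2, e3) ?(n1, n2, n3); ring.
  have [d20 _] := nc _ _ rel.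
  have d2_0 : d2 = 0.
    by have [e1 e2 e3] := dot_eq0 d20; apply: vecP; rewrite !coordE.
  have : 0 *: d1 + 1 *: d2 = 0 by rewrite d2_0 scaler0 scale0r addr0.
  by move/nc => [_ /eqP]; rewrite oner_eq0.
pose X := N^-1 *: cross d2 n.
pose Y := N^-1 *: cross n d1.
pose Z := n.
have recon v : v = dot X v *: d1 + dot Y v *: d2 + (N^-1 * dot Z v) *: n.
  move: N0; rewrite /X /Y /Z /N /n /cross /dot => N0.
  by apply: vecP; rewrite !coordE; field; move: N0; rewrite !coordE.
have dots : [/\ dot X d1 = 1, dot X d2 = 0, dot Y d1 = 0 & dot Y d2 = 1] /\
    (dot Z d1 = 0 /\ dot Z d2 = 0).
  move: N0; rewrite /X /Y /Z /N /n /cross /dot => N0.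
  by split; split; rewrite !coordE; try ring; field; move: N0; rewrite !coordE.
case: dots => -[X1 X2 Y1 Y2] [Z1 Z2].
clearbody X Y Z.
have dotDl v w q : dot (v + w) q = dot v q + dot w q.
  by rewrite /dot !coordE; ring.
have dotZl k v q : dot (k *: v) q = k * dot v q.
  by rewrite /dot !coordE; ring.
exists (2 *: X + Y), Y, Z, (d2 - 2^-1 *: d1).
exists (- (dot (2 *: X + Y) a) - 1), (- dot Y a), (- dot Z a).
have be w : dot w b = dot w a + dot w d1 by rewrite -dotD d1E addrC subrK.
have ce w : dot w c = dot w a + dot w d2 by rewrite -dotD d2E addrC subrK.
split.
- by rewrite !dotDl !dotZl !dotD !dotN !dotZ X1 X2 Y1 Y2 Z1 Z2; split; [split|]; lra.
- move=> q r; rewrite !dotDl !dotZl => h1 h2 h3.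
  by rewrite (recon q) (recon r); congr (_ *: _ + _ *: _ + (_ * _) *: _) => //; lra.
- by rewrite !dotDl !dotZl; split; lra.
- by rewrite !be !dotDl !dotZl X1 Y1 Z1; split; lra.
- by rewrite !ce !dotDl !dotZl X2 Y2 Z2; split; lra.
Qed.
End Coordinates.

(** * Replacing one side of a triangle *)

Section DeltaMove.
Variable R : realType.
Notation V := 'rV[R]_3.
Implicit Types (a b c q u v w : V) (k s x y z : R).

Lemma tent_slope (K al be ga s : R) : 0 < K -> 0 <= s ->
  tent K al be ga - K / (K + 1) * s <= tent K al (be + s) ga.
Proof.
move=> K0 s0.
have k0 : 0 <= K / (K + 1) * s by rewrite mulr_ge0 // divr_ge0; lra.
have Ks : 0 <= K * s by rewrite mulr_ge0 // ltW.
rewrite /tent lerBlDr ge_max; apply/andP; split.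
  by rewrite addr_ge0 // le_max lexx.
rewrite -lerBlDr le_max; apply/orP; right.
rewrite lerBlDr; case: (leP (1 - `|al| - K * `|ga| + K * (be + s))
  (1 - `|al| - K * `|ga| - K / (K + 1) * (be + s))) => _.
  by rewrite ge_min; apply/orP; left; lra.
by rewrite ge_min; apply/orP; right; lra.
Qed.

Lemma continuous_tent (T : topologicalType) (K : R) (al be ga : T -> R) :
  continuous al -> continuous be -> continuous ga ->
  continuous (fun t => tent K (al t) (be t) (ga t)).
Proof.
move=> ca cb cg t.
have n1 : {for t, continuous (fun t => 1 - `|al t| - K * `|ga t|)}.
  apply: cvgB; last by apply: cvgM; [exact: cvg_cst|apply: cvg_norm; exact: cg].
  by apply: cvgB; [exact: cvg_cst|apply: cvg_norm; exact: ca].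
apply: (@continuous_max _ _ (fun t => 0) (fun t => Num.min _ _)).
  exact: cvg_cst.
apply: (@continuous_min _ _ (fun t => _ + _) (fun t => _ - _)).
  by apply: cvgD; [exact: n1|apply: cvgM; [exact: cvg_cst|exact: cb]].
by apply: cvgB; [exact: n1|apply: cvgM; [exact: cvg_cst|exact: cb]].
Qed.

(** The elementary move of combinatorial knot theory. It is a push by a
    [tent], with the frame of the triangle and a slope [K] so large that no
    other edge meets the support. *)
Lemma delta_move a b c (l : seq (V * V)) :
  noncollinear a b c ->
  (forall e, e \in l -> forall q, segment e.1 e.2 q -> triangle a b c q ->
     (q = a \/ q = b) /\ (q = e.1 \/ q = e.2)) ->
  ambient_isotopic (segs ((a, b) :: l)) (segs [:: (a, c), (c, b) & l]).
Proof.
move=> /triangle_frame[wa [wb [wg [u [da [db [dg]]]]]]] [[[au bu] gu] inj fa fb fc] off.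
pose al q := dot wa q + da; pose be q := dot wb q + db; pose ga q := dot wg q + dg.
have aff w d x y p q : x + y = 1 ->
    dot w (x *: p + y *: q) + d = x * (dot w p + d) + y * (dot w q + d).
  by move=> xy; rewrite dotD !dotZ -{1}[d]mul1r -xy; ring.
have aff2 w d s p q : dot w ((1 - s) *: p + s *: q) + d
    = (1 - s) * (dot w p + d) + s * (dot w q + d).
  by apply: aff; ring.
have inj' q r : al q = al r -> be q = be r -> ga q = ga r -> q = r.
  by move=> h1 h2 h3; apply: inj; apply: addIr; [exact: h1|exact: h2|exact: h3].
have tri q : in_tri (al q) (be q) (ga q) -> triangle a b c q.
  move=> [g0 b0 ab].
  exists ((1 - be q - al q) / 2), ((1 - be q + al q) / 2), (be q).
  have h1 := ler_norm (al q); have h2 := ler_norm (- al q).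
  rewrite normrN in h2.
  split; [lra|lra|lra|lra|].
  have aff3 w d x y z : x + y + z = 1 -> dot w (x *: a + y *: b + z *: c) + d
      = x * (dot w a + d) + y * (dot w b + d) + z * (dot w c + d).
    by move=> xyz; rewrite !dotD !dotZ -{1}[d]mul1r -xyz; ring.
  case: fa fb fc => fa1 fa2 fa3 [fb1 fb2 fb3] [fc1 fc2 fc3].
  apply: inj'; rewrite /al /be /ga aff3; try lra.
  - by rewrite fa1 fb1 fc1 -/(al q) -/(be q); field.
  - by rewrite fa2 fb2 fc2 -/(al q) -/(be q); field.
  - by rewrite fa3 fb3 fc3 -/(ga q) g0; ring.
have [K0 K0p clear] : exists2 K0, 0 < K0 & forall e, e \in l -> forall q K,
    K0 <= K -> segment e.1 e.2 q -> tent K (al q) (be q) (ga q) = 0.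
  elim: l off => [|e l IH] off; first by exists 1 => // e; rewrite in_nil.
  have [K1 K1p h1] : exists2 K0, 0 < K0 &
      forall e', e' \in l -> forall q K, K0 <= K -> segment e'.1 e'.2 q ->
      tent K (al q) (be q) (ga q) = 0.
    by apply: IH => e' e'l; apply: off; rewrite inE e'l orbT.
  have [|K2 K2p h2] := @tent_off_segment R (al e.1) (be e.1) (ga e.1)
      (al e.2) (be e.2) (ga e.2).
    move=> s s01; rewrite /al /be /ga -!aff2 => /tri T.
    have [] := off e (mem_head _ _) _ _ T; first by exists s.
    case: fa fb => fa1 fa2 fa3 [fb1 fb2 fb3].
    move=> ab ends; split.
      by case: ab => ->; rewrite ?(fa1, fb1, fa2, fb2) ?normrN normr1.
    by case: ends => ->; [left|right].
  exists (Num.max K1 K2); first by rewrite lt_max K1p.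
  move=> e' + q K; rewrite ge_max inE => /orP[/eqP ->|e'l] /andP[KK1 KK2].
    by move=> [s [s01 ->]]; rewrite /al /be /ga !aff2; exact: h2.
  exact: h1.
pose g q := tent K0 (al q) (be q) (ga q).
have push_u q s : g (q + s *: u) = tent K0 (al q) (be q + s) (ga q).
  by rewrite /g /al /be /ga !dotD !dotZ au bu gu; congr tent; ring.
have k01 : 0 <= K0 / (K0 + 1) < 1.
  by apply/andP; split; [rewrite divr_ge0 //|rewrite ltr_pdivrMr]; lra.
have main := @ambient_isotopic_push R u g (K0 / (K0 + 1)) (segs ((a, b) :: l)).
have -> : segs [:: (a, c), (c, b) & l] = (fun q => q + g q *: u) @` segs ((a, b) :: l).
  have gseg s : 0 <= s <= 1 -> g ((1 - s) *: a + s *: b) = 1 - `|2 * s - 1|.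
    move=> /andP[s0 s1]; rewrite /g /al /be /ga !aff2.
    case: fa fb => -> -> -> [-> -> ->]; rewrite !mulr0 addr0 /tent.
    rewrite normr0 !mulr0 !subr0 addr0 minxx.
    have -> : (1 - s) * -1 + s * 1 = 2 * s - 1 by ring.
    by rewrite max_r // subr_ge0 ler_norml; apply/andP; split; lra.
  case: fa fb fc => fa1 fa2 fa3 [fb1 fb2 fb3] [fc1 fc2 fc3].
  have affu w d p k : dot w (p + k *: u) + d = (dot w p + d) + k * dot w u.
    by rewrite dotD dotZ; ring.
  have left_half s : 0 <= s <= 1 / 2 ->
      (1 - s) *: a + s *: b + g ((1 - s) *: a + s *: b) *: u
      = (1 - 2 * s) *: a + (2 * s) *: c.
    move=> /andP[s0 s1]; rewrite gseg; last by apply/andP; split; lra.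
    rewrite ler0_norm; last lra.
    by apply: inj'; rewrite /al /be /ga affu !aff2
      ?(au, bu, gu) ?(fa1, fa2, fa3, fb1, fb2, fb3) ?(fc1, fc2, fc3); ring.
  have right_half s : 1 / 2 <= s <= 1 ->
      (1 - s) *: a + s *: b + g ((1 - s) *: a + s *: b) *: u
      = (1 - (2 * s - 1)) *: c + (2 * s - 1) *: b.
    move=> /andP[s0 s1]; rewrite gseg; last by apply/andP; split; lra.
    rewrite ger0_norm; last lra.
    by apply: inj'; rewrite /al /be /ga affu !aff2
      ?(au, bu, gu) ?(fa1, fa2, fa3, fb1, fb2, fb3) ?(fc1, fc2, fc3); ring.
  have fixl e q : e \in l -> segment e.1 e.2 q -> q + g q *: u = q.
    by move=> el eq; rewrite /g (clear e el) // scale0r addr0.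
  apply/seteqP; split=> q; rewrite !segs_cons /=.
  - case=> [[s [/andP[s0 s1] ->]]|[[s [/andP[s0 s1] ->]]|[e [el eq]]]].
    + exists ((1 - s / 2) *: a + (s / 2) *: b).
        by left; exists (s / 2); split=> //; apply/andP; split; lra.
      rewrite left_half; last by apply/andP; split; lra.
      by have -> : 2 * (s / 2) = s by field.
    + exists ((1 - (s + 1) / 2) *: a + ((s + 1) / 2) *: b).
        by left; exists ((s + 1) / 2); split=> //; apply/andP; split; lra.
      rewrite right_half; last by apply/andP; split; lra.
      by have -> : 2 * ((s + 1) / 2) - 1 = s by field.
    + by exists q; [right; exists e|exact: (fixl e)].
  - case=> p [[s [/andP[s0 s1] ->]]|[e [el ep]]] <-.
    + case: (lerP s (1 / 2)) => sh.
        rewrite left_half; last by apply/andP; split; lra.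
        by left; exists (2 * s); split=> //; apply/andP; split; lra.
      rewrite right_half; last by apply/andP; split; lra.
      by right; left; exists (2 * s - 1); split=> //; apply/andP; split; lra.
    + by right; right; exists e; split=> //; rewrite (fixl e).
apply: main => //.
  have cont (al' be' ga' : V -> R) : continuous al' -> continuous be' -> continuous ga' ->
      continuous (fun q => tent K0 (al' q) (be' q) (ga' q)) by exact: continuous_tent.
  by apply: cont; exact: continuous_affine.
by move=> q s s0; rewrite push_u; exact: tent_slope.
Qed.

End DeltaMove.

(** * A triangle is unknotted *)

Section Unknot.
Variable R : realType.
Notation V := 'rV[R]_3.
Implicit Types (a b c q u v w : V) (k s x y z : R).

Lemma dotv3 x y z v : dot (vec3 x y z) v = x * xc v + y * yc v + z * zc v.
Proof. by rewrite /dot !coordE. Qed.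

Definition shear u w (d : R) q := q + (dot w q + d) *: u.

Lemma ambient_isotopic_shear u w (d : R) (A : set V) :
  -1 < dot w u -> ambient_isotopic A (shear u w d @` A).
Proof.
move=> wu; apply: (@ambient_isotopic_push R u _ (Num.max 0 (- dot w u))).
- exact: continuous_affine.
- by rewrite le_max lexx gt_max ltr01; lra.
- move=> q s s0; rewrite dotD dotZ.
  have : - dot w u <= Num.max 0 (- dot w u) by rewrite le_max lexx orbT.
  move: (Num.max _ _) => m h; nra.
Qed.

Lemma image_segs (f : V -> V) (l : seq (V * V)) :
  (forall a b s, f ((1 - s) *: a + s *: b) = (1 - s) *: f a + s *: f b) ->
  f @` segs l = segs [seq (f e.1, f e.2) | e <- l].
Proof.
move=> faff; apply/seteqP; split=> [_ [q [e [el [s [s01 ->]]]] <-]|q].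
  exists (f e.1, f e.2); split; first by apply: (map_f (fun e => (f e.1, f e.2))).
  by exists s.
move=> [_ [/mapP[e el ->] [s [s01 ->]]]].
by exists ((1 - s) *: e.1 + s *: e.2); [exists e; split=> //; exists s|exact: faff].
Qed.

Lemma shear_affine u w d a b s :
  shear u w d ((1 - s) *: a + s *: b) = (1 - s) *: shear u w d a + s *: shear u w d b.
Proof. by apply: vecP; rewrite /shear !coordE dotD !dotZ; ring. Qed.

Lemma shear_segs u w d (l : seq (V * V)) : -1 < dot w u ->
  ambient_isotopic (segs l) (segs [seq (shear u w d e.1, shear u w d e.2) | e <- l]).
Proof.
move=> wu; rewrite -image_segs; first exact: ambient_isotopic_shear.
by move=> *; exact: shear_affine.
Qed.

Definition tri a b c := [:: (a, b); (b, c); (c, a)].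

Lemma tri_shear u w d a b c a' b' c' : -1 < dot w u ->
  a' = shear u w d a -> b' = shear u w d b -> c' = shear u w d c ->
  ambient_isotopic (segs (tri a b c)) (segs (tri a' b' c')).
Proof. by move=> wu -> -> ->; exact: shear_segs. Qed.

Lemma tri_standard :
  segs (tri (vec3 (-1) 0 0) (vec3 1 0 0) (vec3 0 1 0)) =
  [set q | exists x : R, -1 <= x <= 1 /\ (q = vec3 x 0 0 \/ q = vec3 x (1 - `|x|) 0)].
Proof.
apply/seteqP; split=> q; rewrite /tri !segs_cons segs_nil /=.
- case=> [[s [/andP[s0 s1] ->]]|[[s [/andP[s0 s1] ->]]|[[s [/andP[s0 s1] ->]]|//]]].
  + exists (-1 + 2 * s); split; first by apply/andP; split; lra.
    by left; apply: vecP; rewrite !coordE; ring.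
  + exists (1 - s); split; first by apply/andP; split; lra.
    right; rewrite ger0_norm; last lra.
    by apply: vecP; rewrite !coordE; ring.
  + exists (- s); split; first by apply/andP; split; lra.
    right; rewrite ler0_norm; last lra.
    by apply: vecP; rewrite !coordE; ring.
- move=> [x [/andP[x0 x1] [->|->]]].
  + left; exists ((x + 1) / 2); split; first by apply/andP; split; lra.
    by apply: vecP; rewrite !coordE; field.
  + right; case: (lerP 0 x) => x2; rewrite ?(ger0_norm x2) ?(ltr0_norm x2); [left|right; left].
      exists (1 - x); split; first by apply/andP; split; lra.
      by apply: vecP; rewrite !coordE; ring.
    exists (- x); split; first by apply/andP; split; lra.
    by apply: vecP; rewrite !coordE; ring.
Qed.

(** Two pushes in the second direction: the first bends the base of the
    triangle down onto the lower half circle, the second bends the two other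
    sides up onto the upper one. *)
Lemma tri_standard_trivial :
  trivial_knot (segs (tri (vec3 (-1) 0 0) (vec3 1 0 0) (vec3 0 1 0))).
Proof.
pose ey : V := vec3 0 1 0.
pose g1 q := - Num.sqrt (1 - xc q ^+ 2 - 2 * Num.max (yc q) 0).
pose g2 q := Num.max 0 (Num.sqrt (1 - xc q ^+ 2 + 2 * Num.min (yc q - (1 - `|xc q|)) 0)
   - (1 - `|xc q|)).
have cX : continuous (fun q : V => 1 - xc q ^+ 2).
  have c (T : topologicalType) (f : T -> R) : continuous f ->
      continuous (fun t => 1 - f t ^+ 2).
    move=> cf t; apply: cvgB; first exact: cvg_cst.
    by rewrite expr2; apply: cvgM; exact: cf.
  by apply: c; exact: continuous_xc.
have c1 : continuous g1.
  have c (T : topologicalType) (f h : T -> R) : continuous f -> continuous h ->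
      continuous (fun t => - Num.sqrt (f t - 2 * Num.max (h t) 0)).
    move=> cf ch t; apply: cvgN.
    apply: (@cvg_comp _ _ _ (fun t => f t - 2 * Num.max (h t) 0) Num.sqrt _ (nbhs (f t - 2 * Num.max (h t) 0))); last exact: sqrt_continuous.
    apply: cvgB; first exact: cf.
    apply: cvgM; first exact: cvg_cst.
    by apply: (@continuous_max _ _ h (fun=> 0)); [exact: ch|exact: cvg_cst].
  by apply: c; [exact: cX|exact: continuous_yc].
have c2 : continuous g2.
  have c (T : topologicalType) (f h n : T -> R) : continuous f -> continuous h ->
      continuous n -> continuous (fun t => Num.max 0 (Num.sqrt
        (f t + 2 * Num.min (h t - (1 - `|n t|)) 0) - (1 - `|n t|))).
    move=> cf ch cn t.
    have ct : {for t, continuous (fun t => 1 - `|n t|)}.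
      by apply: cvgB; [exact: cvg_cst|apply: cvg_norm; exact: cn].
    apply: (@continuous_max _ _ (fun=> 0) (fun t => _ - _)); first exact: cvg_cst.
    apply: cvgB; last exact: ct.
    apply: (@cvg_comp _ _ _ (fun t => f t + 2 * Num.min (h t - (1 - `|n t|)) 0) Num.sqrt _
       (nbhs (f t + 2 * Num.min (h t - (1 - `|n t|)) 0))); last exact: sqrt_continuous.
    apply: cvgD; first exact: cf.
    apply: cvgM; first exact: cvg_cst.
    apply: (@continuous_min _ _ (fun t => _ - _) (fun=> 0)); last exact: cvg_cst.
    by apply: cvgB; [exact: ch|exact: ct].
  by apply: c; [exact: cX|exact: continuous_yc|exact: continuous_xc].
suff E : (fun q => q + g2 q *: ey) @` ((fun q => q + g1 q *: ey) @`
    segs (tri (vec3 (-1) 0 0) (vec3 1 0 0) (vec3 0 1 0))) = round_circle.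
  rewrite /trivial_knot -E; apply: ambient_isotopic_trans.
    apply: (@ambient_isotopic_push R ey g1 0) => //; first by rewrite lexx ltr01.
    move=> q s s0; rewrite mul0r subr0 /g1 !coordE lerN2 mulr0 addr0.
    apply: ler_wsqrtr; rewrite lerD2l lerN2 ler_pM2l // ge_max !le_max mulr1 lexx !orbT andbT.
    by rewrite lerDl s0.
  apply: (@ambient_isotopic_push R ey g2 0) => //; first by rewrite lexx ltr01.
    move=> q s s0; rewrite mul0r subr0 /g2 !coordE mulr0 addr0 mulr1.
    rewrite ge_max !le_max lexx /=; apply/orP; right.
    rewrite lerD2r; apply: ler_wsqrtr; rewrite lerD2l ler_pM2l // le_min !ge_min lexx !orbT andbT.
    by apply/orP; left; lra.
rewrite tri_standard.
have r0 x : -1 <= x <= 1 -> 0 <= 1 - x ^+ 2.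
  by move=> /andP[x0 x1]; nra.
have n1 x : -1 <= x <= 1 -> `|x| <= 1 by rewrite ler_norml.
have rt x : -1 <= x <= 1 -> 1 - `|x| <= Num.sqrt (1 - x ^+ 2).
  move=> xI; rewrite -[leLHS]ger0_norm ?subr_ge0 ?n1 // -sqrtr_sqr.
  apply: ler_wsqrtr; rewrite -(real_normK (num_real x)).
  by have := n1 x xI; have := normr_ge0 x; nra.
have low x : -1 <= x <= 1 -> vec3 x 0 0 + g1 (vec3 x 0 0) *: ey
    = vec3 x (- Num.sqrt (1 - x ^+ 2)) 0.
  move=> xI; apply: vecP; rewrite /g1 !coordE ?maxxx ?mulr0 ?subr0; ring.
have low2 x : -1 <= x <= 1 -> g2 (vec3 x (- Num.sqrt (1 - x ^+ 2)) 0) = 0.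
  move=> xI; rewrite /g2 !coordE.
  have rE := sqr_sqrtr (r0 x xI).
  have rp := sqrtr_ge0 (1 - x ^+ 2).
  have tx := n1 x xI.
  rewrite min_l; last lra.
  rewrite ler0_sqrtr; last by rewrite -{1}rE; have := rt x xI; nra.
  by rewrite max_l //; lra.
have up x : -1 <= x <= 1 -> g1 (vec3 x (1 - `|x|) 0) = 0.
  move=> xI; rewrite /g1 !coordE max_l ?subr_ge0 ?n1 //.
  rewrite ler0_sqrtr ?oppr0 // -(real_normK (num_real x)).
  by have := n1 x xI; have := normr_ge0 x; nra.
have up2 x : -1 <= x <= 1 -> vec3 x (1 - `|x|) 0 + g2 (vec3 x (1 - `|x|) 0) *: ey
    = vec3 x (Num.sqrt (1 - x ^+ 2)) 0.
  move=> xI; apply: vecP; rewrite /g2 !coordE ?mulr0 ?addr0 //.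
  by rewrite subrr minxx mulr0 addr0 max_r ?subr_ge0 ?rt //; ring.
rewrite image_comp; apply/seteqP; split=> q.
- move=> [_ [x [xI [->|->]]] <-] /=.
    rewrite low // low2 // scale0r addr0.
    exists x, (- Num.sqrt (1 - x ^+ 2)); split=> //.
    by rewrite sqrrN sqr_sqrtr ?r0 //; ring.
  rewrite up // scale0r addr0 up2 //.
  exists x, (Num.sqrt (1 - x ^+ 2)); split=> //.
  by rewrite sqr_sqrtr ?r0 //; ring.
- move=> [x [y [xy ->]]].
  have xI : -1 <= x <= 1 by apply/andP; split; nra.
  have yE : y ^+ 2 = 1 - x ^+ 2 by lra.
  have [y0|y0] := lerP 0 y.
    exists (vec3 x (1 - `|x|) 0); first by exists x; split=> //; right.
    by rewrite /= up // scale0r addr0 up2 // -yE sqrtr_sqr ger0_norm.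
  exists (vec3 x 0 0); first by exists x; split=> //; left.
  rewrite /= low // low2 // scale0r addr0 -yE sqrtr_sqr ltr0_norm //.
  by rewrite opprK.
Qed.

(** Products of shears are the linear maps of positive determinant, so they carry
    any triangle to the standard one; for a triangle in this position they are
    explicit. *)
Lemma vertical_triangle_trivial a b c :
  xc c = xc a -> yc c = yc a -> zc c != zc a -> zc b = zc a ->
  (xc b != xc a) || (yc b != yc a) ->
  trivial_knot (segs (tri a b c)).
Proof.
move=> cx cy cz bz bxy.
(* Move [a] to the origin. *)
apply: (ambient_isotopic_trans (@tri_shear a 0 (-1) a b c 0 (b - a) (c - a) _ _ _ _)).
- by rewrite /dot !coordE; lra.
- by apply: vecP; rewrite /shear /dot !coordE; ring.
- by apply: vecP; rewrite /shear /dot !coordE; ring.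
- by apply: vecP; rewrite /shear /dot !coordE; ring.
have -> : c - a = vec3 0 0 (zc c - zc a) by apply: vecP; rewrite !coordE ?cx ?cy ?subrr.
have -> : b - a = vec3 (xc b - xc a) (yc b - yc a) 0 by apply: vecP; rewrite !coordE ?bz ?subrr.
have d0 : (xc b - xc a != 0) || (yc b - yc a != 0) by rewrite !subr_eq0.
have h0 : zc c - zc a != 0 by rewrite subr_eq0.
move: (xc b - xc a) (yc b - yc a) (zc c - zc a) d0 h0 => x y h d0 h0.
have step1 : exists x' y', y' != 0 /\ ambient_isotopic
    (segs (tri 0 (vec3 x y 0) (vec3 0 0 h))) (segs (tri 0 (vec3 x' y' 0) (vec3 0 0 h))).
  have [y0|yn] := eqVneq y 0; last first.
    exists x, y; split=> //; apply: (tri_shear (u := 0) (w := 0) (d := 0));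
      rewrite ?/shear ?scaler0 ?addr0 ///dot !coordE; lra.
  have xn : x != 0 by move: d0; rewrite y0 eqxx orbF.
  exists x, 1; split; first exact: oner_neq0.
  apply: (tri_shear (u := vec3 0 1 0) (w := vec3 x^-1 0 0) (d := 0)).
  - by rewrite dotv3 !coordE; lra.
  - by apply: vecP; rewrite /shear dotv3 !coordE; ring.
  - by apply: vecP; rewrite /shear dotv3 !coordE y0; field.
  - by apply: vecP; rewrite /shear dotv3 !coordE; ring.
move: step1 => [x' [y' [yn iso]]]; apply: ambient_isotopic_trans iso _.
apply: (ambient_isotopic_trans (@tri_shear (vec3 1 0 0) (vec3 0 ((1 - x') / y') 0) 0
  _ _ _ 0 (vec3 1 y' 0) (vec3 0 0 h) _ _ _ _)).
- by rewrite dotv3 !coordE; lra.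
- by apply: vecP; rewrite /shear dotv3 !coordE; ring.
- by apply: vecP; rewrite /shear dotv3 !coordE; field.
- by apply: vecP; rewrite /shear dotv3 !coordE; ring.
apply: (ambient_isotopic_trans (@tri_shear (vec3 0 1 0) (vec3 (- y') 0 h^-1) 0
  _ _ _ 0 (vec3 1 0 0) (vec3 0 1 h) _ _ _ _)).
- by rewrite dotv3 !coordE; lra.
- by apply: vecP; rewrite /shear dotv3 !coordE; ring.
- by apply: vecP; rewrite /shear dotv3 !coordE; ring.
- by apply: vecP; rewrite /shear dotv3 !coordE; field.
apply: (ambient_isotopic_trans (@tri_shear (vec3 0 0 1) (vec3 0 (- h) 0) 0
  _ _ _ 0 (vec3 1 0 0) (vec3 0 1 0) _ _ _ _)).
- by rewrite dotv3 !coordE; lra.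
- by apply: vecP; rewrite /shear dotv3 !coordE; ring.
- by apply: vecP; rewrite /shear dotv3 !coordE; ring.
- by apply: vecP; rewrite /shear dotv3 !coordE; ring.
apply: (ambient_isotopic_trans (@tri_shear (vec3 1 0 0) (vec3 1 1 0) (-1)
  _ _ _ (vec3 (-1) 0 0) (vec3 1 0 0) (vec3 0 1 0) _ _ _ _)).
- by rewrite dotv3 !coordE; lra.
- by apply: vecP; rewrite /shear dotv3 !coordE; ring.
- by apply: vecP; rewrite /shear dotv3 !coordE; ring.
- by apply: vecP; rewrite /shear dotv3 !coordE; ring.
exact: tri_standard_trivial.
Qed.

End Unknot.

(** * Cyclic sequences and their edges *)

Section Edges.
Variable T : Type.
Implicit Types (s p : seq T) (x y : T).

(** The consecutive pairs of the sequence [rcons s y]. *)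
Definition link s y := zip s (rcons (behead s) y).

Definition edges p := zip p (rot 1 p).

Lemma edges_link x s : edges (x :: s) = link (x :: s) x.
Proof. by rewrite /edges /link rot1_cons. Qed.

Lemma size_edges p : size (edges p) = size p.
Proof. by rewrite size_zip size_rot minnn. Qed.

Lemma link_cat x s1 y s2 z :
  link (x :: s1 ++ y :: s2) z = link (x :: s1) y ++ link (y :: s2) z.
Proof.
elim: s1 x => [|x' s1 IH] x //=.
by have := IH x'; rewrite /link /= => ->.
Qed.

Lemma link_flatten (h : nat -> T) (t : nat -> seq T) m n : (0 < n)%N ->
  link (flatten [seq h i :: t i | i <- iota m n]) (h (m + n)%N) =
  flatten [seq link (h i :: t i) (h i.+1) | i <- iota m n].
Proof.
elim: n m => // -[|n] IH m _; first by rewrite /= !cats0 addn1.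
have := IH m.+1 isT; rewrite addSnnS => e.
transitivity (link (h m :: t m) (h m.+1) ++
  link (flatten [seq h i :: t i | i <- iota m.+1 n.+1]) (h (m + n.+2)%N)).
  exact: link_cat.
by rewrite e.
Qed.

Lemma edges_rot r p : edges (rot r p) = rot r (edges p).
Proof.
have aux : forall (n : nat) (s t : seq T), size s = size t ->
    rot n (zip s t) = zip (rot n s) (rot n t).
  move=> n s t st; rewrite /rot zip_cat ?size_drop ?st //.
  congr (_ ++ _); elim: n s t st => [|n IH] [|? s] [|? t] //= [] //; first exact: IH.
  by move=> /IH ->.
by rewrite /edges aux ?size_rot // rot_rot.
Qed.
End Edges.

Lemma edges_map (T U : Type) (f : T -> U) (p : seq T) :
  edges [seq f x | x <- p] = [seq (f e.1, f e.2) | e <- edges p].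
Proof.
rewrite /edges -map_rot; elim: p (rot 1 p) => [|x p IH] [|y q] //=.
by rewrite IH.
Qed.

Lemma link_map (T U : Type) (f : T -> U) (s : seq T) y :
  link [seq f x | x <- s] (f y) = [seq (f e.1, f e.2) | e <- link s y].
Proof.
rewrite /link behead_map -map_rcons; elim: s (rcons _ y) => [|x p IH] [|z q] //=.
by rewrite IH.
Qed.

Lemma cycle_edges (T : Type) (e : rel T) (p : seq T) :
  cycle e p = all (fun x => e x.1 x.2) (edges p).
Proof.
case: p => // x p; rewrite edges_link /cycle /link /=.
by elim: p {1 3}x => [|y p IH] z //=; rewrite IH.
Qed.

(** The trace depends on the set of edges only, so from here on polygons are
    handled as lists of segments, in which edges can be reordered and reversed. *)
Lemma trace_segs (R : realType) (p : seq 'rV[R]_3) : trace p = segs (edges p).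
Proof.
apply/seteqP; split=> q.
  move=> [i [s [ip s01 ->]]].
  exists (edge_src p i, edge_tgt p i); split; last by exists s.
  rewrite /edge_src /edge_tgt -(@nth_zip _ _ 0 0) ?size_rot //.
  by apply: mem_nth; rewrite size_zip size_rot minnn.
move=> [e [/(nthP (0, 0))[i]]]; rewrite size_edges => ip <- [s [s01 ->]].
exists i, s; split=> //; rewrite /edge_point /edge_src /edge_tgt.
by rewrite nth_zip ?size_rot.
Qed.

(** * Levels as cyclic bit sequences *)

(** In a lattice polygon an edge is horizontal when its ends have the same
    height, so the levels can be read off from the heights of the vertices. *)

Definition level_bits (H : eqType) (hs : seq H) (k : H) : seq bool :=
  [seq (e.1 == k) && (e.2 == k) | e <- edges hs].

Definition single_arc (bs : seq bool) :=
  exists r m f, rot r bs = nseq m true ++ nseq f.+1 false.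

Definition arcs (H : eqType) (hs : seq H) :=
  forall k, true \in level_bits hs k -> single_arc (level_bits hs k).

Lemma level_bits_rot (H : eqType) r (hs : seq H) k :
  level_bits (rot r hs) k = rot r (level_bits hs k).
Proof. by rewrite /level_bits edges_rot map_rot. Qed.

Lemma level_bits_map (H H' : eqType) (f : H -> H') (hs : seq H) k :
  injective f -> level_bits [seq f x | x <- hs] (f k) = level_bits hs k.
Proof.
move=> fi; rewrite /level_bits edges_map -map_comp; apply: eq_map => e /=.
by rewrite !inj_eq.
Qed.

Lemma arcs_map (H H' : eqType) (f : H -> H') (hs : seq H) :
  injective f -> arcs [seq f x | x <- hs] <-> arcs hs.
Proof.
move=> fi; split=> hA k; first by have := hA (f k); rewrite level_bits_map.
move=> kin; have [k' kE] : exists k', k = f k'.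
  move: kin; rewrite /level_bits edges_map -map_comp => /mapP[e _ /esym] /=.
  by case/andP=> /eqP <- _; exists e.1.
by move: kin; rewrite kE level_bits_map //; exact: hA.
Qed.

Section ProperlyLeveled.
Variable R : realType.
Notation V := 'rV[R]_3.

Lemma level_edge_bits (hor p : seq V) (h : R) i :
  (forall d, d \in hor -> height d = 0) -> cycle (is_edge (e_z R :: hor)) p ->
  (i < size p)%N ->
  level_edge hor p h i <-> nth false (level_bits [seq height v | v <- p] h) i.
Proof.
move=> horiz; rewrite cycle_edges => /(all_nthP (0, 0)) adj ip.
have ie : (i < size (edges p))%N by rewrite size_edges.
rewrite /level_bits edges_map -map_comp (nth_map (0, 0)) //=.
have := adj i ie; rewrite /edges nth_zip ?size_rot //= -/(edge_src p i) -/(edge_tgt p i).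
rewrite /level_edge; move: (edge_src p i) (edge_tgt p i) => u v.
have hB (x y : V) : height (x - y) = height x - height y by rewrite /height !mxE.
have hz : height (e_z R) = 1 by rewrite -/(zc _) /e_z coordE.
rewrite {1}/is_edge !inE => uv; split.
  move=> [/orP[/horiz|/horiz] + <-]; rewrite hB => /eqP; rewrite subr_eq0 eqxx /=.
    by [].
  by rewrite eq_sym.
move=> /andP[/eqP hu /eqP hv]; split=> //; rewrite /is_edge.
case/orP: uv => /orP[/eqP e|->//]; last by rewrite orbT.
  by have := hB v u; rewrite e hz hu hv subrr => /eqP; rewrite oner_eq0.
by have := hB u v; rewrite e hz hu hv subrr => /eqP; rewrite oner_eq0.
Qed.

(** Having the same height at both ends is a property of the edge that does not
    involve real numbers, which moves the condition on levels to sequences of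
    integers. *)
Lemma properly_leveled_arcs (hor p : seq V) :
  (forall d, d \in hor -> height d = 0) -> cycle (is_edge (e_z R :: hor)) p ->
  properly_leveled hor p <-> arcs [seq height v | v <- p].
Proof.
move=> horiz adj.
have sz k : size (level_bits [seq height v | v <- p] k) = size p.
  by rewrite size_map size_edges size_map.
have adjr r : cycle (is_edge (e_z R :: hor)) (rot r p) by rewrite rot_cycle.
split=> hP k.
- move=> /(nthP false)[i]; rewrite sz => ip ni.
  have [|r [m [mp hm]]] := hP k.
    by exists i; split=> //; apply/level_edge_bits => //; rewrite ni.
  exists r, m, (size p - m).-1; rewrite prednK ?subn_gt0 //.
  apply: (@eq_from_nth _ false).
    by rewrite size_rot sz size_cat !size_nseq subnKC // ltnW.
  move=> j; rewrite size_rot sz => jp.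
  have jr : (j < size (rot r p))%N by rewrite size_rot.
  have := level_edge_bits k horiz (adjr r) jr.
  rewrite map_rot level_bits_rot nth_cat size_nseq !nth_nseq => e.
  case: (ltnP j m) => jm; first by apply/e/(hm j jp).
  rewrite if_same; by apply/negP => /e /(hm j jp); rewrite ltnNge jm.
- move=> [i [ip /level_edge_bits hi]].
  have [|r [m [f e]]] := hP k.
    by apply/(nthP false); exists i; rewrite ?sz //; apply: hi.
  have sE : size p = (m + f.+1)%N.
    by have := congr1 size e; rewrite size_rot sz size_cat !size_nseq.
  exists r, m; split; first by rewrite sE addnS ltnS leq_addr.
  move=> j jp.
  have jr : (j < size (rot r p))%N by rewrite size_rot.
  have := level_edge_bits k horiz (adjr r) jr.
  rewrite map_rot level_bits_rot e nth_cat size_nseq !nth_nseq => ->.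
  by case: (ltnP j m) => jm //; rewrite if_same.
Qed.
End ProperlyLeveled.

(** * Lattice polygons in integer coordinates *)

Notation pt := (int * int * int)%type.

Definition adj (D : seq pt) : rel pt := fun v w => (w - v \in D) || (v - w \in D).

Definition cub_dirs : seq pt := [:: (0, 0, 1); (1, 0, 0); (0, 1, 0)].
Definition sh_dirs : seq pt := [:: (0, 0, 1); (1, 0, 0); (0, 1, 0); (-1, 1, 0)].

Record polygon (D : seq pt) (l : seq pt) : Prop := Polygon {
  polygon_uniq : uniq l;
  polygon_size : (2 < size l)%N;
  polygon_adj : cycle (adj D) l;
  polygon_arcs : arcs [seq v.2 | v <- l] }.

Section Embeddings.
Variable R : realType.
Notation V := 'rV[R]_3.
Implicit Types (v w d e : pt) (l : seq pt).

Definition cub v : V := vec3 v.1.1%:~R v.1.2%:~R v.2%:~R.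
Definition shv v : V := v.1.1%:~R *: e_x R + v.1.2%:~R *: sh_y R + v.2%:~R *: e_z R.

Lemma cubB v w : cub (v - w) = cub v - cub w.
Proof. by apply: vecP; rewrite !coordE /= intrB. Qed.

Lemma shvB v w : shv (v - w) = shv v - shv w.
Proof. by apply: vecP; rewrite !coordE /= !intrB; ring. Qed.

Lemma cub_inj : injective cub.
Proof.
move=> [[a b] c] [[a' b'] c'] e.
move: (congr1 (@xc R) e) (congr1 (@yc R) e) (congr1 (@zc R) e); rewrite !coordE /=.
by move=> /intr_inj -> /intr_inj -> /intr_inj ->.
Qed.

Lemma shv_inj : injective shv.
Proof.
move=> [[a b] c] [[a' b'] c'] e.
move: (congr1 (@xc R) e) (congr1 (@yc R) e) (congr1 (@zc R) e).
rewrite /shv /= !coordE !mulr0 !mulr1 !addr0 !add0r => ex ey /intr_inj ->.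
have s3 : Num.sqrt 3 / 2 != 0 :> R by rewrite mulf_neq0 ?invr_eq0 ?gt_eqF ?sqrtr_gt0.
move/(mulIf s3): ey ex => /[dup] /intr_inj -> _ /addIr.
by move=> /intr_inj ->.
Qed.

(** Both embeddings of the integer points are injective and additive, which is
    all that adjacency depends on. *)
Lemma is_edge_emb (f : pt -> V) (D : seq pt) v w : injective f ->
  (forall v w, f (v - w) = f v - f w) ->
  is_edge [seq f d | d <- D] (f v) (f w) = adj D v w.
Proof. by move=> fi fB; rewrite /is_edge /adj -!fB !mem_map. Qed.

Lemma cub_dirsE : e_z R :: cubic_hor R = [seq cub d | d <- cub_dirs].
Proof. by []. Qed.

Lemma sh_dirsE : e_z R :: sh_hor R = [seq shv d | d <- sh_dirs].
Proof.
by congr [:: _; _; _; _]; apply: vecP; rewrite /shv !coordE /=; ring.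
Qed.

Lemma cycle_emb (f : pt -> V) (D : seq pt) l : injective f ->
  (forall v w, f (v - w) = f v - f w) ->
  cycle (is_edge [seq f d | d <- D]) [seq f v | v <- l] = cycle (adj D) l.
Proof.
move=> fi fB; rewrite !cycle_edges edges_map all_map.
by apply: eq_all => e /=; exact: is_edge_emb.
Qed.

Lemma cubic_hor0 (d : V) : d \in cubic_hor R -> height d = 0.
Proof. by rewrite !inE => /orP[|] /eqP ->; rewrite -/(zc _) !coordE. Qed.

Lemma sh_hor0 (d : V) : d \in sh_hor R -> height d = 0.
Proof.
by rewrite !inE => /or3P[] /eqP ->; rewrite -/(zc _) !coordE ?subrr.
Qed.

Lemma simple_closed_uniq (p : seq V) : simple_closed p -> uniq p /\ (2 < size p)%N.
Proof.
move=> [p0 inj].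
have ep0 i : edge_point p i 0 = p`_i by rewrite /edge_point subr0 scale1r scale0r addr0.
have i0 : 0 <= (0 : R) < 1 by rewrite lexx ltr01.
have ih : 0 <= (1 / 2 : R) < 1 by apply/andP; split; lra.
split.
  apply/(uniqP 0) => i j; rewrite !inE => ip jp; rewrite -!ep0 => e.
  by have [] := inj i j 0 0 ip jp i0 i0 e.
case: p p0 inj ep0 => [//|x [|y [|z p]]] // _ inj ep0.
- have e : edge_point [:: x] 0 0 = edge_point [:: x] 0 (1 / 2).
    by rewrite /edge_point /=; apply: vecP; rewrite !coordE /edge_src /edge_tgt /=; field.
  by have [_] := inj 0%N 0%N _ _ isT isT i0 ih e; lra.
- have e : edge_point [:: x; y] 0 (1 / 2) = edge_point [:: x; y] 1 (1 / 2).
    by rewrite /edge_point /=; apply: vecP; rewrite !coordE /edge_src /edge_tgt /=; field.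
  by have [] := inj 0%N 1%N _ _ isT isT ih ih e.
Qed.

Lemma sh_polygonP (p : seq V) :
  lattice_polygon sh_lattice (sh_hor R) p -> properly_leveled (sh_hor R) p ->
  exists2 l, p = [seq shv v | v <- l] & polygon sh_dirs l.
Proof.
move=> [/simple_closed_uniq[up sp] inL adjp] /(properly_leveled_arcs sh_hor0 adjp) ar.
have [l pE] : exists l, p = [seq shv v | v <- l].
  elim: p inL {up sp adjp ar} => [|v p IH] inL; first by exists [::].
  have [|l ->] := IH; first by move=> w wp; apply: inL; rewrite inE wp orbT.
  have [i [j [k ->]]] := inL v (mem_head _ _).
  by exists ((i, j, k) :: l).
exists l => //; split.
- by move: up; rewrite pE map_inj_uniq //; exact: shv_inj.
- by move: sp; rewrite pE size_map.
- by move: adjp; rewrite pE sh_dirsE cycle_emb //; [exact: shv_inj|exact: shvB].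
- apply/(@arcs_map _ _ (fun i : int => i%:~R : R)); first exact: intr_inj.
  move: ar; rewrite pE -!map_comp; congr arcs; apply: eq_map => v /=.
  by rewrite -/(zc _) /shv !coordE; ring.
Qed.

(** Two unit edges of the cubic lattice meet only in common ends, unless they
    coincide: a point inside an edge has exactly one coordinate that is not an
    integer. *)
Lemma cub_edges_meet (a b c a' b' c' : int) d e (s t : R) :
  (d \in cub_dirs) || (- d \in cub_dirs) -> (e \in cub_dirs) || (- e \in cub_dirs) ->
  0 <= s < 1 -> 0 <= t < 1 ->
  cub (a, b, c) + s *: cub d = cub (a', b', c') + t *: cub e ->
  ((a, b, c) = (a', b', c') /\ s = t) \/
  ((a, b, c) + d = (a', b', c') /\ (a', b', c') + e = (a, b, c)).
Proof.
move=> dD eD /andP[s0 s1] /andP[t0 t1] eq.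
move: (congr1 (@xc R) eq) (congr1 (@yc R) eq) (congr1 (@zc R) eq).
rewrite !coordE /= => ex ey ez {eq}.
have small (m : int) : -2 < (m%:~R : R) < 2 -> m = 0 \/ m = 1 \/ m = -1.
  have -> : (-2 : R) = (-2)%:~R by [].
  have -> : (2 : R) = 2%:~R by [].
  by rewrite !ltr_int; lia.
have diff (i j : int) (x y : R) : i%:~R + x = j%:~R + y -> -1 < x < 1 -> -1 < y < 1 ->
    [\/ i = j /\ x = y, i = j + 1 /\ y = x + 1 | i = j - 1 /\ x = y + 1].
  move=> h /andP[x0 x1] /andP[y0 y1].
  have [|m0|[m1|m1]] := small (i - j).
  - by rewrite intrB; apply/andP; split; lra.
  - have ij : i = j by clear -m0; lia.
    by apply: Or31; split=> //; rewrite ij in h; lra.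
  - have ij : i = j + 1 by clear -m1; lia.
    by apply: Or32; split=> //; rewrite ij intrD in h; lra.
  - have ij : i = j - 1 by clear -m1; lia.
    by apply: Or33; split=> //; rewrite ij intrB in h; lra.
have dirs (f : pt) : (f \in cub_dirs) || (- f \in cub_dirs) ->
    exists2 g : int, g = 1 \/ g = -1 &
      [\/ f = (0, 0, g), f = (g, 0, 0) | f = (0, g, 0)].
  move=> h; have [h'|h'] := orP h; move: h'; rewrite !inE.
    by case/or3P=> /eqP ->; exists 1; [left|apply: Or31|left|apply: Or32|left|apply: Or33].
  rewrite !eqr_oppLR.
  by case/or3P=> /eqP ->; exists (-1); [right|apply: Or31|right|apply: Or32|right|apply: Or33].
have [g g1 dE] := dirs _ dD; have [h h1 eE] := dirs _ eD.
have scaled (k : int) (r : R) : k = 1 \/ k = -1 -> 0 <= r -> r < 1 ->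
    -1 < r * k%:~R < 1 /\ (r * k%:~R = 0 -> r = 0).
  by move=> [->|->] r0 r1; rewrite ?mulr1 ?mulrN1; split=> [|?]; try lra; apply/andP; split; lra.
have [sg sg0] := scaled g s g1 s0 s1; have [th th0] := scaled h t h1 t0 t1.
have z01 : -1 < (0 : R) < 1 by rewrite ltrN10 ltr01.
(* Along an axis that only one edge follows, the common point is a vertex. *)
have cross (i j : int) (x : R) : -1 < x < 1 -> i%:~R + x = j%:~R -> i = j /\ x = 0.
  move=> xI; rewrite -[RHS]addr0 => /diff -/(_ xI z01)[[]//|[_ x0]|[_ x0]].
    by move/andP: xI; lra.
  by move/andP: xI; lra.
have same (i j : int) : i%:~R + s * g%:~R = j%:~R + t * h%:~R ->
    (i = j /\ s = t) \/ (i + g = j /\ j + h = i).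
  move=> /diff -/(_ sg th)[[-> st]|[-> st]|[-> st]].
  - left; split=> //; case: g1 h1 st => -> [] ->; lra.
  - right; case: g1 st => ->; rewrite ?mulr1z ?mulrN1z => st; first by exfalso; move/andP: th; lra.
    by case: h1 st => -> st; [rewrite addrK|exfalso; move: st; lra].
  - right; case: h1 st => ->; rewrite ?mulr1z ?mulrN1z => st; first by exfalso; move/andP: sg; lra.
    by case: g1 st => -> st; [rewrite subrK|exfalso; move: st; lra].
case: dE eE => -> [] -> /= in ex ey ez *; rewrite ?mulr0 ?addr0 in ex ey ez.
all: try (move: ex => /intr_inj ->); try (move: ey => /intr_inj ->);
  try (move: ez => /intr_inj ->).
- by case: (same _ _ ez) => -[ij st]; [left; rewrite ij|right; split; congr (_, _, _)];
    rewrite ?addr0.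
- move: ex ez => /esym /(cross _ _ _ th)[-> /th0 ->] /(cross _ _ _ sg)[-> /sg0 ->].
  by left.
- move: ey ez => /esym /(cross _ _ _ th)[-> /th0 ->] /(cross _ _ _ sg)[-> /sg0 ->].
  by left.
- move: ez ex => /esym /(cross _ _ _ th)[-> /th0 ->] /(cross _ _ _ sg)[-> /sg0 ->].
  by left.
- by case: (same _ _ ex) => -[ij st]; [left; rewrite ij|right; split; congr (_, _, _)];
    rewrite ?addr0.
- move: ey ex => /esym /(cross _ _ _ th)[-> /th0 ->] /(cross _ _ _ sg)[-> /sg0 ->].
  by left.
- move: ez ey => /esym /(cross _ _ _ th)[-> /th0 ->] /(cross _ _ _ sg)[-> /sg0 ->].
  by left.
- move: ex ey => /esym /(cross _ _ _ th)[-> /th0 ->] /(cross _ _ _ sg)[-> /sg0 ->].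
  by left.
- by case: (same _ _ ey) => -[ij st]; [left; rewrite ij|right; split; congr (_, _, _)];
    rewrite ?addr0.
Qed.

Lemma nth_rot1 (T : Type) (x0 : T) (p : seq T) i : (i < size p)%N ->
  nth x0 (rot 1 p) i = nth x0 p (i.+1 %% size p).
Proof.
case: p => // x p; rewrite /= rot1_cons nth_rcons ltnS leq_eqVlt => /orP[/eqP ->|ip].
  by rewrite ltnn eqxx modnn.
by rewrite ip modn_small.
Qed.

Lemma cubic_polygon l : polygon cub_dirs l ->
  lattice_polygon cubic_lattice (cubic_hor R) [seq cub v | v <- l] /\
  properly_leveled (cubic_hor R) [seq cub v | v <- l].
Proof.
move=> [ul sl al ar].
have adjR : cycle (is_edge (e_z R :: cubic_hor R)) [seq cub v | v <- l].
  by rewrite cub_dirsE cycle_emb //; [exact: cub_inj|exact: cubB].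
split; last first.
  apply/properly_leveled_arcs => //; first exact: cubic_hor0.
  have -> : [seq height q | q <- [seq cub v | v <- l]]
      = [seq (i%:~R : R) | i <- [seq v.2 | v <- l]].
    by rewrite -!map_comp; apply: eq_map => v /=; rewrite -/(zc _) coordE.
  by apply/arcs_map => //; exact: intr_inj.
split=> //; last first.
  move=> _ /mapP[v vl ->]; exists v.1.1, v.1.2, v.2.
  by apply: vecP; rewrite !coordE; ring.
rewrite /simple_closed size_map; split; first exact: ltn_trans sl.
move=> i j s t il jl s01 t01.
pose nxt i := nth 0 l (i.+1 %% size l).
pose d i := nxt i - nth 0 l i.
have l0 : (0 < size l)%N by exact: ltn_trans sl.
have nxtE k : nth 0 l k + d k = nxt k by rewrite /d addrC subrK.
have epE k r : (k < size l)%N ->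
    edge_point [seq cub v | v <- l] k r = cub (nth 0 l k) + r *: cub (d k).
  move=> kl; rewrite /edge_point /edge_src /edge_tgt nth_rot1 size_map //.
  rewrite !(nth_map 0) ?ltn_mod // /d cubB.
  by apply: vecP; rewrite !coordE; ring.
have dD k : (k < size l)%N -> (d k \in cub_dirs) || (- d k \in cub_dirs).
  move=> kl; move: al; rewrite cycle_edges => /(all_nthP (0, 0)) /(_ k).
  by rewrite size_edges /edges nth_zip ?size_rot //= nth_rot1 // /adj opprB => ->.
rewrite !epE // => e.
have {e} : ((nth 0 l i = nth 0 l j) /\ s = t) \/
    (nth 0 l i + d i = nth 0 l j /\ nth 0 l j + d j = nth 0 l i).
  move: (dD i il) (dD j jl) e; case: (nth 0 l i) => -[a b] c; case: (nth 0 l j) => -[a' b'] c'.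
  by move=> di dj; exact: cub_edges_meet.
case=> [[/eqP + st]|]; first by rewrite nth_uniq // => /eqP.
rewrite !nxtE => -[/eqP h1 /eqP h2]; exfalso; move: h1 h2.
rewrite !nth_uniq ?ltn_mod // => /eqP <- /eqP.
rewrite -addn1 modnDml addn1 -addn2 => h.
have : (i + 2 == i + 0 %[mod size l])%N by rewrite h addn0 modn_small.
by rewrite eqn_modDl mod0n modn_small.
Qed.

End Embeddings.

(** * From the sh-lattice to the cubic lattice *)

Definition hor (d : pt) := d.2 == 0.
Definition diag (d : pt) := d \in [:: (-1, 1, 0); (1, -1, 0) : pt].

(** The first vertex of the staircase from [0] to [d + d]; the two diagonals, one
    the opposite of the other, get the same staircase in opposite directions. *)
Definition corner (d : pt) : pt := if d == (-1, 1, 0) then (-1, 0, 0) else (0, -1, 0).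
Definition dbl (v : pt) : pt := (v.1.1 + v.1.1, v.1.2 + v.1.2, v.2).

Definition all_dirs : seq pt := [:: (0, 0, 1); (0, 0, -1); (1, 0, 0); (-1, 0, 0);
  (0, 1, 0); (0, -1, 0); (-1, 1, 0); (1, -1, 0)].

Lemma adj_sh v w : adj sh_dirs v w = (w - v \in all_dirs).
Proof.
rewrite /adj -[v - w]opprB !inE !eqr_oppLR.
by apply/idP/idP; do ?case/orP; move=> /eqP ->.
Qed.

(** Two steps that leave a vertex in the directions [d] and [e] are cut short when
    the staircase of one would start along the other. *)
Definition cutd (d e : pt) := (diag d && (e == corner d)) || (diag e && (d == corner e)).

(** The vertices that a step [d] contributes to the staircase, relative to the
    doubled start of [d]. The flags tell whether the corners at the start and
    at the end of the step are cut; the last vertex belongs to the next step,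
    and a cut corner is joined directly to the middle [d] of the doubled step. *)
Definition offs (c c' : bool) (d : pt) : seq pt :=
  (if c then [::] else 0 :: (if diag d then [:: corner d] else [::])) ++
  (if hor d then d :: (if diag d && ~~ c' then [:: d + d + corner (- d)] else [::])
   else [::]).

Lemma cutd_hor d e : cutd d e -> hor d /\ hor e.
Proof. by case/orP=> /andP[]; rewrite /diag !inE => /orP[] /eqP -> /eqP ->. Qed.

Lemma dblD v w : dbl (v + w) = dbl v + dbl w.
Proof. by rewrite /dbl; congr (_, _, _); rewrite /= addrACA. Qed.

Lemma adj_shift D (a v w : pt) : adj D (a + v) (a + w) = adj D v w.
Proof.
have e x y : a + x - (a + y) = x - y by rewrite [a + x]addrC addrKA.
by rewrite /adj !e.
Qed.

(** The finitely many local pictures are checked by computation. *)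
Lemma offs_adj b d e : b \in all_dirs -> d \in all_dirs -> e \in all_dirs ->
  all (fun p => adj cub_dirs p.1 p.2) (link (offs (cutd (- b) d) (cutd (- d) e) d)
    (dbl d + if cutd (- d) e then e else 0)).
Proof.
move=> bD dD eD.
have /allP/(_ b bD)/allP/(_ d dD)/allP/(_ e eD) : all (fun b => all (fun d => all (fun e =>
    all (fun p => adj cub_dirs p.1 p.2) (link (offs (cutd (- b) d) (cutd (- d) e) d)
    (dbl d + if cutd (- d) e then e else 0))) all_dirs) all_dirs) all_dirs.
  by vm_compute.
by [].
Qed.

(** Level bits of the staircase arise from those of the original polygon by
    repetition, as each step is replaced with several edges in the same level. *)
Definition inflate (s : seq (nat * bool)) := flatten [seq nseq x.1 x.2 | x <- s].

Lemma inflate_const b s m : [seq x.2 | x <- s] = nseq m b ->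
  inflate s = nseq (\sum_(x <- s) x.1) b.
Proof.
elim: s m => [|x s IH] [|m] //=; first by rewrite /inflate big_nil.
by move=> [xb /IH e]; rewrite big_cons nseqD -e /inflate /= xb.
Qed.

Lemma single_arc_inflate s : all (fun x => 0 < x.1)%N s ->
  single_arc [seq x.2 | x <- s] -> single_arc (inflate s).
Proof.
move=> s_gt0 [r [m [f e]]].
have rotI : exists k, rot k (inflate s) = inflate (rot r s).
  exists (size (inflate (take r s))).
  rewrite {2}/rot /inflate map_cat flatten_cat -/(inflate _).
  by rewrite -{2}(cat_take_drop r s) map_cat flatten_cat rot_size_cat.
have s_gt0' : all (fun x => 0 < x.1)%N (rot r s).
  by apply/allP => x; rewrite mem_rot => /(allP s_gt0).
have [k kE] := rotI; move: e s_gt0'; rewrite -map_rot => e s_gt0'.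
exists k; rewrite kE {k kE rotI s_gt0}.
move: (rot r s) e s_gt0' => {}s e.
have [s1 [s2 [-> e1 e2]]] : exists s1 s2, [/\ s = s1 ++ s2,
    [seq x.2 | x <- s1] = nseq m true & [seq x.2 | x <- s2] = nseq f.+1 false].
  exists (take m s), (drop m s); rewrite cat_take_drop map_take map_drop e.
  by split=> //; rewrite ?take_size_cat ?drop_size_cat ?size_nseq.
rewrite all_cat => /andP[_ a2].
exists (\sum_(x <- s1) x.1)%N, (\sum_(x <- s2) x.1).-1.
rewrite /inflate map_cat flatten_cat -!/(inflate _) (inflate_const e1) (inflate_const e2).
rewrite prednK //; case: s2 e2 a2 => //= x s2 _ /andP[x0 _].
by rewrite big_cons addn_gt0 x0.
Qed.

Lemma mem_inflate s b : b \in inflate s -> b \in [seq x.2 | x <- s].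
Proof.
case/flattenP=> _ /mapP[x xs ->]; rewrite mem_nseq => /andP[_ /eqP ->].
exact: map_f.
Qed.

Lemma single_arc_rot k bs : single_arc bs -> single_arc (rot k bs).
Proof.
move=> [r [m [f e]]].
have [r' r'E] : exists r', rot r' (rot k bs) = rot r bs.
  have rotn r1 (s : seq bool) : exists2 r2, (r2 <= size s)%N & rot r1 s = rot r2 s.
    case: (leqP r1 (size s)) => h; first by exists r1.
    by exists 0%N; rewrite ?rot0 // rot_oversize // ltnW.
  have bsE : bs = rot (size (rot k bs) - k) (rot k bs).
    by rewrite -/(rotr k (rot k bs)) rotK.
  have [r2 r2s ->] := rotn r bs.
  have -> : rot r2 bs = rot r2 (rot (size (rot k bs) - k) (rot k bs)) by rewrite -bsE.
  by rewrite rot_add_mod ?leq_subr ?size_rot //; eexists.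
by exists r', m, f; rewrite r'E.
Qed.

Section Staircase.
Variable l : seq pt.
Hypothesis poly : polygon sh_dirs l.
Notation n := (size l).

(** Vertices are indexed by all natural numbers, cyclically, so that successors
    need no case distinction at the end of [l]. *)
Definition vtx i : pt := nth 0 l (i %% n).
Definition step i : pt := vtx i.+1 - vtx i.
Arguments vtx : simpl never.
Arguments step : simpl never.
Definition cut_at i := cutd (- step i) (step i.+1).
Definition blk i := [seq dbl (vtx i.+1) + o | o <- offs (cut_at i) (cut_at i.+1) (step i.+1)].
Definition stair := flatten [seq blk i | i <- iota 0 n].

Lemma n_gt0 : (0 < n)%N. Proof. exact: ltn_trans (polygon_size poly). Qed.

Lemma vtx_mod i j : i = j %[mod n] -> vtx i = vtx j.
Proof. by rewrite /vtx => ->. Qed.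

Lemma vtx_inj i j : vtx i = vtx j -> i = j %[mod n].
Proof.
move/eqP; rewrite /vtx nth_uniq ?ltn_mod ?n_gt0 //; last exact: polygon_uniq poly.
by move/eqP.
Qed.

Lemma modS i j : i = j %[mod n] -> i.+1 = j.+1 %[mod n].
Proof. by move=> e; rewrite -[i.+1]addn1 -[j.+1]addn1 -modnDml e modnDml. Qed.

Lemma modSI i j : i.+1 = j.+1 %[mod n] -> i = j %[mod n].
Proof. by move=> /eqP; rewrite -[i.+1]addn1 -[j.+1]addn1 eqn_modDr => /eqP. Qed.

Lemma step_mod i j : i = j %[mod n] -> step i = step j.
Proof. by move=> e; rewrite /step (vtx_mod e) (vtx_mod (modS e)). Qed.

Lemma cut_mod i j : i = j %[mod n] -> cut_at i = cut_at j.
Proof. by move=> e; rewrite /cut_at (step_mod e) (step_mod (modS e)). Qed.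

Lemma edges_vtx : edges l = [seq (vtx i, vtx i.+1) | i <- iota 0 n].
Proof.
apply: (@eq_from_nth _ (0, 0)); first by rewrite size_edges size_map size_iota.
move=> i; rewrite size_edges => il.
rewrite /edges nth_zip ?size_rot // (nth_map 0%N) ?size_iota // nth_iota // add0n.
by rewrite nth_rot1 // /vtx (modn_small il).
Qed.

Lemma rot_edges_vtx : rot 1 (edges l) = [seq (vtx i.+1, vtx i.+2) | i <- iota 0 n].
Proof.
apply: (@eq_from_nth _ (0, 0)); first by rewrite size_rot size_edges size_map size_iota.
move=> i; rewrite size_rot size_edges => il.
rewrite nth_rot1 ?size_edges // edges_vtx.
rewrite !(nth_map 0%N) ?size_iota ?ltn_mod ?n_gt0 // !nth_iota ?ltn_mod ?n_gt0 //.
by rewrite !add0n (vtx_mod (modn_mod _ _)) (vtx_mod (modS (modn_mod _ _))).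
Qed.

Lemma step_dir i : step i \in all_dirs.
Proof.
rewrite -adj_sh; have := polygon_adj poly; rewrite cycle_edges edges_vtx all_map.
move/allP/(_ (i %% n)%N); rewrite mem_iota add0n ltn_mod n_gt0 => /(_ isT) /=.
by rewrite (vtx_mod (modn_mod i n)) (vtx_mod (modS (modn_mod i n))).
Qed.

Lemma vtxS i : vtx i.+1 = vtx i + step i.
Proof. by rewrite /step addrC subrK. Qed.

(** Going back along an edge would close the path after two edges, but a polygon
    has more vertices. *)
Lemma no_return i : step i.+1 != - step i.
Proof.
apply/eqP => e; have : vtx i.+2 = vtx i by rewrite vtxS vtxS e addrK.
move/vtx_inj => /eqP; rewrite -[in X in _ == X](addn0 i) -addn2 eqn_modDl mod0n.
by rewrite modn_small // (polygon_size poly).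
Qed.

Lemma head_blk i : blk i = (dbl (vtx i.+1) + (if cut_at i then step i.+1 else 0)) ::
  behead (blk i).
Proof.
rewrite /blk /offs; case: (boolP (cut_at i)) => // /cutd_hor[_ ->].
by [].
Qed.

Definition hd i := dbl (vtx i.+1) + (if cut_at i then step i.+1 else 0).

Lemma edges_stair :
  edges stair = flatten [seq link (blk i) (hd i.+1) | i <- iota 0 n].
Proof.
have sE : stair = flatten [seq hd i :: behead (blk i) | i <- iota 0 n].
  by congr flatten; apply: eq_map => i; exact: head_blk.
have hdn : hd 0 = hd (0 + n).
  have e : 0 = (0 + n)%N %[mod n] by rewrite add0n modnn mod0n.
  by rewrite /hd (cut_mod e) (vtx_mod (modS e)) (step_mod (modS e)).
transitivity (link stair (hd 0)).
  by rewrite sE; move: n_gt0; case: n => //= k _; rewrite edges_link.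
rewrite hdn sE link_flatten ?n_gt0 //; congr flatten; apply: eq_map => i.
by rewrite -head_blk.
Qed.

Lemma stair_adj : cycle (adj cub_dirs) stair.
Proof.
rewrite cycle_edges edges_stair; apply/allP => x /flattenP[_ /mapP[i _ ->]].
rewrite /hd vtxS dblD -addrA /blk link_map => /mapP[y yin ->] {x} /=.
rewrite adj_shift.
exact: (allP (offs_adj (step_dir i) (step_dir i.+1) (step_dir i.+2)) y yin).
Qed.

Lemma mem_blk i x : x \in blk i ->
  [\/ x = dbl (vtx i.+1) /\ ~~ cut_at i,
      x = dbl (vtx i.+1) + step i.+1 /\ hor (step i.+1),
      [/\ x = dbl (vtx i.+1) + corner (step i.+1), diag (step i.+1) & ~~ cut_at i]
    | [/\ x = dbl (vtx i.+2) + corner (- step i.+1), diag (step i.+1) & ~~ cut_at i.+1]].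
Proof.
case/mapP=> o + ->; rewrite /offs mem_cat => /orP[].
  case: (cut_at i) => //; rewrite inE => /orP[/eqP ->|]; first by rewrite addr0; apply: Or41.
  by case: ifP => // dd; rewrite inE => /eqP ->; apply: Or43.
case: ifP => // hh; rewrite inE => /orP[/eqP ->|]; first exact: Or42.
case: ifP => // /andP[dd cc]; rewrite inE => /eqP ->; apply: Or44; split=> //.
rewrite [vtx i.+2]vtxS; move: (vtx i.+1) (step i.+1) hh => v [[a b] c].
rewrite /hor /= => /eqP ->.
by rewrite dblD -[RHS]addrA.
Qed.

Definition hex_dirs : seq pt := [:: (1, 0, 0); (-1, 0, 0);
  (0, 1, 0); (0, -1, 0); (-1, 1, 0); (1, -1, 0)].

(** Half steps are odd: two shifted vertices agree only if they agree before
    shifting or are the midpoint of two neighbours. *)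
Lemma dbl_shift_inj v w o o' : o \in 0 :: hex_dirs -> o' \in 0 :: hex_dirs ->
  dbl v + o = dbl w + o' -> (v = w /\ o = o') \/ [/\ o != 0, w = v + o & o' = - o].
Proof.
move: v w => [[a b] c] [[a' b'] c'] oh oh' e.
have [e1 e2 e3] : [/\ a + a + o.1.1 = a' + a' + o'.1.1,
    b + b + o.1.2 = b' + b' + o'.1.2 & c + o.2 = c' + o'.2] by case: e.
have [oe|on] := eqVneq o o'.
  left; split=> //; move: e1 e2 e3; rewrite oe => /addIr e1 /addIr e2 /addIr ->.
  by congr (_, _, _); clear -e1 e2; lia.
have [oN|oN] := eqVneq o' (- o).
  right; move: e1 e2 e3; rewrite oN /=; split=> //.
    by apply/eqP => o0; move: on; rewrite oN o0 oppr0 eqxx.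
  have o2 : o.2 = 0 by move: oh; do ?case/orP; do ?[move=> /eqP -> //].
  case: o oh e e1 e2 e3 on oN o2 => [[x y] z] _ _ /= e1 e2 e3 _ _ o2.
  by congr (_, _, _); rewrite /=; clear -e1 e2 e3 o2; lia.
exfalso; move: e1 e2 on oN; clear -oh oh'.
have : all (fun o => all (fun o' => [|| o == o', o' == - o,
   (absz (o.1.1 - o'.1.1)) %% 2 == 1 | (absz (o.1.2 - o'.1.2)) %% 2 == 1])%N (0 :: hex_dirs)) (0 :: hex_dirs).
  by vm_compute.
move=> /allP/(_ o oh)/allP/(_ o' oh') h e1 e2 /negbTE on /negbTE oN.
move: h e1 e2; rewrite on oN; clear; move: o o' => [[x y] z] [[x' y'] z'] /=.
move=> /orP[/eqP h|/eqP h] e1 e2; [clear -h e1|clear -h e2]; lia.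
Qed.

Lemma hex_step i : hor (step i) -> step i \in hex_dirs.
Proof. by have := step_dir i; rewrite !inE; do ?case/orP; move=> /eqP ->. Qed.

Lemma hex_dirs0 o : o \in hex_dirs -> o \in 0 :: hex_dirs.
Proof. by move=> oh; rewrite inE oh orbT. Qed.

Lemma hex_neq0 o : o \in hex_dirs -> o != 0.
Proof. by rewrite !inE; do ?case/orP; move=> /eqP ->. Qed.

Lemma corner_hex d : corner d \in hex_dirs.
Proof. by rewrite /corner; case: ifP. Qed.

Lemma corner_opp d e : corner d <> - corner e.
Proof. by rewrite /corner; do 2!case: ifP. Qed.

Lemma corner_inj d e : diag d -> diag e -> corner d = corner e -> d = e.
Proof. by rewrite /diag !inE => /orP[] /eqP -> /orP[] /eqP ->. Qed.

Lemma corner_neq d : diag d -> corner d <> d /\ corner d <> - d.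
Proof. by rewrite /diag !inE => /orP[] /eqP ->. Qed.

Lemma diagN d : diag d -> diag (- d).
Proof. by rewrite /diag !inE => /orP[] /eqP ->. Qed.

(** The next three lemmas separate the vertices of different steps. By
    [dbl_shift_inj], two of them agree only if they belong to the same vertex or
    to the same edge; [cut_at], [no_return] and the choice of [corner] exclude
    both. *)
Lemma mid_neq_pre i j : hor (step i.+1) -> diag (step j.+1) -> ~~ cut_at j ->
  dbl (vtx i.+1) + step i.+1 <> dbl (vtx j.+1) + corner (step j.+1).
Proof.
move=> hi dj cj.
case/(dbl_shift_inj (hex_dirs0 (hex_step hi)) (hex_dirs0 (corner_hex _))) => [[vE oE]|[_ vE oE]].
  have e := vtx_inj vE; rewrite (step_mod e) in oE.
  by have [h _] := corner_neq dj; exact: h (esym oE).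
rewrite -vtxS in vE; have e := modSI (vtx_inj vE).
by move: cj; rewrite /cut_at /cutd dj oE (step_mod e) eqxx orbT.
Qed.

Lemma mid_neq_post i j : hor (step i.+1) -> diag (step j.+1) -> ~~ cut_at j.+1 ->
  dbl (vtx i.+1) + step i.+1 <> dbl (vtx j.+2) + corner (- step j.+1).
Proof.
move=> hi dj cj.
case/(dbl_shift_inj (hex_dirs0 (hex_step hi)) (hex_dirs0 (corner_hex _))) => [[vE oE]|[_ vE oE]].
  have e := vtx_inj vE.
  by move: cj; rewrite /cut_at /cutd diagN // -(step_mod e) oE eqxx.
rewrite -vtxS in vE; have e := modSI (vtx_inj vE).
have [h _] := corner_neq (diagN dj); apply: h.
by rewrite oE (step_mod e).
Qed.

Lemma pre_neq_post i j : diag (step i.+1) -> diag (step j.+1) ->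
  dbl (vtx i.+1) + corner (step i.+1) <> dbl (vtx j.+2) + corner (- step j.+1).
Proof.
move=> di dj.
case/(dbl_shift_inj (hex_dirs0 (corner_hex _)) (hex_dirs0 (corner_hex _))) => [[vE oE]|[_ _ oE]].
  have e := corner_inj di (diagN dj) oE.
  by have /eqP[] := no_return j.+1; rewrite -(step_mod (vtx_inj vE)).
by case: (@corner_opp (- step j.+1) (step i.+1)).
Qed.

Lemma blk_disjoint i j x : x \in blk i -> x \in blk j -> i = j %[mod n].
Proof.
have vtx0 p q o : o \in hex_dirs -> dbl (vtx p) <> dbl (vtx q) + o.
  move=> oh; rewrite -[dbl (vtx p)]addr0.
  case/(dbl_shift_inj (mem_head _ _) (hex_dirs0 oh)) => [[_ oE]|[]]; last by rewrite eqxx.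
  by have := hex_neq0 oh; rewrite -oE eqxx.
have same p q d e : dbl (vtx p) + corner d = dbl (vtx q) + corner e -> p = q %[mod n].
  case/(dbl_shift_inj (hex_dirs0 (corner_hex _)) (hex_dirs0 (corner_hex _))).
    by case=> /vtx_inj.
  by case=> _ _ oE; case: (@corner_opp e d).
move=> /mem_blk xi /mem_blk xj.
case: xi xj => [[-> ci]|[-> hi]|[-> di ci]|[-> di ci]]
  [[e cj]|[e hj]|[e dj cj]|[e dj cj]].
- move: e; rewrite -[LHS]addr0 -[RHS]addr0.
  case/(dbl_shift_inj (mem_head _ _) (mem_head _ _)) => [[/vtx_inj/modSI]//|[]].
  by rewrite eqxx.
- by case/vtx0: e; exact: hex_step.
- by case/vtx0: e; exact: corner_hex.
- by case/vtx0: e; exact: corner_hex.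
- by case/esym/vtx0: e; exact: hex_step.
- move: e; case/(dbl_shift_inj (hex_dirs0 (hex_step hi)) (hex_dirs0 (hex_step hj))).
    by case=> /vtx_inj/modSI.
  case=> _; rewrite -vtxS => /vtx_inj/modSI e oE; exfalso.
  by have /eqP[] := no_return i.+1; rewrite -oE; apply: step_mod (modS (esym e)).
- by case/mid_neq_pre: e.
- by case/mid_neq_post: e.
- by case/esym/vtx0: e; exact: corner_hex.
- by case/esym/mid_neq_pre: e.
- exact: modSI (same _ _ _ _ e).
- by case/pre_neq_post: e.
- by case/esym/vtx0: e; exact: corner_hex.
- by case/esym/mid_neq_post: e.
- by case/esym/pre_neq_post: e.
- exact: modSI (modSI (same _ _ _ _ e)).
Qed.

Lemma offs_uniq c c' i : uniq (offs c c' (step i)).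
Proof.
have := step_dir i; rewrite !inE.
by do ?case/orP; move=> /eqP ->; case: c; case: c'.
Qed.

Lemma stair_uniq : uniq stair.
Proof.
have : {subset iota 0 n <= gtn n} by move=> i; rewrite mem_iota.
rewrite /stair; elim: (iota 0 n) (iota_uniq 0 n) => //= i s IH /andP[sN us] sub.
rewrite cat_uniq IH ?andbT //; last by move=> j js; apply: sub; rewrite inE js orbT.
rewrite map_inj_uniq ?offs_uniq; last exact: addrI.
apply/hasPn => x /flattenP[_ /mapP[j js ->]] xj; apply/negP => xi.
have := blk_disjoint xi xj; rewrite !modn_small.
- by move=> ij; move: sN; rewrite ij js.
- by apply: sub; rewrite inE js orbT.
- by apply: sub; rewrite inE eqxx.
Qed.

(** The largest number of edges by which a step of direction [d] is replaced. *)
Definition weight (d : pt) : nat := if ~~ hor d then 1 else if diag d then 4 else 2.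

Lemma size_blk i : (0 < size (blk i) <= weight (step i.+1))%N.
Proof.
rewrite /blk size_map; have := @cutd_hor (- step i) (step i.+1); rewrite -/(cut_at i).
have := step_dir i.+1; rewrite !inE.
by do ?case/orP; move=> /eqP ->; case: (cut_at i) => h; case: (cut_at i.+1) => //;
  have [] := h isT.
Qed.

Lemma size_stair : (size stair <= \sum_(e <- edges l) weight (e.2 - e.1)%R)%N.
Proof.
have pe : perm_eq (edges l) (rot 1 (edges l)) by rewrite perm_sym perm_rot.
rewrite (perm_big _ pe) rot_edges_vtx /stair size_flatten /shape -map_comp sumnE !big_map.
by apply: leq_sum => i _ /=; case/andP: (size_blk i).
Qed.

Lemma stair_gt2 : (2 < size stair)%N.
Proof.
apply: leq_trans (polygon_size poly) _.
rewrite /stair size_flatten /shape -map_comp sumnE big_map.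
rewrite -[leqLHS](size_iota 0) -sum1_size; apply: leq_sum => i _ /=.
by case/andP: (size_blk i).
Qed.

Lemma snd_add (v w : pt) : (v + w).2 = v.2 + w.2. Proof. by []. Qed.

Lemma hor_heights i : hor (step i) -> (vtx i.+1).2 = (vtx i).2.
Proof. by rewrite vtxS /hor /= => /eqP ->; rewrite addr0. Qed.

Lemma diag_hor d : diag d -> hor d.
Proof. by rewrite /diag !inE => /orP[] /eqP ->. Qed.

Lemma corner_height d : (corner d).2 = 0.
Proof. by rewrite /corner; case: ifP. Qed.

Lemma blk_height i x : x \in blk i -> x.2 = (vtx i.+1).2.
Proof.
case/mem_blk => [[-> _]|[-> /eqP h]|[-> _ _]|[-> /diag_hor h _]] //.
- by rewrite snd_add h addr0.
- by rewrite snd_add corner_height addr0.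
- by rewrite snd_add corner_height addr0 /dbl hor_heights.
Qed.

Lemma hd_in i : hd i \in blk i.
Proof. by rewrite head_blk mem_head. Qed.

Lemma mem_link (T : eqType) (s : seq T) y x :
  x \in link s y -> x.1 \in s /\ (x.2 \in s \/ x.2 = y).
Proof.
rewrite /link => xin; split.
  have := map_f (fun x => x.1) xin; rewrite -/unzip1 unzip1_zip //.
  by rewrite size_rcons size_behead; case: (size s).
have : x.2 \in unzip2 (zip s (rcons (behead s) y)) by apply: (map_f (fun x => x.2)).
have h : (size s <= size (rcons (behead s) y))%N.
  by rewrite size_rcons size_behead; case: (size s).
move=> x2; have {x2} : x.2 \in rcons (behead s) y.
  by move: x2; elim: s (rcons _ y) {xin h} => [|a s IH] [|b t] //=;
    rewrite !inE => /orP[->//|/IH ->]; rewrite orbT.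
by rewrite mem_rcons inE => /orP[/eqP|/mem_behead]; [right|left].
Qed.

Lemma level_bits_stair k : level_bits [seq v.2 | v <- stair] k = inflate
  [seq (size (blk i), ((vtx i.+1).2 == k) && ((vtx i.+2).2 == k)) | i <- iota 0 n].
Proof.
rewrite /level_bits edges_map -map_comp edges_stair map_flatten /inflate -!map_comp.
congr flatten; apply: eq_map => i /=.
have [hh|vv] := boolP (hor (step i.+1)).
  have sz : size (link (blk i) (hd i.+1)) = size (blk i).
    by rewrite /link size_zip size_rcons size_behead head_blk /= minnn.
  rewrite -sz -(size_map (fun x => (x.1.2 == k) && (x.2.2 == k))).
  apply/all_pred1P/allP => _ /mapP[x /mem_link[x1 x2] ->] /=.
  rewrite (blk_height x1); case: x2 => [/blk_height ->|->].
    by rewrite (hor_heights hh).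
  by rewrite (blk_height (hd_in _)).
have -> : blk i = [:: dbl (vtx i.+1)].
  rewrite /blk /offs (negbTE vv); case: (boolP (cut_at i)) => [/cutd_hor[_]|_].
    by rewrite (negbTE vv).
  by case: (boolP (diag _)) => [/diag_hor|_] /=; [rewrite (negbTE vv)|rewrite addr0].
by rewrite -(blk_height (hd_in i.+1)).
Qed.

Lemma stair_arcs : arcs [seq v.2 | v <- stair].
Proof.
move=> k; rewrite level_bits_stair => /mem_inflate kin.
have bE : [seq x.2 | x <- [seq (size (blk i), ((vtx i.+1).2 == k) && ((vtx i.+2).2 == k))
    | i <- iota 0 n]] = rot 1 (level_bits [seq v.2 | v <- l] k).
  by rewrite /level_bits edges_map -!map_rot rot_edges_vtx -!map_comp.
apply: single_arc_inflate.
  by rewrite all_map; apply/allP => i _ /=; case/andP: (size_blk i).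
rewrite bE; move: kin; rewrite bE mem_rot => /(polygon_arcs poly)[r [m [f e]]].
by apply: single_arc_rot; exists r, m, f.
Qed.

Lemma stair_polygon : polygon cub_dirs stair.
Proof.
by split; [exact: stair_uniq|exact: stair_gt2|exact: stair_adj|exact: stair_arcs].
Qed.

End Staircase.

(** * The staircase is isotopic to the polygon *)

Section LocalGeometry.
Variable R : realType.
Notation V := 'rV[R]_3.
Implicit Types (q w : V) (a b d e D : pt) (s : R).

Lemma diagP d : diag d -> d = (-1, 1, 0) \/ d = (1, -1, 0).
Proof. by rewrite /diag !inE => /orP[] /eqP ->; [left|right]. Qed.

(** A step is doubled horizontally but not vertically, so its half is [d] itself
    in the horizontal directions and half of [d] in the vertical one. *)
Definition hv d : V := vec3 d.1.1%:~R d.1.2%:~R (d.2%:~R / 2).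

(** The doubled polygon is cut at the midpoints of its edges into one star of two
    half edges for each vertex [w]. A staircase passes through the midpoint of
    its diagonal, so it is cut there, too, and [star] can be replaced with
    [star'] at one vertex after the other. *)
Definition bent w d : seq (V * V) :=
  if diag d then [:: (w, w + hv (corner d)); (w + hv (corner d), w + hv d)]
  else [:: (w, w + hv d)].

Definition star w d e : seq (V * V) := [:: (w, w + hv d); (w, w + hv e)].

Definition star' w d e : seq (V * V) :=
  if cutd d e then [:: (w + hv d, w + hv e)] else bent w d ++ bent w e.

Definition slab (t z : R) :=
  [/\ t + 2 * z <= 1, t - 2 * z <= 1, - t + 2 * z <= 1 & - t - 2 * z <= 1].

(** A hexagonal bipyramid around a vertex; its corners are the midpoints of the
    eight edges at that vertex. *)
Definition bipyramid q :=
  [/\ slab (xc q) (zc q), slab (yc q) (zc q) & slab (xc q + yc q) (zc q)].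

Lemma hv0 : hv 0 = 0.
Proof. by apply: vecP; rewrite /hv !coordE /= ?mul0r. Qed.

Lemma hvN d : hv (- d) = - hv d.
Proof. by apply: vecP; rewrite /hv !coordE /= rmorphN ?mulNr. Qed.

Lemma cubD (v w : pt) : cub R (v + w) = cub R v + cub R w.
Proof. by apply: vecP; rewrite /cub !coordE /= intrD. Qed.

Lemma cub_dbl d : cub R (dbl d) = hv d + hv d.
Proof. by apply: vecP; rewrite /cub /hv !coordE /= ?intrD //; field. Qed.

Lemma hv_hor d : hor d -> hv d = cub R d.
Proof.
by rewrite /hor => /eqP h; apply: vecP; rewrite /cub /hv !coordE // h mul0r.
Qed.

Lemma bipyramid_hv a : a \in 0 :: all_dirs -> bipyramid (hv a).
Proof.
rewrite inE => /orP[/eqP ->|]; first by rewrite hv0 /bipyramid !coordE; split; split; lra.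
by rewrite !inE; do ?case/orP; move=> /eqP ->; rewrite /bipyramid /hv !coordE /=; split; split; lra.
Qed.

Lemma bipyramid_convex q q' s : 0 <= s <= 1 -> bipyramid q -> bipyramid q' ->
  bipyramid ((1 - s) *: q + s *: q').
Proof.
move=> /andP[s0 s1].
have sl (t z t' z' : R) : slab t z -> slab t' z' ->
    slab ((1 - s) * t + s * t') ((1 - s) * z + s * z').
  have comb (x y : R) : x <= 1 -> y <= 1 -> (1 - s) * x + s * y <= 1 by move=> *; nra.
  move=> [a1 a2 a3 a4] [b1 b2 b3 b4].
  by split; [have := comb _ _ a1 b1|have := comb _ _ a2 b2|have := comb _ _ a3 b3|have := comb _ _ a4 b4]; lra.
move=> [a1 a2 a3] [b1 b2 b3]; rewrite /bipyramid !coordE; split; [exact: sl|exact: sl|].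
have E (x y x' y' : R) : (1 - s) * x + s * x' + ((1 - s) * y + s * y')
    = (1 - s) * (x + y) + s * (x' + y') by ring.
by rewrite E; exact: sl.
Qed.

(** Twice the inner product that makes the eight half edges unit vectors; it
    exposes each of them as a corner of the bipyramid. *)
Definition ip a b : int := 2 * (a.1.1 * b.1.1 + a.1.2 * b.1.2)
  + (a.1.1 * b.1.2 + a.1.2 * b.1.1) + 2 * (a.2 * b.2).

Definition rip q b : R := 2 * (xc q * b.1.1%:~R + yc q * b.1.2%:~R)
  + (xc q * b.1.2%:~R + yc q * b.1.1%:~R) + 4 * (zc q * b.2%:~R).

Lemma rip_hv a b : rip (hv a) b = (ip a b)%:~R.
Proof. by rewrite /rip /ip /hv !coordE !(intrD, intrM); field. Qed.

Lemma rip_lin q q' k k' b : rip (k *: q + k' *: q') b = k * rip q b + k' * rip q' b.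
Proof. by rewrite /rip !coordE; ring. Qed.

Lemma ip_le1 a D : a \in 0 :: all_dirs -> D \in all_dirs -> a != D -> ip a D <= 1.
Proof.
move=> aD DD aneq.
have /allP/(_ a aD)/allP/(_ D DD) : all (fun a => all (fun D =>
  (a == D) || (ip a D <= 1)) all_dirs) (0 :: all_dirs) by vm_compute.
by rewrite (negbTE aneq).
Qed.

Lemma ip_self D : D \in all_dirs -> ip D D = 2.
Proof. by rewrite !inE; do ?case/orP; move=> /eqP ->. Qed.

Lemma segment_corner a b D w q : a \in 0 :: all_dirs -> b \in 0 :: all_dirs ->
  D \in all_dirs -> segment (w + hv a) (w + hv b) q -> q = w + hv D ->
  D = a \/ D = b.
Proof.
move=> aD bD DD [s [/andP[s0 s1] ->]] e.
have {}e : (1 - s) *: hv a + s *: hv b = hv D.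
  by apply: (addrI w); rewrite -e; apply: vecP; rewrite !coordE; ring.
have := congr1 (fun q => rip q D) e; rewrite rip_lin !rip_hv (ip_self DD).
have [->|aneq] := eqVneq a D; first by left.
have [->|bneq] := eqVneq b D; first by right.
have := ip_le1 aD DD aneq; have := ip_le1 bD DD bneq.
rewrite -!(ler_int R) => h1 h2 h3; exfalso; nra.
Qed.

Lemma triangle_corner a b D w q : a \in 0 :: all_dirs -> b \in 0 :: all_dirs ->
  D \in all_dirs -> triangle w (w + hv a) (w + hv b) q -> q = w + hv D ->
  D = a \/ D = b.
Proof.
move=> aD bD DD [x [y [z [x0 y0 z0 xyz ->]]]] e.
have {}e : y *: hv a + z *: hv b = hv D.
  apply: (addrI w); rewrite -e; apply: vecP; rewrite !coordE.
  - by rewrite -[X in X + _ = _]mul1r -xyz; ring.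
  - by rewrite -[X in X + _ = _]mul1r -xyz; ring.
  - by rewrite -[X in X + _ = _]mul1r -xyz; ring.
have := congr1 (fun q => rip q D) e; rewrite rip_lin !rip_hv (ip_self DD).
have [->|aneq] := eqVneq a D; first by left.
have [->|bneq] := eqVneq b D; first by right.
have := ip_le1 aD DD aneq; have := ip_le1 bD DD bneq.
rewrite -!(ler_int R) => h1 h2 h3; exfalso; nra.
Qed.

(** Adding up the inequalities of both bipyramids bounds the difference of the two
    vertices. Its only integer values are the eight directions of edges, and
    each of them leaves a single point [q]. *)
Lemma bipyramids_meet (v w : pt) q : v != w ->
  bipyramid (q - cub R (dbl v)) -> bipyramid (q - cub R (dbl w)) ->
  w - v \in all_dirs /\ q = cub R (dbl v) + hv (w - v).
Proof.
move=> vw; rewrite /bipyramid /slab.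
have -> : cub R (dbl w) = cub R (dbl v) + cub R (dbl (w - v)).
  by rewrite -cubD -dblD addrC subrK.
have D0 : w - v != 0 by rewrite subr_eq0 eq_sym.
move: (w - v) D0 => {vw} [[a b] c] D0; move: (cub R (dbl v)) => u.
rewrite !coordE /= !intrD.
move=> [[x1 x2 x3 x4] [y1 y2 y3 y4] [z1 z2 z3 z4]] [[x5 x6 x7 x8] [y5 y6 y7 y8] [z5 z6 z7 z8]].
have bounds (i j : int) : (i%:~R + j%:~R <= 1 :> R) -> i + j <= 1.
  by rewrite -intrD -(ler_int R).
have boundsB (i j : int) : (i%:~R - j%:~R <= 1 :> R) -> i - j <= 1.
  by rewrite -intrB -(ler_int R).
have [ha ha' ha'' ha'''] : [/\ a + c <= 1, a - c <= 1, c - a <= 1 & - a - c <= 1].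
  split; [apply: bounds; lra|apply: boundsB; lra|apply: boundsB; lra|].
  by apply: boundsB; rewrite intrN; lra.
have [hb hb' hb'' hb'''] : [/\ b + c <= 1, b - c <= 1, c - b <= 1 & - b - c <= 1].
  split; [apply: bounds; lra|apply: boundsB; lra|apply: boundsB; lra|].
  by apply: boundsB; rewrite intrN; lra.
have [hc hc' hc'' hc'''] : [/\ (a + b) + c <= 1, (a + b) - c <= 1, c - (a + b) <= 1
    & - (a + b) - c <= 1].
  split; [apply: bounds|apply: boundsB|apply: boundsB|apply: boundsB]; rewrite ?intrN !intrD; lra.
have DD : (a, b, c) \in all_dirs.
  move: D0 ha ha' ha'' ha''' hb hb' hb'' hb''' hc hc' hc'' hc'''; clear.
  move=> D0 ha ha' ha'' ha''' hb hb' hb'' hb''' hc hc' hc'' hc'''.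
  have a3 : a = -1 \/ a = 0 \/ a = 1 by clear -ha ha' ha'' ha'''; lia.
  have b3 : b = -1 \/ b = 0 \/ b = 1 by clear -hb hb' hb'' hb'''; lia.
  have c3 : c = -1 \/ c = 0 \/ c = 1 by clear -ha ha' ha'' ha'''; lia.
  move: a3 b3 c3 D0 ha ha' ha'' ha''' hb hb' hb'' hb''' hc hc' hc'' hc'''.
  by move=> [->|[->|->]] [->|[->|->]] [->|[->|->]].
clear ha ha' ha'' ha''' hb hb' hb'' hb''' hc hc' hc'' hc''' bounds boundsB D0.
split=> //; move: DD; rewrite !inE.
by do ?case/orP; move=> /eqP[ea eb ec]; subst a b c;
  apply: vecP; rewrite /hv !coordE /=; lra.
Qed.

Lemma corner_dirs d : d \in all_dirs -> corner d \in all_dirs.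
Proof. by rewrite /corner; case: ifP. Qed.

(** Only finitely many directions occur around a vertex, so that [segment_corner]
    and [triangle_corner] apply to all segments there. *)
Lemma star_ends w d e (x : V * V) : d \in all_dirs -> e \in all_dirs ->
  x \in star w d e ++ star' w d e ->
  exists a b, [/\ x = (w + hv a, w + hv b),
    a \in [:: 0; d; e; (-1, 0, 0); (0, -1, 0)] & b \in [:: 0; d; e; (-1, 0, 0); (0, -1, 0)]].
Proof.
move=> dD eD.
have corner_in f : corner f \in [:: 0; d; e; (-1, 0, 0); (0, -1, 0)].
  by rewrite /corner; case: ifP; rewrite !inE !eqxx ?orbT.
have half_in f : f \in [:: 0; d; e; (-1, 0, 0); (0, -1, 0)] -> x \in bent w f ->
  exists a b, [/\ x = (w + hv a, w + hv b),
    a \in [:: 0; d; e; (-1, 0, 0); (0, -1, 0)] & b \in [:: 0; d; e; (-1, 0, 0); (0, -1, 0)]].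
  rewrite /bent => fin; case: ifP => _; rewrite !inE.
    case/orP=> /eqP ->; first by exists 0, (corner f); rewrite hv0 addr0 mem_head.
    by exists (corner f), f.
  by move=> /eqP ->; exists 0, f; rewrite hv0 addr0 mem_head.
have din : d \in [:: 0; d; e; (-1, 0, 0); (0, -1, 0)] by rewrite !inE eqxx ?orbT.
have ein : e \in [:: 0; d; e; (-1, 0, 0); (0, -1, 0)] by rewrite !inE eqxx ?orbT.
rewrite mem_cat => /orP[|].
  rewrite !inE => /orP[] /eqP ->; [exists 0, d|exists 0, e];
  by rewrite hv0 addr0 mem_head.
rewrite /star'; case: ifP => _.
  by rewrite inE => /eqP ->; exists d, e.
by rewrite mem_cat => /orP[]; exact: half_in.
Qed.

(** Half edges and their bent forms leave a vertex in one of eight directions.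
    The triangle spans the angle between two adjacent ones, so a third one
    leaves it at once. *)
Lemma half_off_triangle w d e (x : V * V) q : diag d -> e \in all_dirs ->
  e != d -> e != corner d -> x \in (w, w + hv e) :: bent w e ->
  segment x.1 x.2 q -> triangle w (w + hv d) (w + hv (corner d)) q ->
  q = w /\ q = x.1.
Proof.
move=> dd eD ed ec xin [s [s01 ->]] T.
have first_end f : s = 0 -> x = (w, w + hv f) ->
    (1 - s) *: x.1 + s *: x.2 = w /\ (1 - s) *: x.1 + s *: x.2 = x.1.
  by move=> -> -> /=; rewrite subr0 scale1r scale0r addr0.
have [s0 s1] := andP s01.
case: T => x' [y [z [x0 y0 z0 xyz E]]].
have rel f g : x = (w + hv f, w + hv g) ->
    (1 - s) *: hv f + s *: hv g = y *: hv d + z *: hv (corner d).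
  move=> xE; apply: (addrI w); move: E; rewrite xE /=.
  have -> : (1 - s) *: (w + hv f) + s *: (w + hv g) = w + ((1 - s) *: hv f + s *: hv g).
    by apply: vecP; rewrite !coordE; ring.
  move=> ->; have -> : x' = 1 - y - z by lra.
  by apply: vecP; rewrite !coordE; ring.
have {rel}coords f g : x = (w + hv f, w + hv g) ->
    [/\ (1 - s) * xc (hv f) + s * xc (hv g) = y * xc (hv d) + z * xc (hv (corner d)),
        (1 - s) * yc (hv f) + s * yc (hv g) = y * yc (hv d) + z * yc (hv (corner d))
      & (1 - s) * zc (hv f) + s * zc (hv g) = y * zc (hv d) + z * zc (hv (corner d))].
  by move=> /rel h; rewrite -!xcZ -!ycZ -!zcZ -!xcD -!ycD -!zcD h.
have ray f : f \in all_dirs -> f != d -> f != corner d -> x = (w, w + hv f) -> s = 0.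
  move=> fD fd fc xE; have [] := coords 0 f; first by rewrite hv0 addr0.
  move: fD dd fd fc; rewrite /diag !inE => + /orP[] /eqP ->;
  by do ?case/orP; move=> /eqP -> //= _ _; rewrite /hv !coordE /=; lra.
move: xin; rewrite inE => /orP[/eqP xE|].
  by apply: (first_end e) => //; exact: (ray e).
rewrite /bent; case: (boolP (diag e)) => [de|_]; last first.
  by rewrite inE => /eqP xE; apply: (first_end e) => //; exact: (ray e).
rewrite !inE => /orP[] /eqP xE.
  apply: (first_end (corner e)) => //; apply: (ray (corner e)) => //.
  - exact: corner_dirs.
  - by move: ed; case: (diagP dd) => ->; case: (diagP de) => ->.
  - by move: ed; case: (diagP dd) => ->; case: (diagP de) => ->.
exfalso; have [] := coords _ _ xE.
move: ed; case: (diagP dd) => ->; case: (diagP de) => -> //= _;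
  by rewrite /hv !coordE /=; lra.
Qed.

End LocalGeometry.

Section StairIsotopy.
Variables (R : realType) (l : seq pt).
Hypothesis poly : polygon sh_dirs l.
Notation V := 'rV[R]_3.
Notation n := (size l).
Notation vtx := (vtx l).
Notation step := (step l).

Definition pos i : V := cub R (dbl (vtx i)).
Definition star_at i := star (pos i.+1) (- step i) (step i.+1).
Definition star'_at i := star' (pos i.+1) (- step i) (step i.+1).

Lemma dirsN d : d \in all_dirs -> - d \in all_dirs.
Proof. by rewrite !inE; do ?case/orP; move=> /eqP ->. Qed.

Lemma posS i : pos i.+1 = pos i + hv R (step i) + hv R (step i).
Proof. by rewrite /pos (vtxS l i) dblD cubD (cub_dbl R (step i)) addrA. Qed.

Lemma pos_mod i j : i = j %[mod n] -> pos i = pos j.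
Proof. by move=> e; rewrite /pos (vtx_mod e). Qed.

Lemma star_at_mod i j : i = j %[mod n] -> star_at i = star_at j.
Proof.
by move=> e; rewrite /star_at (pos_mod (modS e)) (step_mod e) (step_mod (modS e)).
Qed.

Lemma star'_at_mod i j : i = j %[mod n] -> star'_at i = star'_at j.
Proof.
by move=> e; rewrite /star'_at (pos_mod (modS e)) (step_mod e) (step_mod (modS e)).
Qed.

(** The bipyramids around distinct vertices share at most one midpoint
    ([bipyramids_meet]). It is a corner of both, hence an end of every segment
    that contains it. *)
Lemma rest_off_triangle i k d (x : V * V) q : i <> k %[mod n] ->
  x \in star_at i ++ star'_at i -> diag d ->
  segment x.1 x.2 q -> triangle (pos k.+1) (pos k.+1 + hv R d) (pos k.+1 + hv R (corner d)) q ->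
  exists D, [/\ D = d \/ D = corner d, D = - step k \/ D = step k.+1,
    q = pos k.+1 + hv R D & q = x.1 \/ q = x.2].
Proof.
move=> ik xin dd xq tq.
have si := step_dir poly i; have si1 := step_dir poly i.+1.
have dD : d \in all_dirs by case: (diagP dd) => ->.
have in0 a : a \in [:: 0; - step i; step i.+1; (-1, 0, 0); (0, -1, 0)] -> a \in 0 :: all_dirs.
  rewrite 4!inE => /or4P[/eqP ->|/eqP ->|/eqP ->|].
  - exact: mem_head.
  - by rewrite inE dirsN ?orbT.
  - by rewrite inE si1 orbT.
  - by rewrite inE => /orP[] /eqP ->.
have [a [b [xE /[dup] ain /in0 aD /[dup] bin /in0 bD]]] := star_ends (dirsN si) si1 xin.
have ballx : bipyramid (q - pos i.+1).
  case: xq => s [s01 ->]; rewrite xE /=.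
  have -> : (1 - s) *: (pos i.+1 + hv R a) + s *: (pos i.+1 + hv R b) - pos i.+1
      = (1 - s) *: hv R a + s *: hv R b.
    by apply: vecP; rewrite ![in LHS](xcD, ycD, zcD, xcN, ycN, zcN, xcZ, ycZ, zcZ)
      ![in RHS](xcD, ycD, zcD, xcN, ycN, zcN, xcZ, ycZ, zcZ); ring.
  by apply: bipyramid_convex => //; exact: bipyramid_hv.
have ballt : bipyramid (q - pos k.+1).
  case: tq => x0 [y [z [x00 y0 z0 xyz ->]]].
  have -> : x0 *: pos k.+1 + y *: (pos k.+1 + hv R d) + z *: (pos k.+1 + hv R (corner d))
      - pos k.+1 = y *: hv R d + z *: hv R (corner d).
    have -> : x0 = 1 - y - z by lra.
    by apply: vecP; rewrite ![in LHS](xcD, ycD, zcD, xcN, ycN, zcN, xcZ, ycZ, zcZ)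
      ![in RHS](xcD, ycD, zcD, xcN, ycN, zcN, xcZ, ycZ, zcZ); ring.
  by case: (diagP dd) => ->; rewrite /bipyramid /hv !coordE /=; split; split; lra.
have neq : vtx k.+1 != vtx i.+1.
  by apply/eqP => e; apply: ik; apply: modSI; rewrite (vtx_inj poly e).
have [DD qE] := bipyramids_meet neq ballt ballx.
have DE : vtx i.+1 = vtx k.+1 + (vtx i.+1 - vtx k.+1) by rewrite addrC subrK.
move: (vtx i.+1 - vtx k.+1) DD qE DE => D DD qE DE.
have qE' : q = pos i.+1 + hv R (- D).
  by rewrite qE /pos DE dblD cubD (cub_dbl R D) hvN addrA addrK.
have Dtri : D = d \/ D = corner d.
  by apply: triangle_corner tq qE; rewrite // inE ?dD ?corner_dirs ?orbT.
have Dends : - D = a \/ - D = b.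
  by move: xq; rewrite xE => xq; apply: segment_corner xq qE' => //; exact: dirsN.
exists D; split=> //; last first.
  by case: Dends => e; [left|right]; rewrite qE' e xE.
have : - D \in [:: 0; - step i; step i.+1; (-1, 0, 0); (0, -1, 0)] by case: Dends => ->.
rewrite 4!inE => /or4P[/eqP e|/eqP /oppr_inj e|/eqP e|].
- by case: Dtri (diagP dd) e => -> [] ->.
- right; have /(vtx_inj poly) ik1 : vtx i = vtx k.+1.
    by apply: (addIr (step i)); rewrite -vtxS DE e.
  by rewrite e (step_mod ik1).
- left; have /(vtx_inj poly)/modSI ik1 : vtx i.+2 = vtx k.+1.
    by rewrite vtxS DE -e addrK.
  by rewrite -(step_mod ik1) -e opprK.
- rewrite inE => /orP[] /eqP e; have {}e := congr1 -%R e; rewrite opprK in e.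
    by case: Dtri (diagP dd) e => -> [] ->.
  by case: Dtri (diagP dd) e => -> [] ->.
Qed.

Definition rest_ok k (rest : seq (V * V)) := forall x, x \in rest ->
  exists2 i, i <> k %[mod n] & x \in star_at i ++ star'_at i.

Lemma diag_noncollinear (w : V) d : diag d ->
  noncollinear w (w + hv R d) (w + hv R (corner d)).
Proof.
move=> dd x y; rewrite ![w + _]addrC !addrK => e.
have := congr1 (@xc R) e; have := congr1 (@yc R) e.
by case: (diagP dd) => ->; rewrite /hv !coordE /= => h1 h2; split; lra.
Qed.

(** Bending one diagonal half edge; the other half edge at the same vertex may
    or may not have been bent before. *)
Lemma half_move k d e (rest s : seq (V * V)) :
  (d = - step k /\ e = step k.+1) \/ (d = step k.+1 /\ e = - step k) ->
  ~~ cutd d e -> rest_ok k rest ->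
  s = [:: (pos k.+1, pos k.+1 + hv R e)] \/ s = bent (pos k.+1) e ->
  ambient_isotopic (segs ((pos k.+1, pos k.+1 + hv R d) :: s ++ rest))
                   (segs (bent (pos k.+1) d ++ s ++ rest)).
Proof.
move=> de nc rok sE; rewrite /bent; case: ifP => dd; last exact: ambient_isotopic_refl.
have dD : d \in all_dirs by case: (diagP dd) => ->.
have eD : e \in all_dirs.
  by case: de => -[_ ->]; rewrite ?dirsN // (step_dir poly).
have ed : e != d.
  by case: de => -[-> ->]; have := no_return poly k; rewrite // eq_sym.
have ec : e != corner d by move: nc; rewrite /cutd dd /= negb_or => /andP[].
apply: delta_move; first exact: diag_noncollinear.
move=> x; rewrite mem_cat => /orP[xs|xr] q xq tq.
  have [|-> ->] := half_off_triangle dd eD ed ec _ xq tq; last by split; left.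
  by case: sE xs => ->; [rewrite !inE => ->|rewrite [in X in _ -> X]inE => ->; rewrite orbT].
have [i ik xi] := rok x xr.
have [D [Dt Dk qE qx]] := rest_off_triangle ik xi dd xq tq.
split=> //; right; rewrite qE; congr (_ + hv _ _).
have Dde : D = d \/ D = e by case: de Dk => -[-> ->] [] ->; auto.
case: Dt Dde => // Dc [//|De]; exfalso.
by move: ec; rewrite -De Dc eqxx.
Qed.

Lemma cut_move k (rest : seq (V * V)) : cutd (- step k) (step k.+1) -> rest_ok k rest ->
  ambient_isotopic (segs (star_at k ++ rest)) (segs (star'_at k ++ rest)).
Proof.
move=> ct rok; rewrite /star_at /star /star'_at /star' ct.
suff main d e : (d = - step k /\ e = step k.+1) \/ (d = step k.+1 /\ e = - step k) ->
    diag d -> e = corner d ->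
    ambient_isotopic (segs [:: (pos k.+1, pos k.+1 + hv R d), (pos k.+1, pos k.+1 + hv R e) & rest])
      (segs ((pos k.+1 + hv R d, pos k.+1 + hv R e) :: rest)).
  case/orP: ct => /andP[dd /eqP e]; first by apply: main => //; left.
  have := main (step k.+1) (- step k) (or_intror (conj erefl erefl)) dd e.
  by rewrite /= !segs_cons /= [segment (pos k.+1 + _) _]segmentC setUCA.
move=> de dd eE; apply: ambient_isotopic_sym.
have -> : segs [:: (pos k.+1, pos k.+1 + hv R d), (pos k.+1, pos k.+1 + hv R e) & rest]
    = segs [:: (pos k.+1 + hv R d, pos k.+1), (pos k.+1, pos k.+1 + hv R e) & rest].
  by rewrite !segs_cons /= [segment (pos k.+1 + _) _]segmentC.
apply: delta_move.
  move=> x y h; have := congr1 (@xc R) h; have := congr1 (@yc R) h.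
  by rewrite eE; case: (diagP dd) => ->; rewrite /hv !coordE /= => h1 h2; split; lra.
move=> x xr q xq tq.
have [i ik xi] := rok x xr.
have tq' : triangle (pos k.+1) (pos k.+1 + hv R d) (pos k.+1 + hv R (corner d)) q.
  case: tq => x0 [y [z [x00 y0 z0 xyz ->]]]; exists z, x0, y; split=> //; first by lra.
  by rewrite eE addrC addrA.
have [D [Dt Dk -> qx]] := rest_off_triangle ik xi dd xq tq'.
by split=> //; case: Dt => ->; [left|right; rewrite eE].
Qed.

Lemma local_move k (rest : seq (V * V)) : rest_ok k rest ->
  ambient_isotopic (segs (star_at k ++ rest)) (segs (star'_at k ++ rest)).
Proof.
move=> rok; have [ct|nct] := boolP (cutd (- step k) (step k.+1)).
  exact: cut_move.
rewrite /star_at /star /star'_at /star' (negbTE nct) -catA.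
have nct' : ~~ cutd (step k.+1) (- step k) by move: nct; rewrite /cutd orbC.
apply: ambient_isotopic_trans.
  apply: (half_move (s := [:: (pos k.+1, pos k.+1 + hv R (step k.+1))])
    (or_introl (conj erefl erefl)) nct rok).
  by left.
have swap (s s' : seq (V * V)) : segs (s ++ s' ++ rest) = segs (s' ++ s ++ rest).
  by rewrite !segs_cat setUCA.
rewrite swap [X in ambient_isotopic _ X]swap.
apply: (half_move (s := bent (pos k.+1) (- step k)) (or_intror (conj erefl erefl)) nct' rok).
by right.
Qed.

Lemma stars_isotopic :
  ambient_isotopic (segs (flatten [seq star_at i | i <- iota 0 n]))
                   (segs (flatten [seq star'_at i | i <- iota 0 n])).
Proof.
have swap (s s' s'' : seq (V * V)) : segs (s ++ s' ++ s'') = segs (s' ++ s ++ s'').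
  by rewrite !segs_cat setUCA.
have main s1 s2 : uniq (s1 ++ s2) -> {subset s1 ++ s2 <= gtn n} ->
    ambient_isotopic (segs (flatten [seq star'_at i | i <- s1] ++ flatten [seq star_at i | i <- s2]))
                     (segs (flatten [seq star'_at i | i <- s1 ++ s2])).
  elim: s2 s1 => [|k s2 IH] s1 us sub.
    by rewrite cats0 cats0; exact: ambient_isotopic_refl.
  apply: ambient_isotopic_trans (_ : ambient_isotopic _ (segs (star'_at k ++
    (flatten [seq star'_at i | i <- s1] ++ flatten [seq star_at i | i <- s2])))) _.
    have -> : flatten [seq star_at i | i <- k :: s2] =
      star_at k ++ flatten [seq star_at i | i <- s2] by [].
    rewrite swap; apply: local_move => x.
    have nk i : i \in s1 ++ s2 -> i <> k %[mod n].
      move=> is12; have ik : i != k.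
        apply/eqP => ik; move: us; rewrite cat_uniq /= -ik negb_or.
        move: is12; rewrite mem_cat => /orP[->|is2]; first by rewrite andbF.
        by rewrite is2 !andbF.
      rewrite !modn_small; first by move/eqP: ik.
        by apply: sub; rewrite mem_cat inE eqxx !orbT.
      by apply: sub; move: is12; rewrite !mem_cat inE => /orP[] ->; rewrite ?orbT.
    rewrite mem_cat => /orP[] /flattenP[_ /mapP[i ins ->]] xin; exists i;
      rewrite ?mem_cat ?xin ?orbT //; apply: nk; by rewrite mem_cat ins ?orbT.
  have := IH (rcons s1 k); rewrite cat_rcons => /(_ us sub).
  by rewrite map_rcons flatten_rcons -catA swap.
by apply: (main [::] (iota 0 n)); [exact: iota_uniq|move=> i; rewrite mem_iota].
Qed.

Lemma segs_periodic (f : nat -> seq (V * V)) :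
  (forall i j, i = j %[mod n] -> f i = f j) ->
  segs (flatten [seq f i | i <- iota 0 n]) = [set q | exists i, segs (f i) q].
Proof.
move=> per; apply/seteqP; split=> q.
  by move=> [x [/flattenP[_ /mapP[i _ ->] xi] xq]]; exists i, x.
move=> [i [x [xi xq]]]; exists x; split=> //; apply/flattenP.
exists (f (i %% n)%N); last by rewrite (per _ i) // modn_mod.
by apply: map_f; rewrite mem_iota add0n ltn_mod (n_gt0 poly).
Qed.

(** Regrouping half edges by vertices instead of steps. *)
Lemma union_shift (P Q : nat -> set V) : (forall i j, i = j %[mod n] -> Q i = Q j) ->
  [set q | exists i, (P i `|` Q i.+1) q] = [set q | exists i, (Q i `|` P i) q].
Proof.
move=> per; apply/seteqP; split=> q [i [h|h]].
- by exists i; right.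
- by exists i.+1; left.
- exists (i + n).-1; right; rewrite prednK ?addn_gt0 ?(n_gt0 poly) ?orbT //.
  by rewrite (per _ i) // modnDr.
- by exists i; left.
Qed.

Lemma edge_mid i : pos i.+1 + hv R (- step i) = pos i + hv R (step i).
Proof. by rewrite posS hvN addrK. Qed.

Lemma edge_halves i : segment (pos i) (pos i.+1) =
  segment (pos i) (pos i + hv R (step i)) `|` segment (pos i.+1 + hv R (- step i)) (pos i.+1).
Proof.
rewrite edge_mid (@segment_split _ _ _ (1 / 2)); last by apply/andP; split; lra.
have -> : (1 - 1 / 2) *: pos i + (1 / 2) *: pos i.+1 = pos i + hv R (step i).
  by rewrite posS; apply: vecP; rewrite !(xcD, ycD, zcD, xcZ, ycZ, zcZ); field.
by [].
Qed.

Lemma trace_dbl :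
  trace [seq cub R (dbl v) | v <- l] = segs (flatten [seq star_at i | i <- iota 0 n]).
Proof.
rewrite (segs_periodic star_at_mod) trace_segs edges_map.
have -> : segs [seq (cub R (dbl e.1), cub R (dbl e.2)) | e <- edges l] =
    [set q | exists i, (segment (pos i.+1) (pos i.+1 + hv R (step i.+1)) `|`
       segment (pos i.+2) (pos i.+2 + hv R (- step i.+1))) q].
  have e : (edges l) =i rot 1 (edges l) by move=> x; rewrite mem_rot.
  have e' : [seq (cub R (dbl e.1), cub R (dbl e.2)) | e <- edges l] =i
      [seq (cub R (dbl e.1), cub R (dbl e.2)) | e <- rot 1 (edges l)].
    exact: eq_mem_map.
  rewrite (eq_segs e') (rot_edges_vtx poly) -map_comp.
  transitivity (segs (flatten [seq [:: (pos i.+1, pos i.+2)] | i <- iota 0 n])).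
    by congr segs; elim: (iota 0 n) => //= i s ->.
  rewrite segs_periodic; last first.
    by move=> i j ij; rewrite (pos_mod (modS ij)) (pos_mod (modS (modS ij))).
  suff E i : segs [:: (pos i.+1, pos i.+2)] =
      segment (pos i.+1) (pos i.+1 + hv R (step i.+1)) `|`
      segment (pos i.+2) (pos i.+2 + hv R (- step i.+1)).
    by apply/seteqP; split=> q [i h]; exists i; [rewrite -E|rewrite E].
  rewrite segs_cons segs_nil setU0 /= edge_halves.
  by rewrite [segment _ (pos i.+2)]segmentC.
rewrite (@union_shift (fun i => segment (pos i.+1) (pos i.+1 + hv R (step i.+1)))
  (fun j => segment (pos j.+1) (pos j.+1 + hv R (- step j)))).
  suff E i : segs (star_at i) = segment (pos i.+1) (pos i.+1 + hv R (- step i)) `|`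
      segment (pos i.+1) (pos i.+1 + hv R (step i.+1)).
    by apply/seteqP; split=> q [i h]; exists i; [rewrite E|rewrite -E].
  by rewrite /star_at /star !segs_cons segs_nil setU0.
by move=> i j ij; rewrite (pos_mod (modS ij)) (step_mod ij).
Qed.

(** Between two midpoints a staircase follows a star; between the doubled ends
    of one step it follows parts of two stars, those at its two ends. *)
Lemma path_segs (a d e : pt) (c c' : bool) : (c -> hor d) -> (c' -> hor d /\ hor e) ->
  let w := cub R a in let w2 := w + hv R d + hv R d in
  segs [seq (cub R x.1, cub R x.2) |
    x <- link [seq a + o | o <- offs c c' d] (a + dbl d + (if c' then e else 0))] =
  (if c then set0 else segs (bent w d)) `|`
  (if c' then segment (w2 + hv R (- d)) (w2 + hv R e) else segs (bent w2 (- d))).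
Proof.
move=> cd cd' w w2.
have a0 : cub R (a + 0) = w by rewrite addr0.
have a2 : cub R (a + dbl d) = w2 by rewrite cubD cub_dbl addrA.
have mid : w2 + hv R (- d) = w + hv R d by rewrite hvN /w2 addrK.
have dN : diag (- d) = diag d.
  by apply/idP/idP => [h|]; [rewrite -[d]opprK|]; exact: diagN.
have [hd0|vd] := boolP (hor d); last first.
  have c0 : c = false by apply/negP => /cd; rewrite (negbTE vd).
  have c'0 : c' = false by apply/negP => /cd'[]; rewrite (negbTE vd).
  have nd : diag d = false by apply/negP => /diag_hor; rewrite (negbTE vd).
  rewrite c0 c'0 /offs (negbTE vd) nd /bent dN nd /= !segs_cons segs_nil !setU0 /=.
  rewrite a0 addr0 a2 mid (@segment_split _ w w2 (1 / 2)); last by apply/andP; split; lra.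
  rewrite [segment w2 _]segmentC; congr (segment _ _ `|` segment _ _);
    by rewrite /w2; apply: vecP; rewrite !(xcD, ycD, zcD, xcZ, ycZ, zcZ); field.
have ad : cub R (a + d) = w + hv R d by rewrite cubD hv_hor.
have ac : cub R (a + corner d) = w + hv R (corner d).
  by rewrite cubD [hv _ _]hv_hor // /hor corner_height.
have add : cub R (a + (d + d + corner (- d))) = w2 + hv R (corner (- d)).
  by rewrite !cubD !hv_hor ?/hor ?corner_height // /w2 !hv_hor // !addrA.
have ae : c' -> cub R (a + dbl d + e) = w2 + hv R e.
  by move=> /cd'[_ he]; rewrite cubD a2 (hv_hor _ he).
rewrite /offs /bent hd0 dN.
case: (boolP c) => c1; case: (boolP (diag d)) => dd; case: (boolP c') => c1';
  rewrite /= !segs_cons ?segs_nil ?setU0 ?set0U /= ?a0 ?addr0 ?a2 ?ad ?ac ?add ?(ae c1') ?mid.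
all: rewrite ?[segment w2 _]segmentC ?[segment (w2 + _) (w + _)]segmentC -?setUA //.
all: by rewrite [segment (w + hv R d) _ `|` segment _ w2]setUC.
Qed.

Lemma cut_hor i : cut_at l i -> hor (step i) /\ hor (step i.+1).
Proof. by case/cutd_hor; rewrite /hor /= oppr_eq0. Qed.

Lemma trace_stair :
  trace [seq cub R v | v <- stair l] = segs (flatten [seq star'_at i | i <- iota 0 n]).
Proof.
pose pts i : seq (V * V) := [seq (cub R x.1, cub R x.2) | x <- link (blk l i) (hd l i.+1)].
have pts_mod i j : i = j %[mod n] -> pts i = pts j.
  move=> ij; have ij1 := modS ij; have ij2 := modS ij1.
  by rewrite /pts /blk /hd (cut_mod ij) (cut_mod ij1) (step_mod ij1) (step_mod ij2)
    (vtx_mod ij1) (vtx_mod ij2).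
have -> : trace [seq cub R v | v <- stair l] = segs (flatten [seq pts i | i <- iota 0 n]).
  by rewrite trace_segs edges_map (edges_stair poly) map_flatten -map_comp.
rewrite (segs_periodic pts_mod) (segs_periodic star'_at_mod).
pose P i := if cut_at l i then set0 else segs (bent (pos i.+1) (step i.+1)).
pose Q i := if cut_at l i then segment (pos i.+1 + hv R (- step i)) (pos i.+1 + hv R (step i.+1))
  else segs (bent (pos i.+1) (- step i)).
have ptsE i : segs (pts i) = P i `|` Q i.+1.
  rewrite /pts /blk /hd [vtx i.+2]vtxS dblD -addrA addrA path_segs; last first.
  - exact: cut_hor.
  - by move=> /cut_hor[].
  by rewrite -/(pos i.+1) -posS.
have starE i : segs (star'_at i) = Q i `|` P i.
  rewrite /star'_at /star' /P /Q /cut_at; case: ifP => _.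
    by rewrite segs_cons segs_nil.
  by rewrite segs_cat.
transitivity [set q | exists i, (P i `|` Q i.+1) q].
  by apply/seteqP; split=> q [i h]; exists i; [rewrite -ptsE|rewrite ptsE].
rewrite union_shift; last first.
  by move=> i j ij; rewrite /Q (cut_mod ij) (step_mod ij) (step_mod (modS ij)) (pos_mod (modS ij)).
by apply/seteqP; split=> q [i h]; exists i; [rewrite starE|rewrite -starE].
Qed.

Theorem stair_isotopic :
  ambient_isotopic (trace [seq cub R (dbl v) | v <- l]) (trace [seq cub R v | v <- stair l]).
Proof. by rewrite trace_dbl trace_stair; exact: stars_isotopic. Qed.

End StairIsotopy.

(** * Linear changes of coordinates *)

Section Linear.
Variable R : realType.
Notation V := 'rV[R]_3.
Implicit Types (l : seq pt).

Lemma trace_shear (p : seq V) u w d : -1 < dot w u ->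
  ambient_isotopic (trace p) (trace [seq shear u w d q | q <- p]).
Proof. by move=> wu; rewrite !trace_segs edges_map; exact: shear_segs. Qed.

Definition dbl_cub v := cub R (dbl v).

(** The linear map that takes the basis of the sh-lattice to the doubled basis of
    the cubic one is a product of three shears. *)
Lemma trace_sh_dbl l :
  ambient_isotopic (trace [seq shv R v | v <- l]) (trace [seq dbl_cub v | v <- l]).
Proof.
have s3 : Num.sqrt 3 != 0 :> R by rewrite gt_eqF ?sqrtr_gt0.
have s3p : 0 < (Num.sqrt 3)^-1 :> R by rewrite invr_gt0 sqrtr_gt0.
apply: ambient_isotopic_trans.
  apply: (@trace_shear _ (vec3 1 0 0) (vec3 0 (- (Num.sqrt 3)^-1) 0) 0).
  by rewrite dotv3 !coordE; lra.
apply: ambient_isotopic_trans.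
  apply: (@trace_shear _ (vec3 1 0 0) (vec3 1 0 0) 0).
  by rewrite dotv3 !coordE; lra.
rewrite (_ : [seq dbl_cub v | v <- l] =
  [seq shear (vec3 0 1 0) (vec3 0 (4 / Num.sqrt 3 - 1) 0) 0 q | q <-
  [seq shear (vec3 1 0 0) (vec3 1 0 0) 0 q | q <-
  [seq shear (vec3 1 0 0) (vec3 0 (- (Num.sqrt 3)^-1) 0) 0 q | q <- [seq shv R v | v <- l]]]]).
  by apply: trace_shear; rewrite dotv3 !coordE; lra.
rewrite -!map_comp; apply: eq_map => -[[a b] c] /=.
by apply: vecP; rewrite /shear /dbl_cub /cub /shv ?dotv3 ?coordE /= ?dotv3 ?coordE /= ?intrD; field.
Qed.

(** The rotation by 60 degrees of the sh-lattice. *)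
Definition rho (v : pt) : pt := (- v.1.2, v.1.1 + v.1.2, v.2).

Lemma trace_rho l :
  ambient_isotopic (trace [seq dbl_cub v | v <- l])
                   (trace [seq dbl_cub v | v <- [seq rho v | v <- l]]).
Proof.
apply: ambient_isotopic_trans.
  apply: (@trace_shear _ (vec3 0 1 0) (vec3 1 0 0) 0).
  by rewrite dotv3 !coordE; lra.
rewrite (_ : [seq dbl_cub v | v <- [seq rho v | v <- l]] =
  [seq shear (vec3 1 0 0) (vec3 0 (-1) 0) 0 q | q <-
  [seq shear (vec3 0 1 0) (vec3 1 0 0) 0 q | q <- [seq dbl_cub v | v <- l]]]).
  by apply: trace_shear; rewrite dotv3 !coordE; lra.
rewrite -!map_comp; apply: eq_map => -[[a b] c] /=.
by apply: vecP; rewrite /shear /dbl_cub /cub ?dotv3 ?coordE /= ?dotv3 ?coordE /= ?(intrD, intrN); ring.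
Qed.

Lemma rhoB v w : rho (v - w) = rho v - rho w.
Proof. by rewrite /rho; congr (_, _, _); rewrite /= ?opprD // addrACA. Qed.

Lemma rho_inj : injective rho.
Proof.
by move=> [[a b] c] [[a' b'] c']; rewrite /rho => -[/= /oppr_inj -> /addIr -> ->].
Qed.

Lemma rho_dirs d : (rho d \in all_dirs) = (d \in all_dirs).
Proof.
apply/idP/idP; last by rewrite !inE; do ?case/orP; move=> /eqP ->.
move=> h; have -> : d = rho (rho (rho (rho (rho (rho d))))).
  case: d {h} => -[a b] c; rewrite /rho /=.
  by congr (_, _, _); [ring|ring].
by move: (rho d) h => e; rewrite !inE; do ?case/orP; move=> /eqP ->.
Qed.

Lemma polygon_rho l : polygon sh_dirs l -> polygon sh_dirs [seq rho v | v <- l].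
Proof.
move=> [ul sl al ar]; split.
- by rewrite map_inj_uniq //; exact: rho_inj.
- by rewrite size_map.
- move: al; rewrite !cycle_edges edges_map all_map; congr is_true.
  by apply: eq_all => e /=; rewrite !adj_sh -rhoB rho_dirs.
- by rewrite -map_comp.
Qed.

Definition count_steps (P : pred pt) l := count (fun e : pt * pt => P (e.2 - e.1)) (edges l).

Definition vertical d := ~~ hor d.
Definition xdir (d : pt) := d \in [:: (1, 0, 0); (-1, 0, 0) : pt].
Definition ydir (d : pt) := d \in [:: (0, 1, 0); (0, -1, 0) : pt].

Lemma edge_dir l e : polygon sh_dirs l -> e \in edges l -> e.2 - e.1 \in all_dirs.
Proof.
move=> /polygon_adj; rewrite cycle_edges => /allP al el; rewrite -adj_sh.
exact: al.
Qed.

Lemma count_steps_rho (P Q : pred pt) l : polygon sh_dirs l ->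
  {in all_dirs, forall d, P (rho d) = Q d} ->
  count_steps P [seq rho v | v <- l] = count_steps Q l.
Proof.
move=> pl PQ; rewrite /count_steps edges_map count_map; apply: eq_in_count => e el /=.
by rewrite -rhoB PQ //; exact: edge_dir el.
Qed.

Lemma count_steps_size l : polygon sh_dirs l ->
  (count_steps vertical l + count_steps xdir l + count_steps ydir l + count_steps diag l
   = size l)%N.
Proof.
move=> pl; rewrite -size_edges /count_steps.
have : {in edges l, forall e, e.2 - e.1 \in all_dirs} by move=> e; exact: edge_dir.
elim: (edges l) => //= e s IH dirs.
have := dirs e (mem_head _ _).
have <- := IH (fun x xs => dirs x (mem_behead (s := e :: s) xs)).
move: (e.2 - e.1) => d dD.
have one : (vertical d + xdir d + ydir d + diag d = 1)%N.
  by move: dD; rewrite !inE; do ?case/orP; move=> /eqP ->.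
by clear -one; lia.
Qed.

Lemma sum_weight l : polygon sh_dirs l ->
  (\sum_(e <- edges l) weight (e.2 - e.1)%R =
   count_steps vertical l + 4 * count_steps diag l
   + 2 * (count_steps xdir l + count_steps ydir l))%N.
Proof.
move=> pl; rewrite /count_steps.
have : {in edges l, forall e, e.2 - e.1 \in all_dirs} by move=> e; exact: edge_dir.
elim: (edges l) => [|e s IH] dirs /=; first by rewrite big_nil.
have := dirs e (mem_head _ _).
rewrite big_cons IH; last by move=> x xs; apply: dirs; rewrite inE xs orbT.
move: (e.2 - e.1) => d dD.
have -> : (weight d = vertical d + 4 * diag d + 2 * (xdir d + ydir d))%N.
  by move: dD; rewrite !inE; do ?case/orP; move=> /eqP ->.
by lia.
Qed.

(** One of the three horizontal directions has at most a third of the horizontal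
    steps, and a rotation makes it the diagonal one. *)
Lemma few_diagonals l : polygon sh_dirs l -> exists l',
  [/\ polygon sh_dirs l', size l' = size l,
      count_steps vertical l' = count_steps vertical l,
      (count_steps vertical l' + 3 * count_steps diag l' <= size l')%N
    & ambient_isotopic (trace [seq dbl_cub v | v <- l]) (trace [seq dbl_cub v | v <- l'])].
Proof.
move=> pl; have pl1 := polygon_rho pl; have pl2 := polygon_rho pl1.
have rot P Q := @count_steps_rho P Q l pl.
have rot1 P Q := @count_steps_rho P Q _ pl1.
have rV : {in all_dirs, forall d, vertical (rho d) = vertical d} by [].
have rZ : {in all_dirs, forall d, diag (rho d) = ydir d}.
  by move=> d; rewrite !inE; do ?case/orP; move=> /eqP ->.
have rY : {in all_dirs, forall d, ydir (rho d) = xdir d}.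
  by move=> d; rewrite !inE; do ?case/orP; move=> /eqP ->.
have := count_steps_size pl.
have [h|h] := leqP (count_steps vertical l + 3 * count_steps diag l) (size l).
  by exists l; split=> //; exact: ambient_isotopic_refl.
have [h1|h1] := leqP (count_steps vertical l + 3 * count_steps ydir l) (size l).
  move=> _; exists [seq rho v | v <- l].
  rewrite size_map (rot _ _ rV) (rot _ _ rZ); split=> //; exact: trace_rho.
move=> e; exists [seq rho v | v <- [seq rho v | v <- l]].
rewrite !size_map (rot1 _ _ rV) (rot _ _ rV) (rot1 _ _ rZ) (rot _ _ rY); split=> //.
  by lia.
by apply: ambient_isotopic_trans (trace_rho _) (trace_rho _).
Qed.

End Linear.

(** * Polygons that go up only once *)

Section Fan.
Variables (R : realType).
Notation V := 'rV[R]_3.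
Variables (v : nat -> V) (N : nat).

(** The vertical line of the last edge, which returns from [v N] to [v 0]. Because
    the path climbs and avoids this line, the triangles between its edges and a
    point of the line above the top form an embedded fan. *)
Definition on_axis (q : V) := xc q = xc (v 0) /\ yc q = yc (v 0).

Hypothesis N2 : (1 < N)%N.
Hypothesis climb : forall i, (i < N)%N -> zc (v i) <= zc (v i.+1).
Hypothesis base : zc (v 1) = zc (v 0).
Hypothesis top_axis : on_axis (v N).
Hypothesis top_high : zc (v 0) < zc (v N).
Hypothesis hor_or_ver : forall i, (i < N)%N -> zc (v i) = zc (v i.+1) \/
  (xc (v i) = xc (v i.+1) /\ yc (v i) = yc (v i.+1)).
Hypothesis distinct : forall i, (i < N)%N -> v i != v i.+1.
Hypothesis simple : forall i j q, (i < j < N)%N -> segment (v i) (v i.+1) q ->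
  segment (v j) (v j.+1) q -> i.+1 = j /\ q = v j.
Hypothesis off_axis : forall i, (0 < i < N)%N -> ~ on_axis (v i).
Hypothesis off_axis_edge : forall i q, (0 < i)%N -> (i.+1 < N)%N ->
  segment (v i) (v i.+1) q -> ~ on_axis q.

Definition apex : V := v N + vec3 0 0 1.

Definition path_to k : seq (V * V) := [seq (v i, v i.+1) | i <- iota 0 k].

Lemma path_toS k : segs (path_to k.+1) = segs (path_to k) `|` segment (v k) (v k.+1).
Proof.
have e : iota 0 k.+1 = iota 0 k ++ [:: k] by rewrite -addn1 iotaD.
by rewrite /path_to e map_cat segs_cat /= segs_cons segs_nil setU0.
Qed.

Lemma climb_le i j : (i <= j <= N)%N -> zc (v i) <= zc (v j).
Proof.
elim: j => [|j IH]; first by rewrite leqn0 => /andP[/eqP ->].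
rewrite leq_eqVlt => /andP[/orP[/eqP -> //|ij] jN].
by apply: le_trans (climb jN); apply: IH; rewrite -ltnS ij ltnW.
Qed.

Lemma zc_segment (a b : V) q : zc a <= zc b -> segment a b q -> zc a <= zc q <= zc b.
Proof.
move=> ab [s [s01 ->]]; have /andP[s0 s1] := s01.
by rewrite !(zcD, zcZ); apply/andP; split; nra.
Qed.

Lemma path_to_height k x q : (k <= N)%N -> x \in path_to k -> segment x.1 x.2 q ->
  exists2 i, (i < k)%N & [/\ x = (v i, v i.+1) & zc q <= zc (v k)].
Proof.
move=> kN /mapP[i]; rewrite mem_iota add0n => /andP[_ ik] -> /= xq; exists i => //; split=> //.
have /andP[_ h] := zc_segment (climb (leq_trans ik kN)) xq.
by apply: le_trans h _; apply: climb_le; rewrite ik kN.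
Qed.

Lemma apexE : segment apex (v 0) = segment apex (v N) `|` segment (v N) (v 0).
Proof.
have th := top_high.
pose k := (1 + (zc (v N) - zc (v 0)))^-1.
have kE : k * (1 + (zc (v N) - zc (v 0))) = 1 by rewrite mulVf // gt_eqF //; lra.
have k01 : 0 <= k <= 1.
  have k0 : 0 <= k by rewrite invr_ge0; lra.
  by apply/andP; split => //; nra.
rewrite (segment_split _ _ k01).
have <- : v N = (1 - k) *: apex + k *: v 0.
  by case: top_axis => ax ay; apply: vecP; rewrite /apex !coordE ?ax ?ay; nra.
by [].
Qed.

(** The apex can be inserted into the last edge because everything else stays
    below it. *)
Lemma insert_apex : ambient_isotopic
  (segs (path_to N ++ [:: (v N, v 0)]))
  (segs (path_to N.-1 ++ [:: (v N.-1, apex); (apex, v 0)])).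
Proof.
have [M NE'] : exists M, N == M.+1 by exists N.-1; rewrite prednK // ltnW.
have NE := eqP NE'.
have M0 : (0 < M)%N by rewrite -ltnS -NE.
have MN : (M < N)%N by rewrite NE.
have offM : ~ on_axis (v M) by apply: off_axis; rewrite M0.
have hM := climb MN; rewrite -NE in hM.
rewrite [N.-1](_ : _ = M); last by rewrite NE.
have th := top_high.
rewrite (_ : segs (path_to N ++ _) = segs ((v M, v N) :: (path_to M ++ [:: (v N, v 0)]))); last first.
  by rewrite !(segs_cons, segs_cat) NE path_toS segs_nil setU0 [segs _ `|` segment _ _]setUC -setUA.
clear NE.
rewrite (_ : segs (path_to M ++ _) = segs [:: (v M, apex), (apex, v N) & path_to M ++ [:: (v N, v 0)]]); last first.
  rewrite segs_cat !segs_cons segs_cat !segs_cons segs_nil !setU0 /= apexE.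
  by rewrite setUCA; congr setU; rewrite setUCA.
have D0 (x : R) : x * (xc (v M) - xc (v 0)) = 0 -> x * (yc (v M) - yc (v 0)) = 0 -> x = 0.
  move=> h1 h2; apply/eqP/negP => /negP x0; apply: offM.
  by split; apply/eqP; rewrite -subr_eq0; [move/eqP: h1|move/eqP: h2];
    rewrite mulf_eq0 (negbTE x0).
case: (top_axis) => axN ayN.
apply: delta_move.
  move=> x y e; have ex := congr1 (@xc R) e; have ey := congr1 (@yc R) e.
  have ez := congr1 (@zc R) e; rewrite /apex !coordE axN ayN in ex ey ez.
  have xy : x + y = 0 by apply: D0; nra.
  have xE : x = - y by lra.
  by rewrite xE in ez *; split; nra.
move=> x; rewrite mem_cat => xin q xq [x' [y [z [x0 y0 z0 xyz qE]]]].
have zq := congr1 (@zc R) qE; rewrite /apex !coordE in zq.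
move: xin => /orP[xin|].
  have [i iM [xE hq]] := path_to_height (ltnW MN) xin xq.
  have z00 : z = 0 by nra.
  have qs : segment (v M) (v N) q.
    by exists y; split; [apply/andP; split; lra|rewrite qE z00 scale0r addr0; congr (_ *: _ + _); lra].
  rewrite xE in xq *; rewrite (eqP NE') in qs.
  have [|ij ->] := simple _ xq qs; first by rewrite iM MN.
  by rewrite -ij /=; split; [left|right].
rewrite inE => /eqP xE; rewrite xE /= in xq *.
have qax : xc q = xc (v 0) /\ yc q = yc (v 0).
  by case: xq => s [_ ->]; rewrite !coordE axN ayN; split; ring.
have x'0 : x' = 0.
  case: qax; rewrite qE /apex !coordE axN ayN => qx qy.
  by apply: D0; nra.
have /andP[_ hq] : zc (v 0) <= zc q <= zc (v N).
  by apply: zc_segment; [exact: ltW|rewrite segmentC].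
have z00 : z = 0 by nra.
have -> : q = v N.
  by rewrite qE x'0 z00 !scale0r add0r addr0 (_ : y = 1) ?scale1r //; lra.
by split; [right|left].
Qed.

(** Afterwards the path is contracted towards the apex, one vertex at a time. *)
Lemma contract_apex k : (0 < k)%N -> (k.+1 < N)%N -> ambient_isotopic
  (segs (path_to k.+1 ++ [:: (v k.+1, apex); (apex, v 0)]))
  (segs (path_to k ++ [:: (v k, apex); (apex, v 0)])).
Proof.
move=> k0 kN; have kN' := ltnW kN; apply: ambient_isotopic_sym.
rewrite (_ : segs (path_to k ++ _) = segs ((v k, apex) :: (path_to k ++ [:: (apex, v 0)]))); last first.
  by rewrite segs_cat !segs_cons segs_cat !segs_cons segs_nil !setU0 setUCA.
rewrite (_ : segs (path_to k.+1 ++ _) =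
    segs [:: (v k, v k.+1), (v k.+1, apex) & path_to k ++ [:: (apex, v 0)]]); last first.
  rewrite segs_cat path_toS !segs_cons segs_cat !segs_cons segs_nil !setU0 /=.
  by rewrite -setUA setUCA; congr setU; rewrite setUCA.
have ha : zc apex = zc (v N) + 1 by rewrite /apex !coordE.
have hk : zc (v k) <= zc (v k.+1) by exact: climb.
have hkN : zc (v k.+1) <= zc (v N) by apply: climb_le; rewrite leqnn ltnW.
have axa : xc apex = xc (v 0) /\ yc apex = yc (v 0).
  by case: top_axis => ax ay; rewrite /apex !coordE ax ay; split; ring.
move: apex ha axa => A ha [axx axy].
have offk : ~ on_axis (v k) by apply: off_axis; rewrite k0.
apply: delta_move.
  move=> x y e; have ex := congr1 (@xc R) e; have ey := congr1 (@yc R) e.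
  have ez := congr1 (@zc R) e; rewrite !(xcD, ycD, zcD, xcN, ycN, zcN, xcZ, ycZ, zcZ) ?(xc0, yc0, zc0) in ex ey ez.
  rewrite ha in ez; rewrite axx in ex; rewrite axy in ey.
  have x0 : x = 0.
    case: (hor_or_ver kN') => [h|[h1 h2]].
      by rewrite h in ez hk; nra.
    rewrite h1 h2 in ex ey; apply/eqP/negP => /negP x0; apply: offk.
    rewrite /on_axis h1 h2; split; apply/eqP; rewrite eq_sym -subr_eq0.
      by move: ex => /eqP; rewrite subrr mulr0 addr0 mulf_eq0 (negbTE x0).
    by move: ey => /eqP; rewrite subrr mulr0 addr0 mulf_eq0 (negbTE x0).
  split=> //; move: e; rewrite x0 scale0r add0r => /eqP; rewrite scaler_eq0 subr_eq0.
  by rewrite [v k.+1 == _]eq_sym (negbTE (distinct kN')) orbF => /eqP.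
move=> x; rewrite mem_cat => xin q xq [x' [y [z [x0 y0 z0 xyz qE]]]].
have zq := congr1 (@zc R) qE; rewrite !(zcD, zcZ) ha in zq.
move: xin => /orP[xin|].
  have [i ik [xE hq]] := path_to_height (ltnW kN') xin xq.
  have y00 : y = 0 by nra.
  have qs : segment (v k) (v k.+1) q.
    by exists z; split; [apply/andP; split; lra|rewrite qE y00 scale0r addr0; congr (_ *: _ + _); lra].
  rewrite xE in xq *.
  have [|ij ->] := simple _ xq qs; first by rewrite ik.
  by rewrite -ij /=; split; [left|right].
rewrite inE => /eqP xE; rewrite xE /= in xq *.
have qax : xc q = xc (v 0) /\ yc q = yc (v 0).
  by case: xq => s [_ ->]; rewrite !(xcD, ycD, xcZ, ycZ) axx axy; split; ring.
have [xz|xz] := eqVneq (x' + z) 0.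
  have [x'0 z00] : x' = 0 /\ z = 0 by split; lra.
  have -> : q = A.
    by rewrite qE x'0 z00 !scale0r add0r addr0 (_ : y = 1) ?scale1r //; lra.
  by split; [right|left].
exfalso; have xzp : 0 < x' + z by rewrite lt_neqAle eq_sym xz /=; lra.
pose s := z / (x' + z).
have sE : s * (x' + z) = z by rewrite /s mulfVK.
apply: (@off_axis_edge k ((1 - s) *: v k + s *: v k.+1)) => //.
  exists s; split=> //; apply/andP; split; first by rewrite /s divr_ge0 // ltW.
  by rewrite /s ler_pdivrMr // mul1r; lra.
case: qax; rewrite qE !(xcD, ycD, xcZ, ycZ) axx axy => qx qy.
rewrite /on_axis !(xcD, ycD, xcZ, ycZ).
have xE' : (1 - s) * (x' + z) = x' by rewrite mulrBl mul1r sE; ring.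
split; apply: (mulfI xz).
- transitivity (((1 - s) * (x' + z)) * xc (v k) + (s * (x' + z)) * xc (v k.+1)); first by ring.
  rewrite xE' sE; nra.
- transitivity (((1 - s) * (x' + z)) * yc (v k) + (s * (x' + z)) * yc (v k.+1)); first by ring.
  rewrite xE' sE; nra.
Qed.

Lemma fan_trivial : trivial_knot (segs (path_to N ++ [:: (v N, v 0)])).
Proof.
have th := top_high.
apply: ambient_isotopic_trans insert_apex _.
have main k : (0 < k < N)%N ->
    trivial_knot (segs (path_to k ++ [:: (v k, apex); (apex, v 0)])).
  elim: k => // -[_ _|k IH /andP[_ kN]]; last first.
    apply: ambient_isotopic_trans (contract_apex (ltn0Sn k) kN) _.
    by apply: IH; rewrite ltn0Sn ltnW.
  have off1 : ~ on_axis (v 1) by apply: off_axis; rewrite N2.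
  case: top_axis => axN ayN.
  apply: vertical_triangle_trivial; rewrite /apex ?coordE ?axN ?ayN ?addr0 //.
    by rewrite gt_eqF //; lra.
  apply/negP => /negP; rewrite negb_or !negbK => /andP[/eqP h1 /eqP h2].
  exact: off1.
apply: main; apply/andP; split; last by rewrite prednK // ltnW.
by rewrite -ltnS prednK // ltnW.
Qed.
End Fan.

Section Loops.
Variable R : realType.
Notation V := 'rV[R]_3.

(** Unlike [simple_closed], this form does not depend on the starting vertex
    and the direction of the path. *)
Definition embedded (p : seq V) := forall e f, e \in edges p -> f \in edges p -> e <> f ->
  forall q, segment e.1 e.2 q -> segment f.1 f.2 q ->
  (q = e.1 \/ q = e.2) /\ (q = f.1 \/ q = f.2).

Lemma simple_closed_embedded (p : seq V) : simple_closed p -> embedded p.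
Proof.
move=> [p0 inj] e f /(nthP (0, 0))[i]; rewrite size_edges => ip <- /(nthP (0, 0))[j].
rewrite size_edges => jp <- ne q.
have edgeE k : (k < size p)%N -> nth (0, 0) (edges p) k = (p`_k, p`_(k.+1 %% size p)).
  by move=> kp; rewrite /edges nth_zip ?size_rot // nth_rot1.
have ij : i != j by apply/eqP => ij; apply: ne; rewrite ij.
have norm k : (k < size p)%N -> segment p`_k p`_(k.+1 %% size p) q ->
    exists k' s', [/\ (k' < size p)%N, 0 <= s' < 1, q = edge_point p k' s' &
      k' = k \/ [/\ s' = 0, q = p`_(k.+1 %% size p) & q = p`_k']].
  move=> kp [s [s01 qE]]; have /andP[s0 s1] := s01.
  have [s_1|s_n] := eqVneq s 1.
    have qE' : q = p`_(k.+1 %% size p) by rewrite qE s_1 subrr scale0r scale1r add0r.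
    exists (k.+1 %% size p)%N, 0; rewrite ltn_mod p0 lexx ltr01; split=> //.
      by rewrite /edge_point subr0 scale1r scale0r addr0.
    by right.
  exists k, s; split=> //; first by rewrite s0 lt_neqAle s_n.
    by rewrite qE /edge_point /edge_src /edge_tgt nth_rot1.
  by left.
rewrite !edgeE //= => /(norm i ip)[i' [s [i'p s01 qi hi]]] /(norm j jp)[j' [t [j'p t01 qj hj]]].
have [ij' st] := inj i' j' s t i'p j'p s01 t01 (etrans (esym qi) qj).
case: hi hj => [hi|[s0 hi hi']] [hj|[t0 hj hj']].
- by move: ij; rewrite -hi -hj ij' eqxx.
- by split; [left; rewrite -hi ij'|right].
- by split; [right|left; rewrite -hj -ij'].
- by split; right.
Qed.

Lemma mem_edges_rev (T : eqType) (p : seq T) x :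
  (x \in edges (rev p)) = ((x.2, x.1) \in edges p).
Proof.
have zip_swap (s t : seq T) y : (y \in zip s t) = ((y.2, y.1) \in zip t s).
  elim: s t => [|a s IH] [|b t] //=; rewrite !inE IH; congr (_ || _).
  by case: y {IH} => y1 y2 /=; rewrite !xpair_eqE andbC.
rewrite /edges -rev_rotr; set r := rotr 1 p.
have pE : p = rot 1 r by rewrite /r rotrK.
have sr : size p = size r by rewrite pE size_rot.
by rewrite -rev_zip // mem_rev zip_swap -/(edges p) {1}pE -/(edges r) -(mem_rot 1) -edges_rot -pE.
Qed.

(** What the contraction uses about a polygon, in a form that rotation and reversal
    preserve. *)
Record loop (l : seq pt) : Prop := Loop {
  loop_uniq : uniq l;
  loop_size : (2 < size l)%N;
  loop_adj : forall e, e \in edges l -> e.2 - e.1 \in all_dirs;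
  loop_embedded : embedded [seq shv R v | v <- l] }.

Lemma loop_rot r l : loop l -> loop (rot r l).
Proof.
move=> [ul sl al el]; split.
- by rewrite rot_uniq.
- by rewrite size_rot.
- by move=> e; rewrite edges_rot mem_rot; exact: al.
- by move=> e f; rewrite map_rot edges_rot !mem_rot; exact: el.
Qed.

Lemma loop_rev l : loop l -> loop (rev l).
Proof.
move=> [ul sl al el]; split.
- by rewrite rev_uniq.
- by rewrite size_rev.
- move=> e; rewrite mem_edges_rev => /al /= h; rewrite -opprB.
  by move: h; rewrite !inE; do ?case/orP; move=> /eqP ->.
- move=> e f; rewrite map_rev !mem_edges_rev => /el h /h {}h ef q eq fq.
  have [] := h _ q; rewrite /= 1?segmentC //.
    by move=> [e2 e1]; apply: ef; case: e f e1 e2 {h eq fq} => [? ?] [? ?] /= -> ->.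
  by split; apply/or_comm.
Qed.

Lemma trace_rot r (p : seq V) : trace (rot r p) = trace p.
Proof. by rewrite !trace_segs edges_rot; apply: eq_segs => e; rewrite mem_rot. Qed.

Lemma trace_rev (p : seq V) : trace (rev p) = trace p.
Proof.
suff sub (s : seq V) : trace (rev s) `<=` trace s.
  by apply/seteqP; split; [exact: sub|rewrite -{1}(revK p); exact: sub].
rewrite !trace_segs => q [e [+ eq]]; rewrite mem_edges_rev => es.
by exists (e.2, e.1); rewrite segmentC.
Qed.

(** The projection of an edge is an edge or a vertex of the triangular lattice,
    so it passes through no other lattice point. *)
Lemma edge_off_axis (a v w : pt) q : w - v \in all_dirs ->
  v.1 <> a.1 -> w.1 <> a.1 -> segment (shv R v) (shv R w) q ->
  ~ (xc q = xc (shv R a) /\ yc q = yc (shv R a)).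
Proof.
move=> dD va wa [s [s01 ->]] [].
have -> : w = v + (w - v) by rewrite addrC subrK.
have dE : w = v + (w - v) by rewrite addrC subrK.
have /andP[s0 s1] := s01.
have wa' : (v + (w - v)).1 <> a.1 by rewrite -dE.
move: (w - v) dD wa' {dE wa} => d dD wa.
have s3 : Num.sqrt 3 / 2 != 0 :> R by rewrite mulf_neq0 ?invr_eq0 ?gt_eqF ?sqrtr_gt0.
case: v a va wa => [[v1 v2] v3] [[a1 a2] a3] /= va wa.
rewrite /shv !coordE /= => ex ey.
have ey' : v2%:~R + s * d.1.2%:~R = a2%:~R :> R.
  by apply: (mulIf s3); move: ey; rewrite intrD; lra.
have ex' : v1%:~R + s * d.1.1%:~R = a1%:~R :> R.
  by move: ex ey'; rewrite !intrD; lra.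
have near (i j : int) (t : R) : 0 <= t <= 1 -> i%:~R + t = j%:~R ->
    (t = 0 /\ i = j) \/ (t = 1 /\ i + 1 = j).
  move=> /andP[t0 t1] h.
  have h0 : 0 <= j - i by rewrite -(ler_int R) intrB; lra.
  have h1 : j - i <= 1 by rewrite -(ler_int R) intrB; lra.
  have [e|e] : j = i \/ j = i + 1 by clear -h0 h1; lia.
    by left; split=> //; move: h; rewrite e; lra.
  by right; split=> //; move: h; rewrite e intrD; lra.
have nearN (i j : int) : i%:~R - s = j%:~R -> (s = 0 /\ i = j) \/ (s = 1 /\ i - 1 = j).
  move=> h; have [|[-> ->]|[-> <-]] := near j i s s01; first by lra.
    by left.
  by right; rewrite addrK.
move: dD wa ex' ey'; rewrite !inE.
do ?case/orP; move=> /eqP -> /= wa ex' ey'; rewrite ?mulr0 ?addr0 ?mulr1 ?mulrN1 in ex' ey'.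
- by apply: va; rewrite (intr_inj ex') (intr_inj ey').
- by apply: va; rewrite (intr_inj ex') (intr_inj ey').
- have {}ey' := intr_inj ey'; case: (near _ _ _ s01 ex') => -[_ e].
    by apply: va; rewrite e ey'.
  by apply: wa; rewrite -e -ey'; congr (_, _); exact: addr0.
- have {}ey' := intr_inj ey'; case: (nearN _ _ ex') => -[_ e].
    by apply: va; rewrite e ey'.
  by apply: wa; rewrite -e -ey'; congr (_, _); exact: addr0.
- have {}ex' := intr_inj ex'; case: (near _ _ _ s01 ey') => -[_ e].
    by apply: va; rewrite e ex'.
  by apply: wa; rewrite -e -ex'; congr (_, _); exact: addr0.
- have {}ex' := intr_inj ex'; case: (nearN _ _ ey') => -[_ e].
    by apply: va; rewrite e ex'.
  by apply: wa; rewrite -e -ex'; congr (_, _); exact: addr0.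
- case: (nearN _ _ ex') (near _ _ _ s01 ey') => -[sx e] [] [sy e'].
  + by apply: va; rewrite e e'.
  + by move: sx; rewrite sy => /eqP; rewrite oner_eq0.
  + by move: sy; rewrite sx => /eqP; rewrite oner_eq0.
  + by apply: wa; rewrite -e -e'.
- case: (near _ _ _ s01 ex') (nearN _ _ ey') => -[sx e] [] [sy e'].
  + by apply: va; rewrite e e'.
  + by move: sx; rewrite sy => /eqP; rewrite oner_eq0.
  + by move: sy; rewrite sx => /eqP; rewrite oner_eq0.
  + by apply: wa; rewrite -e -e'.
Qed.

End Loops.

Section Climb.
Variables (R : realType).
Notation V := 'rV[R]_3.

Lemma edges_nth (T : Type) (x0 : T) (p : seq T) n : size p = n.+1 ->
  edges p = [seq (nth x0 p i, nth x0 p i.+1) | i <- iota 0 n] ++ [:: (nth x0 p n, nth x0 p 0)].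
Proof.
move=> pn; apply: (@eq_from_nth _ (x0, x0)).
  by rewrite size_edges size_cat size_map size_iota addn1.
move=> i; rewrite size_edges pn ltnS => ip.
rewrite /edges nth_zip ?size_rot // nth_rot1 ?pn ?ltnS // nth_cat size_map size_iota.
case: ltngtP ip => // [ip _|-> _].
  by rewrite (nth_map 0%N) ?size_iota // nth_iota // add0n modn_small.
by rewrite subnn modnn.
Qed.

Lemma shv_z v : zc (shv R v) = v.2%:~R.
Proof. by rewrite /shv !coordE; ring. Qed.

Lemma shv_xy v w : xc (shv R v) = xc (shv R w) /\ yc (shv R v) = yc (shv R w) <-> v.1 = w.1.
Proof.
case: v w => [[a b] c] [[a' b'] c']; rewrite /shv !coordE /= !mulr0 !mulr1 !addr0 !add0r.
split; last by case=> -> ->.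
have s3 : Num.sqrt 3 / 2 != 0 :> R by rewrite mulf_neq0 ?invr_eq0 ?gt_eqF ?sqrtr_gt0.
by case=> ex /(mulIf s3) /intr_inj eb; move: ex; rewrite eb => /addIr /intr_inj ->.
Qed.

Lemma dir_hor_or_ver (d : pt) : d \in all_dirs -> d.2 = 0 \/ (d.1 = 0 /\ (d.2 = 1 \/ d.2 = -1)).
Proof. by rewrite !inE; do ?case/orP; move=> /eqP -> /=; auto. Qed.

(** The way back along the axis has length one or two; in the second case its two
    edges are merged to apply [fan_trivial]. *)
Lemma climb_trivial l N : loop R l -> (1 < N)%N ->
  let v i := nth 0 l i in
  (size l = N.+1 /\ (v N).2 = (v 0%N).2 + 1) \/
  [/\ size l = N.+2, (v N).2 = (v 0%N).2 + 2 & (v N.+1).2 = (v 0%N).2 + 1] ->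
  (forall i, (i < N)%N -> (v i).2 <= (v i.+1).2) -> (v 1%N).2 = (v 0%N).2 ->
  trivial_knot (trace [seq shv R x | x <- l]).
Proof.
move=> [ul sl al el] N1 v top climb base.
have sizeN : (N < size l)%N by case: top => [[-> _]|[-> _ _]]; rewrite ltnS // leqnSn.
have vinj i j : (i < size l)%N -> (j < size l)%N -> v i = v j -> i = j.
  by move=> il jl /eqP; rewrite nth_uniq // => /eqP.
have edgeN i : (i.+1 < size l)%N -> (v i, v i.+1) \in edges l.
  move=> il; rewrite (@edges_nth _ 0 l (size l).-1); last by rewrite prednK // (ltn_trans _ il).
  rewrite mem_cat (map_f (fun i => (nth 0 l i, nth 0 l i.+1))) //.
  by rewrite mem_iota add0n /= ltn_predRL.
have ltN i : (i < N)%N -> (i.+1 < size l)%N by move=> iN; apply: leq_ltn_trans sizeN.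
have edge_v i : (i < N)%N -> v i.+1 - v i \in all_dirs.
  by move=> /ltN/edgeN/al.
have last_edge m : size l = m.+1 -> (v m, v 0%N) \in edges l.
  by move=> lm; rewrite (@edges_nth _ 0 l m) // mem_cat mem_head orbT.
have vert d : d \in all_dirs -> d.2 <> 0 -> d.1 = 0 by move=> /dir_hor_or_ver[|[]].
have vert_edge x y : (x, y) \in edges l -> x.2 <> y.2 -> y.1 = x.1.
  move=> /al /vert h xy; have : (y - x).1 = 0.
    by apply: h => /eqP; rewrite subr_eq0 => /eqP e; apply: xy.
  by move=> /eqP; rewrite subr_eq0 => /eqP.
have pt_eq (x y : pt) : x.1 = y.1 -> x.2 = y.2 -> x = y.
  by case: x y => ? ? [? ?] /= -> ->.
have v0l : (0 < size l)%N by apply: leq_ltn_trans sizeN.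
have climb_le i j : (i <= j <= N)%N -> (v i).2 <= (v j).2.
  elim: j => [|j IH]; first by rewrite leqn0 => /andP[/eqP ->].
  rewrite leq_eqVlt => /andP[/orP[/eqP -> //|ij] jN].
  by apply: le_trans (climb _ jN); apply: IH; rewrite -ltnS ij ltnW.
(* The way back from the top runs along the axis, so that the axis carries no
   other vertex. *)
have [axN axis] : (v N).1 = (v 0%N).1 /\ forall i, (0 < i < N)%N -> (v i).1 <> (v 0%N).1.
  case: top => [[ln hN]|[ln hN hs]].
    have axN : (v N).1 = (v 0%N).1.
      by apply/esym/vert_edge; [exact: last_edge|apply/eqP; rewrite hN gt_eqF // ltrDl].
    split=> // i /andP[i0 iN] vi.
    have h1 := climb_le 0%N i ltac:(by rewrite /= ltnW); have h2 := climb_le i N ltac:(by rewrite leqnn ltnW).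
    have [e|e] : (v i).2 = (v 0%N).2 \/ (v i).2 = (v N).2 by clear -h1 h2 hN; lia.
      by move: i0; rewrite (vinj i 0%N _ v0l (pt_eq _ _ vi e)) // (ltn_trans iN).
    have := vinj i N (ltn_trans iN sizeN) sizeN (pt_eq _ _ (etrans vi (esym axN)) e).
    by move: iN => /[swap] ->; rewrite ltnn.
  have sN1 : (N.+1 < size l)%N by rewrite ln.
  have axs : (v N.+1).1 = (v 0%N).1.
    by apply/esym/vert_edge; [exact: last_edge|apply/eqP; rewrite hs gt_eqF // ltrDl].
  have axN : (v N).1 = (v 0%N).1.
    by rewrite -axs; apply/esym/vert_edge; [exact: edgeN|apply/eqP; rewrite hs hN gt_eqF // ltrD2l].
  split=> // i /andP[i0 iN] vi.
  have h1 := climb_le 0%N i ltac:(by rewrite /= ltnW); have h2 := climb_le i N ltac:(by rewrite leqnn ltnW).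
  have il := ltn_trans iN sizeN.
  have [e|[e|e]] : (v i).2 = (v 0%N).2 \/ (v i).2 = (v N).2 \/ (v i).2 = (v N.+1).2.
    by clear -h1 h2 hN hs; lia.
  + by move: i0; rewrite (vinj i 0%N il v0l (pt_eq _ _ vi e)).
  + have := vinj i N il sizeN (pt_eq _ _ (etrans vi (esym axN)) e).
    by move: iN => /[swap] ->; rewrite ltnn.
  + have := vinj i N.+1 il sN1 (pt_eq _ _ (etrans vi (esym axs)) e).
    by move: iN => /[swap] ->; rewrite ltnNge leqnSn.
pose V' i : V := shv R (v i).
have traceE : trace [seq shv R x | x <- l] = segs (path_to V' N ++ [:: (V' N, V' 0%N)]).
  have pathE m : [seq (shv R e.1, shv R e.2) | e <- [seq (nth 0 l i, nth 0 l i.+1) | i <- iota 0 m]]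
      = path_to V' m by rewrite -map_comp.
  rewrite trace_segs edges_map; case: top => [[ln _]|[ln hN hs]].
    by rewrite (@edges_nth _ 0 l N) // map_cat pathE.
  rewrite (@edges_nth _ 0 l N.+1) // map_cat pathE segs_cat path_toS segs_cat -setUA.
  congr setU; rewrite !segs_cons segs_nil !setU0 /=.
  have axs : (v N.+1).1 = (v 0%N).1.
    by apply/esym/vert_edge; [exact: last_edge|apply/eqP; rewrite hs gt_eqF // ltrDl].
  rewrite [RHS](@segment_split _ _ _ (1 / 2)); last by apply/andP; split; lra.
  suff -> : (1 - 1 / 2) *: V' N + (1 / 2) *: V' 0%N = V' N.+1 by [].
  have [x1 y1] : xc (V' N) = xc (V' 0%N) /\ yc (V' N) = yc (V' 0%N) by apply/shv_xy.
  have [x2 y2] : xc (V' N.+1) = xc (V' 0%N) /\ yc (V' N.+1) = yc (V' 0%N) by apply/shv_xy.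
  have z1 : zc (V' N) = zc (V' 0%N) + 2 by rewrite /V' !shv_z hN intrD.
  have z2 : zc (V' N.+1) = zc (V' 0%N) + 1 by rewrite /V' !shv_z hs intrD.
  move: (V' N) (V' 0%N) (V' N.+1) x1 y1 x2 y2 z1 z2 => u w t x1 y1 x2 y2 z1 z2.
  by apply: vecP; rewrite !(xcD, ycD, zcD, xcZ, ycZ, zcZ) ?x1 ?x2 ?y1 ?y2 ?z1 ?z2; field.
rewrite traceE.
have V'z i : zc (V' i) = (v i).2%:~R by rewrite /V' shv_z.
apply: fan_trivial => //.
- by move=> i iN; rewrite !V'z ler_int; exact: climb.
- by rewrite !V'z base.
- exact/shv_xy.
- rewrite !V'z ltr_int; case: top => [[_ ->]|[_ -> _]]; by rewrite ltrDl.
- move=> i iN; case: (dir_hor_or_ver (edge_v i iN)) => [/eqP|[/eqP + _]]; rewrite subr_eq0 => /eqP e.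
    by left; rewrite !V'z e.
  by right; apply/shv_xy.
- move=> i iN; apply/eqP => /shv_inj /vinj e.
  by have := e (ltn_trans iN sizeN) (ltN i iN) => /eqP; rewrite -[X in X == _]addn0 -addn1 eqn_add2l.
- move=> i j q /andP[ij jN] qi qj; have iN := ltn_trans ij jN.
  have ein m : (m < N)%N -> (V' m, V' m.+1) \in edges [seq shv R x | x <- l].
    by move=> mN; rewrite edges_map (map_f (fun e => (shv R e.1, shv R e.2)) (edgeN _ (ltN m mN))).
  have Vinj a b : (a < size l)%N -> (b < size l)%N -> V' a = V' b -> a = b.
    by move=> al' bl /shv_inj; exact: vinj.
  have li := ltn_trans iN sizeN; have lj := ltn_trans jN sizeN.
  have ne : (V' i, V' i.+1) <> (V' j, V' j.+1).
    by case=> /(Vinj _ _ li lj) e _; move: ij; rewrite e ltnn.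
  have [[->|qE] /= qj'] := el _ _ (ein i iN) (ein j jN) ne q qi qj.
    case: qj' => [/(Vinj _ _ li lj) e|/(Vinj _ _ li (ltN j jN)) e].
      by move: ij; rewrite e ltnn.
    by move: ij; rewrite e ltnNge leqnSn.
  move: qj'; rewrite qE => -[/(Vinj _ _ (ltN i iN) lj) e|/(Vinj _ _ (ltN i iN) (ltN j jN)) [e]].
    by rewrite /= e.
  by move: ij; rewrite e ltnn.
- by move=> i iN /shv_xy; exact: axis.
- move=> i q i0 iN qi.
  apply: (@edge_off_axis R (v 0%N) (v i) (v i.+1)) => //.
  + by apply: edge_v; exact: ltnW.
  + by apply: axis; rewrite i0 ltnW.
  + exact: axis.
Qed.

End Climb.

(** * Few vertical edges *)

Section HeightRuns.
Implicit Types (x y b : int) (s W : seq int).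

Definition changes x s := count id (pairmap (fun a b : int => a != b) x s).
Definition smooth x s := path (fun a b : int => `|a - b| <= 1) x s.

Lemma changes_dist x s : smooth x s -> `|last x s - x| <= (changes x s)%:Z.
Proof.
rewrite /smooth /changes; elim: s x => [|y s IH] x /=; first by rewrite subrr.
move=> /andP[xy /IH]; move: (count _ _) (last _ _) => c z.
by case: eqVneq xy => [->|_] /=; lia.
Qed.

Lemma next_run y W b : y != b -> smooth y (rcons W b) ->
  (exists2 k, W = nseq k y & `|y - b| <= 1) \/
  exists k y' W', [/\ W = nseq k y ++ y' :: W', y' != y /\ `|y - y'| <= 1,
    smooth y' (rcons W' b) & changes y (rcons W b) = (changes y' (rcons W' b)).+1].
Proof.
rewrite /smooth /changes => yb; elim: W => [|a W IH] /=.
  by rewrite andbT => h; left; exists 0%N.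
move=> /andP[ya sm]; have [ay|ay] := eqVneq a y.
  rewrite ay in sm *; rewrite /= add0n; case: (IH sm) => [[k -> h]|[k [y' [W' [-> h1 h2 h3]]]]].
    by left; exists k.+1.
  by right; exists k.+1, y', W'.
by right; exists 0%N, a, W.
Qed.

(** Heights change by 1 at a time, and only the ends have the height [b]; so both
    a second summit and the height [b + 3] would take at least six changes. *)
Lemma one_summit b T : (0 < size T)%N -> all (fun h => b < h) T ->
  smooth b (rcons T b) -> (changes b (rcons T b) <= 5)%N ->
  (exists k, T = nseq k.+1 (b + 1)) \/
  exists k1 k2 k3, T = nseq k1.+1 (b + 1) ++ nseq k2.+1 (b + 2) ++ nseq k3.+1 (b + 1).
Proof.
case: T => // t T _ /= /andP[bt Tb]; rewrite /smooth /changes /= => /andP[st sm].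
have tE : t = b + 1 by clear -bt st; lia.
have -> : b != t by rewrite tE; clear; lia.
rewrite -/(changes _ _) add1n ltnS => c4.
have tb : t != b by rewrite tE; clear; lia.
have [[k -> _]|[k1 [y [W [TE [yt ty] smy cy]]]]] := next_run tb sm.
  by left; exists k; rewrite tE.
right; move: c4 Tb; rewrite cy TE all_cat /= ltnS => c3 /and3P[_ yb Wb].
have yE : y = b + 2 by clear -tE yt ty yb; lia.
have yb' : y != b by rewrite yE; clear; lia.
have [[k _]|[k2 [z [W2 [WE [zy yz] smz cz]]]]] := next_run yb' smy.
  by rewrite yE; clear; lia.
move: c3 Wb; rewrite cz WE all_cat /= ltnS => c2 /and3P[_ zb W2b].
have dz := changes_dist smz; rewrite last_rcons in dz.
have zE : z = b + 1 by clear -yE zy yz zb dz c2; lia.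
have zb' : z != b by rewrite zE; clear; lia.
have [[k3 W2E _]|[k3 [u [W3 [W2E [uz zu] smu cu]]]]] := next_run zb' smz.
  by exists k1, k2, k3; rewrite tE yE W2E zE.
move: c2 W2b; rewrite cu W2E all_cat /= ltnS => c1 /and3P[_ ub _].
have du := changes_dist smu; rewrite last_rcons in du.
by clear -zE uz zu ub du c1; lia.
Qed.

Lemma changes_nseq m b s : changes b (nseq m b ++ s) = changes b s.
Proof. by rewrite /changes; elim: m => //= m ->; rewrite eqxx. Qed.

Lemma smooth_nseq m b s : smooth b (nseq m b ++ s) = smooth b s.
Proof. by rewrite /smooth; elim: m => //= m ->; rewrite subrr normr0. Qed.

Lemma count_link x s y : count (fun e : int * int => e.1 != e.2) (link (x :: s) y)
  = changes x (rcons s y).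
Proof. by rewrite /link /changes /=; elim: s x => [|z s IH] x //=; rewrite IH. Qed.

Lemma all_link x s y : all (fun e : int * int => `|e.1 - e.2| <= 1) (link (x :: s) y)
  = smooth x (rcons s y).
Proof. by rewrite /link /smooth /=; elim: s x => [|z s IH] x //=; rewrite IH. Qed.
End HeightRuns.

Lemma single_arc_alternate bs p1 p2 p3 p4 : single_arc bs ->
  (p1 < p2 < p3)%N -> (p3 < p4 < size bs)%N ->
  nth false bs p1 -> ~~ nth false bs p2 -> nth false bs p3 -> ~~ nth false bs p4 -> False.
Proof.
move=> [r [m [f e]]] /andP[p12 p23] /andP[p34 p4n] b1 b2 b3 b4.
pose n := size bs.
have [r' r'n {}e] : exists2 r', (r' <= n)%N & rot r' bs = nseq m true ++ nseq f.+1 false.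
  case: (leqP r n) => h; first by exists r.
  by exists 0%N; rewrite ?rot0 // -e rot_oversize // ltnW.
have idx p : (p < n)%N -> exists2 i, nth false bs p = (i < m)%N &
    ((r' <= p)%N /\ (i + r' = p)%N) \/ ((p < r')%N /\ (i + r' = p + n)%N).
  move=> pn.
  have bsE : bs = rotr r' (nseq m true ++ nseq f.+1 false) by rewrite -e rotK.
  have val i : nth false (rot r' bs) i = (i < m)%N.
    rewrite e nth_cat size_nseq !nth_nseq; case: ltnP => // _; exact: if_same.
  case: (leqP r' p) => rp.
    exists (p - r')%N; last by left; rewrite subnK.
    by rewrite -val /rot nth_cat size_drop ltn_sub2r ?(leq_ltn_trans rp) // nth_drop subnKC.
  exists (p + n - r')%N; last first.
    by right; split=> //; rewrite subnK // (leq_trans r'n) // leq_addl.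
  have h : (n - r' <= p + n - r')%N by apply: leq_sub2r; exact: leq_addl.
  rewrite -val /rot nth_cat size_drop ltnNge h /= -addnBA // -/n addnK.
  by rewrite nth_take.
have [i1 e1 h1] := idx p1 ltac:(clear -p12 p23 p34 p4n; rewrite /n; lia).
have [i2 e2 h2] := idx p2 ltac:(clear -p12 p23 p34 p4n; rewrite /n; lia).
have [i3 e3 h3] := idx p3 ltac:(clear -p12 p23 p34 p4n; rewrite /n; lia).
have [i4 e4 h4] := idx p4 p4n.
rewrite e1 in b1; rewrite e2 in b2; rewrite e3 in b3; rewrite e4 in b4.
rewrite -!leqNgt in b2 b4.
move: p12 p23 p34 p4n b1 b2 b3 b4 h1 h2 h3 h4; rewrite -/n; clear; lia.
Qed.

Lemma polygon_rot D r l : polygon D l -> polygon D (rot r l).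
Proof.
move=> [ul sl al ar]; split.
- by rewrite rot_uniq.
- by rewrite size_rot.
- by rewrite rot_cycle.
- move=> k; rewrite map_rot level_bits_rot mem_rot => /ar.
  exact: single_arc_rot.
Qed.

Lemma count_steps_rot P r l : count_steps P (rot r l) = count_steps P l.
Proof. by rewrite /count_steps edges_rot; apply/permP; rewrite perm_rot. Qed.

Section Lowest.
Variables (l : seq pt) (b : int).
Hypothesis poly : polygon sh_dirs l.
Hypothesis low : forall v : pt, v \in l -> b <= v.2.
Notation n := (size l).

Definition lev j := ((vtx l j).2 == b) && ((vtx l j.+1).2 == b).

Lemma vtx_mem j : vtx l j \in l.
Proof. by rewrite /vtx mem_nth // ltn_mod (n_gt0 poly). Qed.

(** A lowest vertex cannot have two vertical edges: they would coincide. *)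
Lemma lowest_level j : (vtx l j.+1).2 = b -> lev j || lev j.+1.
Proof.
move=> hj; rewrite /lev hj eqxx andbT /=.
have h0 := low (vtx_mem j); have h2 := low (vtx_mem j.+2).
have := no_return poly j; move: (step_dir poly j) (step_dir poly j.+1).
have hS i : (vtx l i.+1).2 = (vtx l i).2 + (step l i).2 by rewrite {1}(vtxS l i).
move: (hS j) (hS j.+1); rewrite hj.
move: (step l j) (step l j.+1) => d e d2 e2 /dir_hor_or_ver dD /dir_hor_or_ver eD.
case: dD => [d0 _|[d1 dv]]; first by apply/orP; left; apply/eqP; clear -d2 d0; lia.
case: eD => [e0 _|[e1 ev]]; first by apply/orP; right; apply/eqP; clear -e2 e0; lia.
have dE : d.2 = -1 by clear -d2 h0 dv; lia.
have eE : e.2 = 1 by clear -e2 h2 ev; lia.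
by move=> /eqP[]; case: d e d1 e1 dE eE {dv ev d2 e2} => ? ? [? ?] /= -> -> -> ->.
Qed.

Lemma level_bits_vtx : level_bits [seq v.2 | v <- l] b = [seq lev j | j <- iota 0 n].
Proof. by rewrite /level_bits edges_map (edges_vtx l) -!map_comp. Qed.

Lemma lev_mod i j : i = j %[mod n] -> lev i = lev j.
Proof. by move=> e; rewrite /lev (vtx_mod e) (vtx_mod (modS e)). Qed.

Lemma has_level : (exists2 v, v \in l & v.2 = b) -> true \in level_bits [seq v.2 | v <- l] b.
Proof.
move=> [v vl vb]; pose i := (index v l + n).-1.
have iE : i.+1 = (index v l + n)%N by rewrite prednK // addn_gt0 (n_gt0 poly) orbT.
have vi : vtx l i.+1 = v.
  by rewrite iE /vtx modnDr modn_small ?index_mem // nth_index.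
have mem_lev j : lev j -> true \in level_bits [seq v.2 | v <- l] b.
  move=> lj; rewrite level_bits_vtx; apply/mapP; exists (j %% n)%N.
    by rewrite mem_iota add0n ltn_mod (n_gt0 poly).
  by rewrite (@lev_mod _ j) ?modn_mod.
by have /orP[] := @lowest_level i ltac:(by rewrite vi); exact: mem_lev.
Qed.

(** By [lowest_level], a vertex at the lowest height is the end of an edge in the
    lowest level, so all vertices after that level are higher. *)
Lemma lowest_heights m f :
  level_bits [seq v.2 | v <- l] b = nseq m.+1 true ++ nseq f.+1 false ->
  exists T, [/\ [seq v.2 | v <- l] = nseq m.+2 b ++ T, all (fun h => b < h) T & (0 < size T)%N].
Proof.
rewrite level_bits_vtx => e.
have nE : n = (m.+1 + f.+1)%N.
  by have := congr1 size e; rewrite size_map size_iota size_cat !size_nseq.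
have levE i : (i < n)%N -> lev i = (i < m.+1)%N.
  move=> ni; have := congr1 (nth false ^~ i) e.
  rewrite (nth_map 0%N) ?size_iota // nth_iota // add0n => ->.
  by rewrite nth_cat size_nseq !nth_nseq; case: ltnP => // _; rewrite if_same.
have hE i : (i < n)%N -> nth 0 [seq v.2 | v <- l] i = (vtx l i).2.
  by move=> ni; rewrite (nth_map 0) // /vtx modn_small.
have mn : (m.+1 < n)%N by rewrite nE addnS ltnS leq_addr.
have hlow i : (i <= m.+1)%N -> (vtx l i).2 = b.
  rewrite leq_eqVlt ltnS => /orP[/eqP ->|im].
    by have := levE m (ltnW mn); rewrite ltnSn => /andP[_ /eqP].
  by have := levE i (leq_ltn_trans im (ltnW mn)); rewrite ltnS im => /andP[/eqP].
have hhigh i : (m.+1 < i < n)%N -> b < (vtx l i).2.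
  move=> /andP[]; case: i => // i mi ni; rewrite lt_neqAle low ?vtx_mem // andbT.
  apply/eqP => /esym /lowest_level; rewrite !levE //; last exact: ltnW.
  by move: mi; clear; lia.
exists (drop m.+2 [seq v.2 | v <- l]); split.
- rewrite -{1}(cat_take_drop m.+2 [seq v.2 | v <- l]); congr (_ ++ _).
  apply: (@eq_from_nth _ 0); first by rewrite size_take size_map size_nseq; move: mn; clear; case: ifP; lia.
  move=> i; rewrite size_take size_map => isz.
  have im : (i < m.+2)%N by move: isz; clear; case: ifP; lia.
  by rewrite nth_take // nth_nseq im hE ?hlow // (leq_trans im).
- apply/(all_nthP 0) => i; rewrite size_drop size_map => ni.
  have ni' : (m.+2 + i < n)%N by rewrite addnC -ltn_subRL -?addnBA //; move: ni; lia.
  by rewrite nth_drop hE // hhigh // ni' andbT addSn ltnS leq_addr.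
- rewrite size_drop size_map subn_gt0 ltn_neqAle mn andbT; apply/eqP => mE.
  have := levE m.+1 mn; rewrite ltnn /lev hlow // eqxx /=.
  have -> : vtx l m.+2 = vtx l 0 by apply: vtx_mod; rewrite mE modnn mod0n.
  by rewrite hlow // eqxx.
Qed.
End Lowest.

Section FewLevels.
Variable R : realType.
Notation V := 'rV[R]_3.

Lemma nth_nseq_cat (T : Type) (x0 x : T) k s i :
  nth x0 (nseq k x ++ s) i = if (i < k)%N then x else nth x0 s (i - k).
Proof. by rewrite nth_cat size_nseq; case: ifP => // ik; rewrite nth_nseq ik. Qed.

Lemma two_levels_trivial l m k b : loop R l ->
  [seq v.2 | v <- l] = nseq m.+2 b ++ nseq k.+1 (b + 1) ->
  trivial_knot (trace [seq shv R v | v <- l]).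
Proof.
move=> ll hs.
have ln : size l = (m + k).+3.
  have := congr1 size hs; rewrite size_map size_cat !size_nseq => ->; clear; lia.
have hE i : (i < size l)%N -> (nth 0 l i).2 = if (i < m.+2)%N then b else b + 1.
  move=> il; rewrite -(nth_map _ 0) // hs nth_nseq_cat nth_nseq.
  by case: ltnP => // h; case: ifP => //; rewrite ln in il; move: il h; clear; lia.
apply: (@climb_trivial R l (m + k).+2) => //.
- left; rewrite !hE ?ln //; split=> //=; rewrite ifF //; clear; lia.
- move=> i iN.
  have i1 : (i < size l)%N by rewrite ln; move: iN; clear; lia.
  have i2 : (i.+1 < size l)%N by rewrite ln; move: iN; clear; lia.
  rewrite (hE _ i1) (hE _ i2).
  by case: ltnP => h1; case: ltnP => h2 //; [rewrite lerDl|move: h1 h2; clear; lia].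
- by rewrite !hE ?ln.
Qed.

Lemma three_levels_trivial l m k1 k2 b : loop R l ->
  [seq v.2 | v <- l] = nseq m.+2 b ++ nseq k1.+1 (b + 1) ++ nseq k2.+1 (b + 2) ++ [:: b + 1] ->
  trivial_knot (trace [seq shv R v | v <- l]).
Proof.
move=> ll hs.
have ln : size l = (m + k1 + k2).+4.+1.
  have := congr1 size hs; rewrite size_map !size_cat !size_nseq /= => ->; clear; lia.
have hE i : (i < size l)%N -> (nth 0 l i).2 = if (i < m.+2)%N then b else
    if (i < m + k1 + 3)%N then b + 1 else if (i < (m + k1 + k2).+4)%N then b + 2 else b + 1.
  move=> il; rewrite -(nth_map _ 0) // hs !nth_nseq_cat.
  case: ltnP => // h1; have -> : (i - m.+2 < k1.+1)%N = (i < m + k1 + 3)%N by move: h1; clear; lia.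
  case: ltnP => // h2.
  have -> : (i - m.+2 - k1.+1 < k2.+1)%N = (i < (m + k1 + k2).+4)%N by move: h1 h2; clear; lia.
  case: ltnP => // h3.
  by have -> : (i - m.+2 - k1.+1 - k2.+1 = 0)%N by rewrite ln in il; move: il; clear; lia.
apply: (@climb_trivial R l (m + k1 + k2).+3) => //.
- right; rewrite !hE ?ln //; split=> //=.
    have -> : ((m + k1 + k2).+3 < m.+2)%N = false by clear; lia.
    have -> : ((m + k1 + k2).+3 < m + k1 + 3)%N = false by clear; lia.
    by rewrite ltnSn.
  have -> : ((m + k1 + k2).+4 < m.+2)%N = false by clear; lia.
  have -> : ((m + k1 + k2).+4 < m + k1 + 3)%N = false by clear; lia.
  by rewrite ltnn.
- move=> i iN.
  have i1 : (i < size l)%N by rewrite ln; move: iN; clear; lia.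
  have i2 : (i.+1 < size l)%N by rewrite ln; move: iN; clear; lia.
  rewrite (hE _ i1) (hE _ i2) {i1 i2}.
  by do ![case: ltnP => ?]; rewrite ?lexx ?lerDl ?lerD2l //; exfalso; lia.
- by rewrite !hE ?ln.
Qed.

(** Starting at the lowest level, the heights run through [b], [b + 1] and
    possibly [b + 2] and [b + 1] again. In the latter case one of the two runs at
    height [b + 1] is a single vertex, as otherwise both would contain edges
    although this level is one arc; up to reversal it is the second one, and the
    polygon comes straight down. *)
Theorem few_vertical_trivial l : polygon sh_dirs l -> loop R l ->
  (count_steps vertical l <= 5)%N -> trivial_knot (trace [seq shv R v | v <- l]).
Proof.
move=> pl ll c5.
have [x xl xmin] : exists2 x : pt, x \in l & forall v : pt, v \in l -> x.2 <= v.2.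
  have : (0 < size l)%N by exact: n_gt0 pl.
  elim: l {pl ll c5} => // x [|y s] IH _.
    by exists x; rewrite ?mem_head // => v; rewrite inE => /eqP ->.
  have [z zs zmin] := IH isT.
  case: (lerP x.2 z.2) => xz.
    exists x; rewrite ?mem_head // => v; rewrite in_cons => /orP[/eqP -> //|/zmin].
    exact: le_trans.
  exists z; first by rewrite in_cons zs orbT.
  move=> v; rewrite in_cons => /orP[/eqP ->|/zmin //].
  exact: ltW.
pose b := x.2.
have lev : true \in level_bits [seq v.2 | v <- l] b.
  by apply: has_level => //; exists x.
have [r [m [f e]]] := polygon_arcs pl lev.
case: m e => [|m] e.
  by move: lev; rewrite -(mem_rot r) e mem_cat !mem_nseq.
have pl1 := polygon_rot r pl; have ll1 := loop_rot r ll.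
rewrite -(trace_rot r) -map_rot; rewrite -(count_steps_rot vertical r) in c5.
rewrite -level_bits_rot -map_rot in e.
have low1 (v : pt) : v \in rot r l -> b <= v.2 by rewrite mem_rot; exact: xmin.
move: (rot r l) pl1 ll1 c5 e low1 => {pl ll lev xl xmin}l pl ll c5 e low1.
have [T [hs Tb T0]] := lowest_heights pl low1 e.
have linkE : edges [seq v.2 | v <- l] = link (b :: (nseq m.+1 b ++ T)) b.
  by rewrite hs edges_link.
have c5' : (changes b (rcons T b) <= 5)%N.
  move: c5; rewrite -(changes_nseq m.+1) -rcons_cat -count_link -linkE edges_map count_map.
  apply: leq_trans; rewrite /count_steps; apply: sub_count => y /=.
  by rewrite /vertical /hor /= subr_eq0 eq_sym.
have smT : smooth b (rcons T b).
  rewrite -(smooth_nseq m.+1) -rcons_cat -all_link -linkE edges_map all_map.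
  apply/allP => y /(edge_dir pl) /dir_hor_or_ver yd /=; rewrite distrC.
  by move: yd; rewrite [(y.2 - y.1).2]/= => -[->|[_ [->|->]]].
have [[k TE]|[k1 [k2 [k3 TE]]]] := one_summit T0 Tb smT c5'.
  by apply: (@two_levels_trivial l m k b) => //; rewrite hs TE.
rewrite TE in hs.
have [k30|k3n] := posnP k3.
  by apply: (@three_levels_trivial l m k1 k2 b) => //; rewrite hs k30.
have [k10|k1n] := posnP k1.
  pose A := nseq k3.+1 (b + 1) ++ nseq k2.+1 (b + 2) ++ [:: b + 1].
  rewrite -trace_rev -map_rev -(trace_rot (size A)) -map_rot.
  apply: (@three_levels_trivial _ m k3 k2 b).
    by apply: loop_rot; exact: loop_rev.
  rewrite map_rot map_rev hs k10 !rev_cat !rev_nseq.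
  rewrite (_ : (_ ++ _) ++ nseq m.+2 b = A ++ nseq m.+2 b) ?rot_size_cat //.
  by rewrite /A -!catA.
(* Otherwise the middle level would consist of two arcs. *)
exfalso; pose h i := nth 0 [seq v.2 | v <- l] i.
have ln : size l = (m + k1 + k2 + k3).+4.+1.
  have := congr1 size hs; rewrite size_map !size_cat !size_nseq => ->; clear; lia.
have hE i : (i < size l)%N -> h i = if (i < m.+2)%N then b else
    if (i < m + k1 + 3)%N then b + 1 else if (i < (m + k1 + k2).+4)%N then b + 2 else b + 1.
  move=> il; rewrite /h hs !nth_nseq_cat nth_nseq.
  case: ltnP => // h1; have -> : (i - m.+2 < k1.+1)%N = (i < m + k1 + 3)%N by move: h1; clear; lia.
  case: ltnP => // h2.
  have -> : (i - m.+2 - k1.+1 < k2.+1)%N = (i < (m + k1 + k2).+4)%N by move: h1 h2; clear; lia.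
  case: ltnP => // h3; rewrite ifT //.
  by rewrite ln in il; move: il h1 h2 h3; clear; lia.
have bitE i : (i < size l)%N -> nth false (level_bits [seq v.2 | v <- l] (b + 1)) i =
    (h i == b + 1) && (h (i.+1 %% size l)%N == b + 1).
  move=> il; rewrite /level_bits (nth_map (0, 0)) ?size_edges ?size_map //.
  by rewrite /edges nth_zip ?size_rot // nth_rot1 ?size_map.
have bits_size : size (level_bits [seq v.2 | v <- l] (b + 1)) = size l.
  by rewrite size_map size_edges size_map.
have p1 : nth false (level_bits [seq v.2 | v <- l] (b + 1)) m.+2.
  have i1 : (m.+2 < size l)%N by rewrite ln; clear; lia.
  have i2 : (m.+3 < size l)%N by rewrite ln; clear; lia.
  rewrite bitE // modn_small // !hE // ltnn.
  have -> : (m.+2 < m + k1 + 3)%N by clear; lia.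
  have -> : (m.+3 < m.+2)%N = false by clear; lia.
  have -> : (m.+3 < m + k1 + 3)%N by move: k1n; clear; lia.
  by rewrite eqxx.
have p2 : ~~ nth false (level_bits [seq v.2 | v <- l] (b + 1)) (m + k1 + 3).
  have i1 : (m + k1 + 3 < size l)%N by rewrite ln; clear; lia.
  rewrite bitE // (hE _ i1) ltnn.
  have -> : (m + k1 + 3 < m.+2)%N = false by clear; lia.
  have -> : (m + k1 + 3 < (m + k1 + k2).+4)%N by clear; lia.
  by rewrite (inj_eq (addrI b)).
have p3 : nth false (level_bits [seq v.2 | v <- l] (b + 1)) (size l).-2.
  have i1 : ((size l).-2 < size l)%N by rewrite ln; clear; lia.
  have i2 : ((size l).-2.+1 < size l)%N by rewrite ln; clear; lia.
  rewrite bitE // modn_small // !hE // ln /=.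
  have -> : ((m + k1 + k2 + k3).+3 < m.+2)%N = false by clear; lia.
  have -> : ((m + k1 + k2 + k3).+3 < m + k1 + 3)%N = false by clear; lia.
  have -> : ((m + k1 + k2 + k3).+3 < (m + k1 + k2).+4)%N = false by move: k3n; clear; lia.
  have -> : ((m + k1 + k2 + k3).+4 < m.+2)%N = false by clear; lia.
  have -> : ((m + k1 + k2 + k3).+4 < m + k1 + 3)%N = false by clear; lia.
  have -> : ((m + k1 + k2 + k3).+4 < (m + k1 + k2).+4)%N = false by clear; lia.
  by rewrite eqxx.
have p4 : ~~ nth false (level_bits [seq v.2 | v <- l] (b + 1)) (size l).-1.
  have i1 : ((size l).-1 < size l)%N by rewrite ln; clear; lia.
  have i2 : (0 < size l)%N by rewrite ln.
  rewrite bitE // prednK // modnn (hE _ i2) /=.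
  have -> : (b == b + 1) = false by clear; lia.
  by rewrite andbF.
have lev : true \in level_bits [seq v.2 | v <- l] (b + 1).
  by rewrite -p1 mem_nth // bits_size ln; clear; lia.
apply: (single_arc_alternate (polygon_arcs pl lev) _ _ p1 p2 p3 p4).
- by rewrite ln; move: k1n k3n; clear; lia.
- by rewrite bits_size ln; clear; lia.
Qed.

End FewLevels.

(** * The inequality *)

Lemma polygon_loop (R : realType) l : polygon sh_dirs l -> embedded [seq shv R v | v <- l] ->
  loop R l.
Proof.
move=> pl el; split=> //; first exact: polygon_uniq pl.
  exact: polygon_size pl.
by move=> e; exact: edge_dir.
Qed.

(** With [v], [d] and [h] the numbers of vertical, diagonal and other horizontal
    edges among [n], the staircase has at most [v + 4 * d + 2 * h] edges. As
    [v + 3 * d <= n] after rotation, three times this number is at most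
    [8 * n - 5 * v], and [5 * v] is at least 30. *)
Theorem short_cubic_polygon (R : realType) l : polygon sh_dirs l -> loop R l ->
  ~ trivial_knot (trace [seq shv R v | v <- l]) ->
  exists l', [/\ polygon cub_dirs l', (3 * size l' + 30 <= 8 * size l)%N
    & ambient_isotopic (trace [seq shv R v | v <- l]) (trace [seq cub R v | v <- l'])].
Proof.
move=> pl ll knotted.
have v6 : (5 < count_steps vertical l)%N.
  by rewrite ltnNge; apply/negP => /(few_vertical_trivial pl ll).
have [l' [pl' sl' vl' dl' iso]] := few_diagonals R pl.
exists (stair l'); split; first exact: stair_polygon.
  have := size_stair pl'; rewrite sum_weight // => ls.
  have cs := count_steps_size pl'.
  rewrite -sl'; rewrite -vl' in v6; move: ls cs v6 dl'.
  move: (size _) (size _) (count_steps _ _) (count_steps _ _) (count_steps _ _) (count_steps _ _).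
  by clear; lia.
apply: ambient_isotopic_trans (trace_sh_dbl R l) _.
exact: ambient_isotopic_trans iso (stair_isotopic R pl').
Qed.

Theorem proposition4p10 (R : realType) (K : set 'rV[R]_3)
    (tameK : tame_knot K) (nontrivialK : ~ trivial_knot K) :
  (e_sh K >= (3%:E * e_L K + 30%:E) / 8%:E)%E.
Proof.
have [reps|/nonemptyPn noreps] := pselect (representatives sh_lattice (sh_hor R) K !=set0); last first.
  by rewrite /e_sh /min_edge_length noreps image_set0 ereal_inf0 leey.
have [p [[lp lev pK] _ eK]] := min_edge_lengthP reps.
rewrite /e_sh eK.
have [l pE pl] := sh_polygonP lp lev.
have ll : loop R l.
  by apply: polygon_loop => //; rewrite -pE; apply: simple_closed_embedded; case: lp.
have [|l' [pl' short iso]] := short_cubic_polygon pl ll.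
  rewrite -pE => triv; apply: nontrivialK.
  exact: ambient_isotopic_trans (ambient_isotopic_sym pK) triv.
have eL : (e_L K <= (size l')%:R%:E)%E.
  apply: ereal_inf_lbound; exists [seq cub R v | v <- l']; last by rewrite size_map.
  have [lq levq] := cubic_polygon R pl'.
  by split=> //; apply: ambient_isotopic_trans (ambient_isotopic_sym iso) _; rewrite -pE.
rewrite inver pnatr_eq0 /= lee_pdivrMr // pE size_map.
have eL3 : (3%:E * e_L K <= 3%:E * (size l')%:R%:E)%E.
  by rewrite lee_pmul2l // lte_fin.
apply: (le_trans (leeD2r _ eL3)).
by rewrite -!EFinM -EFinD lee_fin -!natrM -natrD ler_nat [(size l * 8)%N]mulnC.
Qed.
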